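(* Let $R\in\mathbb{R}$ and suppose that $u(x),\rho(x)\in C_b([R,\infty))$ (bounded continuous functions), that $u(x)$ has a finite number of local extremes and that $\rho(x)>0$. Let $\rho_0>0$, $u_0\in\mathbb{R}$ and consider a partition $\{Y_i\}_{i\in\mathbb{N}_0}$ of $[R,\infty)$, $Y_0=R$, such that $C\sqrt[3]{\varepsilon}\ge Y_i-Y_{i-1}\ge\sqrt[3]{\varepsilon}$, $i=1,2,\ldots$, $C\ge 1$. For $\varepsilon>0$ small enough there exists an admissible global solution $U^\varepsilon=(\rho^\varepsilon,u^\varepsilon)$ (in the approximated sense, produced by the shadow wave tracking procedure) to the pressureless gas system with initial data $(\rho,u)(x,0)=(\rho_0,u_0)$ for $x\le R$ and $(\rho,u)(x,0)=(\rho(x),u(x))$ for $x>R$.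
   Context: System: $\partial_t\rho+\partial_x(\rho u)=0$, $\partial_t(\rho u)+\partial_x(\rho u^2)=0$, $\rho\ge 0$. The letters $\rho,u$ denote both the initial functions of $x$ and the solution. Approximate initial data: given the partition $\{Y_i\}$ (depending on $\varepsilon$), set $(\rho_i,u_i)=(\rho(Y_i),u(Y_i))$ for $i\ge1$; $U^\varepsilon(x,0)=(\rho_{i+1},u_{i+1})$ for $x\in(Y_i,Y_{i+1}]$, $i\in\mathbb{N}_0$, and $U^\varepsilon(x,0)=(\rho_0,u_0)$ for $x\le R$. Riemann problems. At each $(Y_i,0)$, with left state $(\rho_i,u_i)$ and right state $(\rho_{i+1},u_{i+1})$: if $u_i=u_{i+1}$, a contact discontinuity $x=Y_i+u_it$; if $u_i<u_{i+1}$, two contact discontinuities $x=Y_i+u_it$ and $x=Y_i+u_{i+1}t$ separated by a vacuum region $\mathrm{Vac}_{i,i+1}$, in which $\rho=0$ and the velocity is a continuous function equal to $u_i$ and $u_{i+1}$ on the two bounding lines; if $u_i>u_{i+1}$, a simple shadow wave with constant speed $y_{i,i+1}=\frac{\sqrt{\rho_i}u_i+\sqrt{\rho_{i+1}}u_{i+1}}{\sqrt{\rho_i}+\sqrt{\rho_{i+1}}}$ and strength $\sqrt{\rho_i\rho_{i+1}}(u_i-u_{i+1})t$. Shadow waves. A shadow wave starting at $(X,T)$ with adjacent states $(\rho_l,u_l)$, $(\rho_r,u_r)$ has central line $x=c(t)$, $c(T)=X$, speed $c'(t)=u_s(t)$ and strength $\xi(t)$ solving $\xi'=(\rho_r-\rho_l)u_s-(\rho_ru_r-\rho_lu_l)$,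 $(\xi u_s)'=(\rho_ru_r-\rho_lu_l)u_s-(\rho_ru_r^2-\rho_lu_l^2)$ for $t>T$. In $U^\varepsilon$ it is represented by an intermediate state $(\rho_\varepsilon(t),u_\varepsilon(t))$ on $|x-c(t)|<\frac{\varepsilon}{2}(t-T)+x_\varepsilon$, where $x_\varepsilon\sim\varepsilon$ ($x_\varepsilon=0$ if $T=0$), $\rho_\varepsilon\sim\varepsilon^{-1}$, $u_\varepsilon(t)\to u_s(t)$ and $(\varepsilon(t-T)+2x_\varepsilon)\rho_\varepsilon(t)\to\xi(t)$ as $\varepsilon\to0$. If the left (right) neighbouring region is a vacuum $\mathrm{Vac}_{l-1,l}$ ($\mathrm{Vac}_{r,r+1}$), then one takes $\rho_l=0$ with velocity $u_l$ ($\rho_r=0$ with velocity $u_r$). Interactions (tracking procedure). Waves propagate until the (central) lines of two or more of them meet at some $(X,T)$. The interacting waves are replaced by a single shadow wave starting at $(X,T)$, whose left state is the left state of the leftmost and whose right state is the right state of the rightmost incoming wave, with $\xi(T)$ the sum of incoming strengths and $\xi(T)u_s(T)$ the sum of (strength times speed) of incoming waves (contact discontinuities have strength zero); $x_\varepsilon$ is chosen so that the mass is continuous at $t=T$. The overlap areas of order $\varepsilon^2$ near interaction points are neglected. The procedure is repeated. Solution in the approximated sense: for every $\varphi\in C_0^\infty(\mathbb{R}\times[0,\infty))$, as $\varepsilon\to0$, $\int_0^\infty\int_{\mathbb{R}}(\rho^\varepsilon\partial_t\varphi+\rho^\varepsilon u^\varepsilon\partial_x\varphi)\,dx\,dt+\int_{\mathbb{R}}(\rho^\varepsilon\varphi)(x,0)\,dx\to0$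 and $\int_0^\infty\int_{\mathbb{R}}(\rho^\varepsilon u^\varepsilon\partial_t\varphi+\rho^\varepsilon (u^\varepsilon)^2\partial_x\varphi)\,dx\,dt+\int_{\mathbb{R}}(\rho^\varepsilon u^\varepsilon\varphi)(x,0)\,dx\to0$, and $\rho^\varepsilon(\cdot,0)$, $u^\varepsilon(\cdot,0)$ converge to the initial data in the sense of distributions. $a_\varepsilon\sim b_\varepsilon$ means $a_\varepsilon/b_\varepsilon$ tends to a positive constant. Admissibility: every wave in the solution is either a classical contact discontinuity or an overcompressive shadow wave, i.e. $u_l\ge u_s(t)\ge u_r$ for its adjacent velocities as long as it exists. *)

(* Defs.v *)
From HB Require Import structures.
From mathcomp Require Import all_boot all_order all_algebra.
From mathcomp Require Import all_classical all_reals all_analysis.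
Import Order.TTheory GRing.Theory Num.Theory.
Import numFieldNormedType.Exports.

Set Implicit Arguments.
Unset Strict Implicit.
Unset Printing Implicit Defensive.

Local Open Scope classical_set_scope.
Local Open Scope ring_scope.

Definition local_extremum (R : realType) (D : set R) (f : R -> R) (x : R) : Prop :=
  D x /\ ((\forall y \near within D (nbhs x), f y <= f x) \/
          (\forall y \near within D (nbhs x), f x <= f y)).

(* [Const i] is the region carrying the state (rho_i, u_i); [Vac i] is the
   vacuum Vac_{i,i+1} issued from Y_i. *)
Inductive region : Type := Const of nat | Vac of nat.

Section States.
Variables (R : realType) (rs us : nat -> R).

Definition dens (r : region) : R := if r is Const i then rs i else 0.

(* The velocity seen by a shadow wave having [r] on its left (resp. right):
   a vacuum Vac_{l-1,l} on the left counts as velocity u_l, a vacuum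
   Vac_{r,r+1} on the right counts as velocity u_r. *)
Definition vel_left (r : region) : R :=
  match r with Const i => us i | Vac i => us i.+1 end.
Definition vel_right (r : region) : R :=
  match r with Const i => us i | Vac i => us i end.

End States.

(* [k] = 0 is the state prescribed on the left of the half-line. *)
Definition sample (R : realType) (f0 : R) (f : R -> R) (Y : nat -> R) (k : nat) : R :=
  if k is 0 then f0 else f (Y k).

(* A wave occupies the times from [time0] to [death]. The last three fields
   matter for shadow waves only: they are the nets delta |-> x_delta,
   rho_delta(t), u_delta(t) that represent the wave by an intermediate state.
   The wave itself (line, speed, strength) does not depend on delta. *)
Record wave (R : realType) := Wave {
  is_shadow : bool;
  pos0 : R;
  time0 : R;
  death : \bar R;
  line : R -> R;
  speed : R -> R;
  strength : R -> R;
  lreg : region;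
  rreg : region;
  prof_x : R -> R;
  prof_rho : R -> R -> R;
  prof_u : R -> R -> R }.

(* [vac_u i] is the velocity in Vac_{i,i+1}, as a function of (x, t). *)
Record pattern (R : realType) := Pattern {
  front : Type;
  wv :> front -> wave R;
  vac_u : nat -> R -> R -> R }.

Section Waves.
Variable R : realType.
Implicit Types (w : wave R) (P : pattern R) (t x d : R) (r : region).

Definition alive w t : Prop := time0 w <= t /\ (t%:E < death w)%E.
Definition open_life w t : Prop := time0 w < t /\ (t%:E < death w)%E.
Definition life w : set R := [set t | time0 w <= t /\ (t%:E <= death w)%E].

Definition width d w t : R := d * (t - time0 w) + 2 * prof_x w d.

Definition strip_mass d w t : R :=
  if is_shadow w then width d w t * prof_rho w d t else 0.

Definition strip d w t x : Prop :=
  [/\ is_shadow w, alive w t &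
      `|x - line w t| < d / 2 * (t - time0 w) + prof_x w d].

Definition shadow_profile w : Prop :=
  [/\ (forall d, 0 < d -> 0 <= prof_x w d) /\
      (time0 w = 0 -> forall d, 0 < d -> prof_x w d = 0),
      0 < time0 w ->
        exists2 k : R, 0 < k & (fun d => prof_x w d / d) @ 0^'+ --> k,
      forall t, life w t -> time0 w < t ->
        exists2 k : R, 0 < k & (fun d => prof_rho w d t / d^-1) @ 0^'+ --> k,
      forall t, life w t -> (fun d => prof_u w d t) @ 0^'+ --> speed w t &
      forall t, life w t -> (fun d => strip_mass d w t) @ 0^'+ --> strength w t].

(* [in_region P x t r]: the wave next to (x,t) on one of the two sides has [r]
   on the side facing (x,t). *)
Definition in_region P x t r : Prop :=
  (exists w : front P,
     [/\ alive (P w) t, line (P w) t < x, rreg (P w) = r &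
      forall v : front P, alive (P v) t ->
        line (P v) t <= line (P w) t \/ x <= line (P v) t]) \/
  (exists w : front P,
     [/\ alive (P w) t, x < line (P w) t, lreg (P w) = r &
      forall v : front P, alive (P v) t ->
        line (P v) t <= x \/ line (P w) t <= line (P v) t]).

Definition off_lines P x t : Prop :=
  forall w : front P, alive (P w) t -> line (P w) t <> x.

End Waves.

Section Tracking.
Variables (R : realType) (Y rs us : nat -> R).
Implicit Types (w : wave R) (P : pattern R) (t x d : R).

Definition shadow_wave w : Prop :=
  let rl := dens rs (lreg w) in let ul := vel_left us (lreg w) in
  let rr := dens rs (rreg w) in let ur := vel_right us (rreg w) in
  [/\ line w (time0 w) = pos0 w,
      [/\ {within life w, continuous (line w)},
          {within life w, continuous (speed w)} &
          {within life w, continuous (strength w)}],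
      forall t, open_life w t ->
        [/\ is_derive t (1 : R) (line w) (speed w t),
            is_derive t (1 : R) (strength w)
              ((rr - rl) * speed w t - (rr * ur - rl * ul)) &
            is_derive t (1 : R) (fun s => strength w s * speed w s)
              ((rr * ur - rl * ul) * speed w t - (rr * ur ^+ 2 - rl * ul ^+ 2))] &
      shadow_profile w].

Definition contact_from (X s : R) (l r : region) : set (wave R) :=
  [set w | [/\ is_shadow w = false, pos0 w = X, time0 w = 0,
               lreg w = l /\ rreg w = r &
               forall t, [/\ line w t = X + s * t, speed w t = s &
                             strength w t = 0]]].

Definition riemann_speed (i : nat) : R :=
  (Num.sqrt (rs i) * us i + Num.sqrt (rs i.+1) * us i.+1) /
  (Num.sqrt (rs i) + Num.sqrt (rs i.+1)).

Definition simple_shadow (i : nat) : set (wave R) :=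
  [set w | [/\ is_shadow w, pos0 w = Y i, time0 w = 0,
               lreg w = Const i /\ rreg w = Const i.+1 &
               forall t, life w t ->
                 [/\ line w t = Y i + riemann_speed i * t,
                     speed w t = riemann_speed i &
                     strength w t =
                       Num.sqrt (rs i * rs i.+1) * (us i - us i.+1) * t]]].

(* The waves solving the Riemann problem at (Y_i, 0), each of them given by
   the set of wave records that describe it. *)
Definition riemann (i : nat) : set (set (wave R)) :=
  [set S | (us i = us i.+1 /\
             S = contact_from (Y i) (us i) (Const i) (Const i.+1)) \/
           (us i < us i.+1 /\
             (S = contact_from (Y i) (us i) (Const i) (Vac i) \/
              S = contact_from (Y i) (us i.+1) (Vac i) (Const i.+1))) \/
           (us i.+1 < us i /\ S = simple_shadow i)].

(* The waves [f 0], ..., [f n.+1], in this order from left to right, are exactly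
   the ones that end at the starting point of [w]. *)
Definition interaction P (n : nat) (f : 'I_n.+2 -> front P) (w : front P) : Prop :=
  let T := time0 (P w) in let X := pos0 (P w) in
  [/\ 0 < T /\ is_shadow (P w),
      (forall v : front P, (exists k, f k = v) <->
         death (P v) = T%:E /\ line (P v) T = X) /\
      (forall v : front P, time0 (P v) = T -> pos0 (P v) = X -> v = w),
      forall j k : 'I_n.+2, (j < k)%N -> forall t,
         open_life (P (f j)) t -> open_life (P (f k)) t ->
         line (P (f j)) t < line (P (f k)) t,
      lreg (P w) = lreg (P (f ord0)) /\ rreg (P w) = rreg (P (f ord_max)) &
      [/\ strength (P w) T = \sum_k strength (P (f k)) T,
          strength (P w) T * speed (P w) T =
            \sum_k strength (P (f k)) T * speed (P (f k)) T &
          forall d, 0 < d ->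
            strip_mass d (P w) T = \sum_k strip_mass d (P (f k)) T]].

Definition vacuum_velocity (i : nat) (v : R -> R -> R) : Prop :=
  {within [set z : R * R | 0 < z.2 /\
             Y i + us i * z.2 <= z.1 <= Y i + us i.+1 * z.2],
    continuous (fun z : R * R => v z.1 z.2)} /\
  (forall t, 0 < t ->
     v (Y i + us i * t) t = us i /\ v (Y i + us i.+1 * t) t = us i.+1).

(* A wave pattern obtained, for all times, by the tracking procedure. The number
   of waves is infinite, so that interactions cannot be listed in order of time:
   the pattern is described as the set of all its waves. *)
Definition tracking P : Prop :=
  [/\ (forall w : front P,
         [/\ 0 <= time0 (P w), ((time0 (P w))%:E < death (P w))%E &
             is_shadow (P w) -> shadow_wave (P w)]) /\
      (forall i, us i < us i.+1 -> vacuum_velocity i (vac_u P i)),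
      (forall i S, riemann i S -> exists w : front P, S (P w)) /\
      (forall w : front P, time0 (P w) = 0 -> exists i S, riemann i S /\ S (P w)),
      (forall w : front P, 0 < time0 (P w) ->
         exists n (f : 'I_n.+2 -> front P), interaction f w) /\
      (forall v : front P, (death (P v) < +oo)%E ->
         exists n (f : 'I_n.+2 -> front P) (w : front P), interaction f w /\ exists k, f k = v),
      forall (v w : front P) t, open_life (P v) t -> life (P w) t ->
        line (P v) t = line (P w) t -> v = w &
      (* the waves delimit regions that fill the half-plane t > 0 *)
      (forall t A : R, 0 < t ->
         finite_set [set x : R | `|x| <= A /\
           exists w : front P, alive (P w) t /\ line (P w) t = x]) /\
      (forall x t, 0 < t -> off_lines P x t -> exists! r, in_region P x t r)].

Definition admissible P : Prop :=
  forall (w : front P) t, alive (P w) t ->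
    let ul := vel_left us (lreg (P w)) in let ur := vel_right us (rreg (P w)) in
    if is_shadow (P w) then (ur <= speed (P w) t <= ul : Prop)
    else speed (P w) t = ul /\ speed (P w) t = ur.

Definition reg_vel P (r : region) (x t : R) : R :=
  match r with Const i => us i | Vac i => vac_u P i x t end.

(* The function (rhoE, uE) is the representation, with parameter [eps], of the
   pattern [P]. Strips overlap only near interaction points; there the value is
   that of one of the overlapping intermediate states. Values on contact lines
   (a null set) are left free. *)
Definition represents (eps : R) P (rhoE uE : R -> R -> R) : Prop :=
  [/\ forall x, x <= Y 0%N -> rhoE x 0 = rs 0%N /\ uE x 0 = us 0%N,
      forall i x, Y i < x <= Y i.+1 -> rhoE x 0 = rs i.+1 /\ uE x 0 = us i.+1,
      forall x t, 0 < t -> (exists w : front P, strip eps (P w) t x) ->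
        exists w : front P, [/\ strip eps (P w) t x,
          rhoE x t = prof_rho (P w) eps t & uE x t = prof_u (P w) eps t] &
      forall x t r, 0 < t -> (forall w : front P, ~ strip eps (P w) t x) ->
        off_lines P x t -> in_region P x t r ->
        rhoE x t = dens rs r /\ uE x t = reg_vel P r x t].

End Tracking.

(* Since the partition, hence the waves, vary with eps, the limits of
   [shadow_profile] (delta -> 0 for a fixed wave) say nothing about the value
   delta = eps used in [represents]. They are therefore also required to be
   uniform with respect to all waves of all patterns P eps, locally in time. *)
Definition uniform_profiles (R : realType) (eps0 : R) (P : R -> pattern R) : Prop :=
  (exists k1 k2 d0 : R, [/\ 0 < k1, 0 < d0 &
     forall (eps d : R) (w : front (P eps)), 0 < eps < eps0 -> 0 < d < d0 ->
       is_shadow (P eps w) -> 0 < time0 (P eps w) ->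
       k1 * d <= prof_x (P eps w) d <= k2 * d]) /\
  (forall tau eta : R, 0 < eta -> exists2 d0 : R, 0 < d0 &
     forall (eps d t : R) (w : front (P eps)), 0 < eps < eps0 -> 0 < d < d0 ->
       is_shadow (P eps w) -> life (P eps w) t -> t <= tau ->
       `|prof_u (P eps w) d t - speed (P eps w) t| <= eta /\
       `|strip_mass d (P eps w) t - strength (P eps w) t| <= eta).

Section Weak.
Variable R : realType.
Implicit Types (phi : R -> R -> R).

Definition dx phi : R -> R -> R := fun x t => derive1 (fun y => phi y t) x.
Definition dt phi : R -> R -> R := fun x t => derive1 (fun s => phi x s) t.

Fixpoint Cn2 (n : nat) phi : Prop :=
  continuous (fun z : R * R => phi z.1 z.2) /\
  (if n is m.+1 then
     [/\ forall x t : R, derivable (fun y => phi y t) x 1 /\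
                     derivable (fun s => phi x s) t 1,
         Cn2 m (dx phi) & Cn2 m (dt phi)]
   else True).

(* Elements of C_0^oo(R x [0,oo)) are restrictions of these. *)
Definition test_fun2 phi : Prop :=
  (forall n, Cn2 n phi) /\
  exists A : R, forall x t, A < `|x| \/ A < `|t| -> phi x t = 0.

Definition test_fun1 (psi : R -> R) : Prop :=
  (forall n (x : R), derivable (derive1n n psi) x 1) /\
  exists A : R, forall x, A < `|x| -> psi x = 0.

Local Notation mu := (@lebesgue_measure R).

(* [q] is the conserved density and [q * v] its flux. *)
Definition integrand (q v : R -> R -> R) phi (x t : R) : R :=
  q x t * dt phi x t + q x t * v x t * dx phi x t.

Definition integrable_balance (q v : R -> R -> R) phi : Prop :=
  (mu \x mu)%E.-integrable (setT `*` `[0, +oo[%classic)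
    (fun z : R * R => (integrand q v phi z.1 z.2)%:E).

Definition weak_form (q v : R -> R -> R) phi : R :=
  Rintegral mu `[0, +oo[%classic (fun t =>
    Rintegral mu setT (fun x => integrand q v phi x t)) +
  Rintegral mu setT (fun x => q x 0 * phi x 0).

(* [rhoE eps x t], [uE eps x t] for 0 < eps < eps0; (r, v) is the initial datum. *)
Definition approx_solution (eps0 : R) (rhoE uE : R -> R -> R -> R) (r v : R -> R) : Prop :=
  let q eps x t := rhoE eps x t * uE eps x t in
  [/\ forall eps x t : R, 0 < eps < eps0 -> 0 <= t -> 0 <= rhoE eps x t,
      forall phi, test_fun2 phi ->
        [/\ forall eps : R, 0 < eps < eps0 ->
              integrable_balance (rhoE eps) (uE eps) phi /\
              integrable_balance (q eps) (uE eps) phi,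
            (fun eps => weak_form (rhoE eps) (uE eps) phi) @ 0^'+ --> (0 : R) &
            (fun eps => weak_form (q eps) (uE eps) phi) @ 0^'+ --> (0 : R)] &
      forall psi, test_fun1 psi ->
        (fun eps => Rintegral mu setT (fun x => rhoE eps x 0 * psi x)) @ 0^'+ -->
          Rintegral mu setT (fun x => r x * psi x) /\
        (fun eps => Rintegral mu setT (fun x => uE eps x 0 * psi x)) @ 0^'+ -->
          Rintegral mu setT (fun x => v x * psi x)].

End Weak.

Definition jump_datum (R : realType) (a f0 : R) (f : R -> R) (x : R) : R :=
  if x <= a then f0 else f x.

(* Main.v *)
(** For piecewise constant data, [cost k y x t] is a primitive in the label [y] of
    rho (y + t u - x). It is affine in (x, t), and its minimizers in [y] are the
    labels of the particles that sit at [x] at time [t]. The front [e] separates the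
    points whose minimizers lie on the two sides of a constant or vacuum region. A
    region that has disappeared never comes back, so that maximal groups of
    coinciding fronts are the waves and all interactions, simultaneous or not, are
    obtained at once, without listing them in order of time. The minimal costs on
    the two sides of a wave agree along it; differentiating this identity gives the
    equations of shadow waves.

    For the weak formulation, integrating the test function along the particle paths
    gives an exact balance for the limit pattern. At a given time the representation
    differs from it by O(eps) per wave, unless two strips overlap. Overlap forces a
    region to be narrower than O(eps); for each region this happens during a time
    O(eps / eps^(1/3)) only, because both parts of a region next to its boundaries
    are eaten up at a rate bounded below. There are O(eps^(-1/3)) regions, hence a
    total error O(eps^(1/3)). *)

Require Import Defs.
From HB Require Import structures.
From mathcomp Require Import all_boot all_order all_algebra.
From mathcomp Require Import all_classical all_reals all_analysis.
From mathcomp Require Import measurable_realfun.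
From mathcomp Require Import zify ring lra.
Import Order.TTheory GRing.Theory Num.Theory.
Import numFieldNormedType.Exports.

Local Open Scope classical_set_scope.
Local Open Scope ring_scope.

Set Implicit Arguments.
Unset Strict Implicit.
Unset Printing Implicit Defensive.

(** Nothing is constructed forward in time: each front is defined at every time separately, as a
    supremum, and its order, its Lipschitz bound and the non-return of regions are comparisons of
    costs at two points. The obstacle is regularity, since no differential equation is solved and
    the group of a front may change. It is overcome as follows. At the label that a region assigns
    to [(x, t)] the cost is a quadratic polynomial of [(x, t)], for which the trapezoidal rule is
    exact. Equality of the costs on the two sides of a wave at times [t] and [s] then expresses the
    secant slope of its line as averaged momentum over averaged mass, which is continuous in [s];
    differentiability follows without a priori smoothness. Mass and momentum are moreover split
    front by front: front [e] carries a signed mass whose labels all have velocity [us (uphalf e)].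
    Conservation at interactions is then concatenation of sums over consecutive fronts, and the weak
    form is balanced for each front separately. Intermediate states are chosen exact (strength
    divided by width, true speed), so that the only errors of the representation come from the
    positions and overlaps of the strips. *)

Record pcdata (R : realType) := PCData {
  node : nat -> R;
  pcrho : nat -> R;
  pcu : nat -> R;
  minstep : R;
  rhomax : R;
  umax : R;
  minstep_gt0 : 0 < minstep;
  node_step : forall i, minstep <= node i.+1 - node i;
  pcrho_gt0 : forall i, 0 < pcrho i;
  pcrho_le : forall i, pcrho i <= rhomax;
  pcu_le : forall i, `|pcu i| <= umax }.

(** * Lagrangian cost *)

Section Cost.
Variables (R : realType) (D : pcdata R).
Local Notation Y := (node D).
Local Notation rs := (pcrho D).
Local Notation us := (pcu D).
Local Notation M := (umax D).
Implicit Types (x y t s : R) (g : nat -> R -> R).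

Lemma nodeS i : Y i < Y i.+1.
Proof. by have := node_step D i; have := minstep_gt0 D; lra. Qed.

Lemma node_le i j : (i <= j)%N -> Y i <= Y j.
Proof.
by move=> ij; apply: (@homo_leq _ Y (fun a b => a <= b)) ij => [||k];
  [move=> ?; exact: lexx | move=> ? ? ?; exact: le_trans | exact/ltW/nodeS].
Qed.

Lemma node_lt i j : (i < j)%N -> Y i < Y j.
Proof. by move=> ij; apply: lt_le_trans (nodeS i) (node_le ij). Qed.

Lemma node_ge k : Y 0 + k%:R * minstep D <= Y k.
Proof.
elim: k => [|k IH]; first by rewrite mul0r addr0.
by have := node_step D k; rewrite -natr1 mulrDl mul1r; lra.
Qed.

Lemma node_unbounded x : exists n, x < Y n.
Proof.
have d0 := minstep_gt0 D.
exists (Num.bound `|(x - Y 0) / minstep D|).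
apply: lt_le_trans (node_ge _).
rewrite -ltrBlDl -ltr_pdivrMr//; apply: le_lt_trans (ler_norm _) _.
by apply: archi_boundP; exact: normr_ge0.
Qed.

Lemma umax_ge0 : 0 <= M.
Proof. by apply: le_trans (pcu_le D 0); exact: normr_ge0. Qed.

Lemma pcu_bnd i : - M <= us i <= M.
Proof. by rewrite -ler_norml pcu_le. Qed.

(** Cell 0 is unbounded to the left, and cells are closed, so that a node lies in two of them;
    [cumul_eq] makes the choice immaterial. *)
Definition incell k y : Prop := (k = 0%N \/ Y k.-1 <= y) /\ y <= Y k.

Lemma incell_node k : incell k (Y k).
Proof. by split => //; case: k => [|k]; [left | right; exact: node_le]. Qed.

Lemma incellS_node k : incell k.+1 (Y k).
Proof. by split; [right | exact: node_le]. Qed.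

Lemma incell_exists y : exists k, incell k y.
Proof.
have [n yn] := node_unbounded y.
have ex : exists n, y <= Y n by exists n; exact: ltW.
case: (ex_minnP ex) => k yk kmin; exists k; split=> //.
case: k yk kmin => [|k] yk kmin; [by left | right => /=].
by rewrite leNgt; apply/negP => /ltW /kmin; rewrite ltnn.
Qed.

Lemma incell_index k k' y y' : incell k y -> incell k' y' -> y < y' -> (k <= k')%N.
Proof.
move=> [k0 yk] [k'0 yk'] yy'; rewrite leqNgt; apply/negP => k'k.
case: k0 => [k0|]; first by move: k'k; rewrite k0.
have /node_le : (k' <= k.-1)%N by lia.
by lra.
Qed.

(* [cumul g k y] is the value at [y], in cell [k], of the continuous primitive
   that coincides with [g j] up to a constant in each cell [j]. *)
Definition cumul g k y : R :=
  \sum_(i < k) (g i.+1 (Y i.+1) - g i.+1 (Y i)) + g k y - g k (Y k).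

Lemma cumul_node g k : cumul g k (Y k) = \sum_(i < k) (g i.+1 (Y i.+1) - g i.+1 (Y i)).
Proof. by rewrite /cumul addrK. Qed.

Lemma cumulS g k : cumul g k.+1 (Y k) = cumul g k (Y k).
Proof. by rewrite cumul_node /cumul big_ord_recr /=; ring. Qed.

Lemma cumul_cell g k y y' : cumul g k y' - cumul g k y = g k y' - g k y.
Proof. by rewrite /cumul; ring. Qed.


Lemma cumulN g k y : cumul (fun j b => - g j b) k y = - cumul g k y.
Proof.
rewrite /cumul.
have -> : \sum_(i < k) (- g i.+1 (Y i.+1) - - g i.+1 (Y i)) =
    - \sum_(i < k) (g i.+1 (Y i.+1) - g i.+1 (Y i)).
  by rewrite -sumrN; apply: eq_bigr => i _; ring.
by ring.
Qed.

(** The increment splits at the nodes into increments of [g j] inside single cells, so monotonicity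
    is needed only between points of one cell. *)
Lemma cumul_le g k k' y y' : incell k y -> incell k' y' -> (k <= k')%N -> y <= y' ->
  (forall j a b, incell j a -> incell j b -> y <= a -> a <= b -> b <= y' ->
     g j a <= g j b) ->
  cumul g k y <= cumul g k' y'.
Proof.
move=> + + kk'; rewrite -(subnKC kk'); move: (k' - k)%N => n {kk'}.
elim: n k y => [|n IH] k y.
  rewrite addn0 => ck ck' yy' H; rewrite -subr_ge0 cumul_cell subr_ge0.
  exact: H.
rewrite addnS -addSn => ck ck' yy' H.
have Yy' : Y k <= y'.
  by case: ck' => -[|] // + _; apply: le_trans; apply: node_le; lia.
have yY : y <= Y k by case: ck.
apply: (@le_trans _ _ (cumul g k (Y k))).
  rewrite -subr_ge0 cumul_cell subr_ge0; apply: H => //; exact: incell_node.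
rewrite -cumulS; apply: IH => //; first exact: incellS_node.
by move=> j a b ja jb ya ab by'; apply: H => //; apply: le_trans ya.
Qed.

Lemma cumul_lt g k k' y y' : incell k y -> incell k' y' -> y < y' ->
  (forall j a b, incell j a -> incell j b -> y <= a -> a < b -> b <= y' ->
     g j a < g j b) ->
  cumul g k y < cumul g k' y'.
Proof.
move=> ck ck' yy' H.
have Hle j a b : incell j a -> incell j b -> y <= a -> a <= b -> b <= y' -> g j a <= g j b.
  move=> ja jb ya; rewrite le_eqVlt => /orP[/eqP <- //|ab] by'.
  by apply/ltW/H.
have kk' := incell_index ck ck' yy'.
have [ek|nk] := eqVneq k k'.
  by subst k'; rewrite -subr_gt0 cumul_cell subr_gt0; apply: H.
have {nk}kk' : (k < k')%N by rewrite ltn_neqAle nk.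
have Yy' : Y k <= y'.
  by case: ck' => -[|] // + _; [lia|]; apply: le_trans; apply: node_le; lia.
have yY : y <= Y k by case: ck.
have [yY'|Yy] := ltP y (Y k).
  apply: (@lt_le_trans _ _ (cumul g k (Y k))).
    rewrite -subr_gt0 cumul_cell subr_gt0; apply: H => //; exact: incell_node.
  apply: cumul_le => //; [exact: incell_node|lia|].
  by move=> j a b ja jb ya ab by'; apply: Hle => //; apply: le_trans ya.
(* The part of cell [k] is reduced to a point here; strictness has to come from cell [k.+1]. *)
have {yY Yy}ey : y = Y k by apply/eqP; rewrite eq_le yY Yy.
rewrite {}ey in ck yy' H Hle *; rewrite -cumulS.
have [ek|nk] := eqVneq k.+1 k'.
  subst k'; rewrite -subr_gt0 cumul_cell subr_gt0; apply: H => //.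
  exact: incellS_node.
have {nk}kk' : (k.+1 < k')%N by rewrite ltn_neqAle nk.
have YSy' : Y k.+1 <= y'.
  by case: ck' => -[|] // + _; [lia|]; apply: le_trans; apply: node_le; lia.
apply: (@lt_le_trans _ _ (cumul g k.+1 (Y k.+1))).
  rewrite -subr_gt0 cumul_cell subr_gt0; apply: H => //;
    [exact: incellS_node|exact: incell_node|exact: nodeS].
apply: cumul_le => //; [exact: incell_node|lia|].
move=> j a b ja jb ya ab by'; apply: Hle => //; apply: le_trans ya.
exact/ltW/nodeS.
Qed.

Lemma cumul_eq g k k' y : incell k y -> incell k' y -> cumul g k y = cumul g k' y.
Proof.
move=> ck ck'.
wlog kk' : k k' ck ck' / (k <= k')%N.
  by move=> W; case: (leqP k k') => [/W->//|/ltnW/W<-].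
have key j a b : y <= a -> a <= b -> b <= y -> g j a = g j b.
  by move=> ya ab by'; congr g; apply/eqP; rewrite eq_le ab (le_trans by').
apply/eqP; rewrite eq_le; apply/andP; split.
  by apply: cumul_le => // j a b _ _ ya ab by'; rewrite (key j a b).
rewrite -lerN2.
by rewrite -!cumulN; apply: cumul_le => // j a b _ _ ya ab by'; rewrite (key j a b).
Qed.

(** Primitives in the label of the density, of density times velocity and of density times label:
    mass, momentum and first moment, normalised to vanish at [Y 0]. *)
Definition mass := cumul (fun k y => rs k * y).
Definition mom := cumul (fun k y => rs k * us k * y).
Definition mom0 := cumul (fun k y => rs k * (y ^+ 2 / 2)).

Lemma cumul_lin g1 g2 g3 c1 c2 c3 k y :
  c1 * cumul g1 k y + c2 * cumul g2 k y + c3 * cumul g3 k y =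
  cumul (fun j b => c1 * g1 j b + c2 * g2 j b + c3 * g3 j b) k y.
Proof.
rewrite /cumul !mulrBr !mulrDr.
have -> : \sum_(i < k) (c1 * g1 i.+1 (Y i.+1) + c2 * g2 i.+1 (Y i.+1) + c3 * g3 i.+1 (Y i.+1) -
   (c1 * g1 i.+1 (Y i) + c2 * g2 i.+1 (Y i) + c3 * g3 i.+1 (Y i))) =
   c1 * (\sum_(i < k) (g1 i.+1 (Y i.+1) - g1 i.+1 (Y i))) +
   c2 * (\sum_(i < k) (g2 i.+1 (Y i.+1) - g2 i.+1 (Y i))) +
   c3 * (\sum_(i < k) (g3 i.+1 (Y i.+1) - g3 i.+1 (Y i))).
  by rewrite !mulr_sumr -!big_split; apply: eq_bigr => i _ /=; ring.
by ring.
Qed.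

(* Minimizers in [y] are the labels of the particles sitting at [x] at time [t]. *)
Definition cost k y x t : R := mom0 k y + t * mom k y - x * mass k y.

Lemma costE k y x t : cost k y x t =
  cumul (fun j b => rs j * (b ^+ 2 / 2 + (t * us j - x) * b)) k y.
Proof.
rewrite /cost -[mom0 k y]mul1r -mulNr cumul_lin.
by congr cumul; apply/funext => j; apply/funext => b; ring.
Qed.

Lemma cost_cell k y y' x t :
  cost k y' x t - cost k y x t =
  rs k * ((y' - y) * ((y' + y) / 2 + t * us k - x)).
Proof. by rewrite !costE cumul_cell; field. Qed.

Lemma cost_eq k k' y x t : incell k y -> incell k' y -> cost k y x t = cost k' y x t.
Proof. by rewrite !costE; exact: cumul_eq. Qed.

Lemma mass_lt k k' y y' : incell k y -> incell k' y' -> y < y' -> mass k y < mass k' y'.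
Proof.
move=> ck ck' yy'; apply: cumul_lt => // j a b _ _ _ ab _.
by rewrite ltr_pM2l// pcrho_gt0.
Qed.

Lemma mass_le k k' y y' : incell k y -> incell k' y' -> y <= y' -> mass k y <= mass k' y'.
Proof.
move=> ck ck'; rewrite le_eqVlt => /orP[/eqP ey|yy']; last exact/ltW/mass_lt.
by rewrite ey in ck *; rewrite /mass (cumul_eq _ ck ck').
Qed.

(** The combination has label density [rs j * (c1 * y + c2 * us j + c3)]; [mom_le] and [mom0_bounds]
    choose coefficients that give it a sign. *)
Lemma lin_le (c1 c2 c3 : R) k k' y y' :
  incell k y -> incell k' y' -> y <= y' ->
  (forall j a b, y <= a -> a <= b -> b <= y' ->
    c1 * (rs j * (a ^+ 2 / 2)) + c2 * (rs j * us j * a) + c3 * (rs j * a) <=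
    c1 * (rs j * (b ^+ 2 / 2)) + c2 * (rs j * us j * b) + c3 * (rs j * b)) ->
  c1 * mom0 k y + c2 * mom k y + c3 * mass k y <=
  c1 * mom0 k' y' + c2 * mom k' y' + c3 * mass k' y'.
Proof.
move=> ck ck' yy' H; rewrite !cumul_lin.
move: yy'; rewrite le_eqVlt => /orP[/eqP ey|yy'].
  by rewrite ey in ck *; rewrite (cumul_eq _ ck ck').
apply: cumul_le => //; first exact: incell_index yy'.
  exact: ltW.
by move=> j a b _ _; exact: H.
Qed.

Lemma mass_rhomax k k' y y' : incell k y -> incell k' y' -> y <= y' ->
  mass k' y' - mass k y <= rhomax D * (y' - y).
Proof.
move=> ck ck' yy'.
have e j l : cumul (fun _ b => b) j l = l - Y 0.
  rewrite /cumul; suff -> : \sum_(i < j) (Y i.+1 - Y i) = Y j - Y 0 by ring.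
  by rewrite -(big_mkord xpredT (fun i => Y i.+1 - Y i)) telescope_sumr.
have : 0 * cumul (fun _ b => b) k y + rhomax D * cumul (fun _ b => b) k y + (-1) * mass k y <=
  0 * cumul (fun _ b => b) k' y' + rhomax D * cumul (fun _ b => b) k' y' + (-1) * mass k' y'.
  rewrite !cumul_lin; move: yy'; rewrite le_eqVlt => /orP[/eqP ey|yy'].
    by rewrite ey in ck *; rewrite (cumul_eq _ ck ck').
  apply: cumul_le => //; [exact: incell_index yy'|exact: ltW|].
  move=> j a b _ _ _ ab _; have := pcrho_le D j.
  by rewrite -subr_ge0 => h; rewrite -subr_ge0; nra.
by rewrite !e; nra.
Qed.

Lemma mom_le k k' y y' : incell k y -> incell k' y' -> y <= y' ->
  `|mom k' y' - mom k y| <= M * (mass k' y' - mass k y).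
Proof.
move=> ck ck' yy'; rewrite ler_norml.
have h1 : 0 * mom0 k y + 1 * mom k y + M * mass k y <=
          0 * mom0 k' y' + 1 * mom k' y' + M * mass k' y'.
  apply: lin_le => // j a b _ ab _.
  have /andP[u1 u2] := pcu_bnd j; have r0 := pcrho_gt0 D j.
  have : 0 <= (b - a) * (us j + M) by apply: mulr_ge0; lra.
  by move/(mulr_ge0 (ltW r0)) => h; rewrite -subr_ge0; lra.
have h2 : 0 * mom0 k y + (-1) * mom k y + M * mass k y <=
          0 * mom0 k' y' + (-1) * mom k' y' + M * mass k' y'.
  apply: lin_le => // j a b _ ab _.
  have /andP[u1 u2] := pcu_bnd j; have r0 := pcrho_gt0 D j.
  have : 0 <= (b - a) * (M - us j) by apply: mulr_ge0; lra.
  by move/(mulr_ge0 (ltW r0)) => h; rewrite -subr_ge0; lra.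
by apply/andP; split; lra.
Qed.

Lemma mom0_bounds k k' y y' : incell k y -> incell k' y' -> y <= y' ->
  y * (mass k' y' - mass k y) <= mom0 k' y' - mom0 k y <= y' * (mass k' y' - mass k y).
Proof.
move=> ck ck' yy'.
have h1 : 1 * mom0 k y + 0 * mom k y + (- y) * mass k y <=
          1 * mom0 k' y' + 0 * mom k' y' + (- y) * mass k' y'.
  apply: lin_le => // j a b ya ab _; have r0 := pcrho_gt0 D j.
  have : 0 <= (b - a) * ((a + b) / 2 - y) by apply: mulr_ge0; lra.
  by move/(mulr_ge0 (ltW r0)) => h; rewrite -subr_ge0; lra.
have h2 : (-1) * mom0 k y + 0 * mom k y + y' * mass k y <=
          (-1) * mom0 k' y' + 0 * mom k' y' + y' * mass k' y'.
  apply: lin_le => // j a b ya ab by'; have r0 := pcrho_gt0 D j.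
  have : 0 <= (b - a) * (y' - (a + b) / 2) by apply: mulr_ge0; lra.
  by move/(mulr_ge0 (ltW r0)) => h; rewrite -subr_ge0; lra.
by apply/andP; split; lra.
Qed.

(** At time 0 the label density of the cost is [rs j * (b - y)], negative on the left of [y] and
    positive on its right. *)
Lemma cost0_lt k k' y y' : incell k y -> incell k' y' -> y' != y ->
  cost k y y 0 < cost k' y' y 0.
Proof.
move=> ck ck'; rewrite neq_lt => /orP[yy'|yy'].
- rewrite -ltrN2.
  rewrite !costE -!cumulN; apply: cumul_lt => // j a b _ _ _ ab by'.
  have r0 := pcrho_gt0 D j.
  have : 0 < (b - a) * (y - (a + b) / 2) by apply: mulr_gt0; lra.
  by move/(mulr_gt0 r0) => h; rewrite -subr_gt0; lra.
- rewrite !costE; apply: cumul_lt => // j a b _ _ ya ab _.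
  have r0 := pcrho_gt0 D j.
  have : 0 < (b - a) * ((a + b) / 2 - y) by apply: mulr_gt0; lra.
  by move/(mulr_gt0 r0) => h; rewrite -subr_gt0; lra.
Qed.

(** Finite speed of propagation: the label density [rs j * (b + t * us j - x)] of the cost has a
    known sign as soon as [b] is farther than [t * M] from [x]. *)
Lemma cost_incr k k' y y' x t : incell k y -> incell k' y' -> 0 <= t ->
  x + t * M <= y -> y < y' -> cost k y x t < cost k' y' x t.
Proof.
move=> ck ck' t0 xy yy'; rewrite !costE; apply: cumul_lt => // j a b _ _ ya ab _.
have r0 := pcrho_gt0 D j.
have /andP[u1 _] := pcu_bnd j.
have tu : - (t * M) <= t * us j by rewrite -mulrN ler_wpM2l.
have : 0 < (b - a) * ((a + b) / 2 + t * us j - x) by apply: mulr_gt0; lra.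
by move/(mulr_gt0 r0) => h; rewrite -subr_gt0; lra.
Qed.

Lemma cost_decr k k' y y' x t : incell k y -> incell k' y' -> 0 <= t ->
  y' <= x - t * M -> y < y' -> cost k' y' x t < cost k y x t.
Proof.
move=> ck ck' t0 xy yy'; rewrite -ltrN2.
rewrite !costE -!cumulN; apply: cumul_lt => // j a b _ _ ya ab by'.
have r0 := pcrho_gt0 D j.
have /andP[_ u1] := pcu_bnd j.
have tu : t * us j <= t * M by rewrite ler_wpM2l.
have : 0 < (b - a) * (x - (a + b) / 2 - t * us j) by apply: mulr_gt0; lra.
by move/(mulr_gt0 r0) => h; rewrite -subr_gt0; lra.
Qed.

End Cost.

(** * Minimizing labels *)

Lemma nat_argmin (R : realType) (f : nat -> R) n :
  exists2 i, (i <= n)%N & forall j, (j <= n)%N -> f i <= f j.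
Proof.
elim: n => [|n [i ile imin]].
  by exists 0%N => // j; rewrite leqn0 => /eqP ->.
case: (lerP (f i) (f n.+1)) => h.
- exists i; first exact: leq_trans ile _.
  by move=> j; rewrite leq_eqVlt => /orP[/eqP -> //|]; exact: imin.
- exists n.+1 => // j; rewrite leq_eqVlt => /orP[/eqP -> //|/imin]; exact/le_trans/ltW.
Qed.

Section Argmin.
Variables (R : realType) (D : pcdata R).
Local Notation Y := (node D).
Local Notation rs := (pcrho D).
Local Notation us := (pcu D).
Local Notation M := (umax D).
Local Notation incell := (incell D).
Local Notation cost := (cost D).
Implicit Types (x y t s : R).

Definition argmin x t y : Prop :=
  exists2 k, incell k y & forall k' y', incell k' y' -> cost k y x t <= cost k' y' x t.

Lemma argmin_le x t y k k' y' : argmin x t y -> incell k y -> incell k' y' ->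
  cost k y x t <= cost k' y' x t.
Proof. by move=> [j jy H] ky ky'; rewrite (cost_eq _ _ ky jy); exact: H. Qed.

(** The vertex [x - t * us k] of the parabola [cost k], projected onto cell [k]: the minimizer
    within that cell. *)
Definition clamp k x t : R :=
  let c := Num.min (Y k) (x - t * us k) in
  if k is 0 then c else Num.max (Y k.-1) c.

Lemma incell_clamp k x t : incell k (clamp k x t).
Proof.
rewrite /clamp; case: k => [|k] /=.
  by split; [left | rewrite ge_min lexx].
split; first by right; rewrite le_max lexx.
by rewrite ge_max ge_min lexx /= ltW // nodeS.
Qed.

Lemma clamp_spec k x t :
  (clamp k x t < Y k -> x - t * us k <= clamp k x t) /\
  ((k = 0%N \/ Y k.-1 < clamp k x t) -> clamp k x t <= x - t * us k).
Proof.
have Yk := nodeS D k.-1; rewrite /clamp; move: (x - t * us k) => c.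
case: k Yk => [|k] /= Yk.
- by case: (lerP (Y 0) c) => h; split => //; lra.
- case: (lerP (Y k.+1) c) => h1; case: (lerP (Y k) _) => h2; split => // h3;
    try lra; by case: h3 => //; lra.
Qed.

Lemma clamp_min k x t y : incell k y -> cost k (clamp k x t) x t <= cost k y x t.
Proof.
have [cY c0] := clamp_spec k x t; have [ci1 ci2] := incell_clamp k x t.
move=> [y0 yY]; rewrite -subr_ge0 cost_cell; apply: mulr_ge0; first exact/ltW/pcrho_gt0.
set c := clamp k x t in cY c0 ci1 ci2 *; set w := t * us k in cY c0 *.
have [yc|yc|->] := ltgtP y c.
- rewrite -[leRHS]mulrNN; apply: mulr_ge0; first lra.
  by have /c0 : k = 0%N \/ Y k.-1 < c; [case: y0; [left|move=> ?; right; lra]|lra].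
- by apply: mulr_ge0; first lra; have /cY : c < Y k; lra.
- by rewrite subrr mul0r.
Qed.

(** Beyond a node to the right of [x + t * M] the cost increases, which leaves finitely many cells,
    each with its own minimizer [clamp]. *)
Lemma argmin_exists x t : 0 <= t -> exists y, argmin x t y.
Proof.
move=> t0; have [n xn] := node_unbounded D (x + t * M).
have [i ile imin] := nat_argmin (fun i => cost i (clamp i x t) x t) n.
exists (clamp i x t), i; first exact: incell_clamp.
move=> k y ky; have [kn|nk] := leqP k n.
  exact: le_trans (imin _ kn) (clamp_min _ _ ky).
apply: le_trans (imin n (leqnn n)) _.
apply: le_trans (clamp_min _ _ (incell_node D n)) _.
have Yy : Y n <= y by case: ky => -[k0|+] _; [lia|apply: le_trans; apply: node_le; lia].
move: Yy; rewrite le_eqVlt => /orP[/eqP Yy|Yy].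
  by rewrite Yy (@cost_eq _ _ n k)// -Yy; exact: incell_node.
by apply/ltW/(cost_incr (incell_node D n) ky t0 (ltW xn)).
Qed.

(** Passing from [x] to [x'] lowers the cost of the larger label relative to the smaller one by
    [x' - x] times their mass difference, which is strictly positive. *)
Lemma argmin_mono x x' t y y' : x < x' -> argmin x t y -> argmin x' t y' -> y <= y'.
Proof.
move=> xx' [k ky H] [k' ky' H']; rewrite leNgt; apply/negP => y'y.
have := H _ _ ky'; have := H' _ _ ky; have := mass_lt ky' ky y'y.
rewrite /cost; set a := mass _ _ _; set b := mass _ _ _ => ab h1 h2.
by have : 0 < (x' - x) * (b - a); [apply: mulr_gt0; lra | lra].
Qed.

Lemma argmin_bnd x t y : 0 <= t -> argmin x t y -> x - t * M <= y <= x + t * M.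
Proof.
move=> t0 [k ky H]; apply/andP; split; rewrite leNgt; apply/negP => h.
- have [k' ky'] := incell_exists D (x - t * M).
  by have := cost_decr ky ky' t0 (lexx _) h; rewrite ltNge H.
- have [k' ky'] := incell_exists D (x + t * M).
  by have := cost_incr ky' ky t0 (lexx _) h; rewrite ltNge H.
Qed.

Lemma argmin_clamp x t y k : argmin x t y -> incell k y -> y = clamp k x t.
Proof.
move=> am ky; have := argmin_le am ky (incell_clamp k x t).
have [cY c0] := clamp_spec k x t; have [ci1 ci2] := incell_clamp k x t.
rewrite -subr_ge0 cost_cell pmulr_rge0 ?pcrho_gt0//; case: ky => y0 yY.
set c := clamp k x t in cY c0 ci1 ci2 *; set w := t * us k in cY c0 *.
have [yc|yc|->//] := ltgtP y c => h; exfalso.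
- have h1 : c <= x - w by apply: c0; case: y0; [left|move=> ?; right; lra].
  suff : (c - y) * ((c + y) / 2 + w - x) < 0 by lra.
  by rewrite nmulr_llt0; lra.
- have h1 : x - w <= c by apply: cY; lra.
  suff : (c - y) * ((c + y) / 2 + w - x) < 0 by lra.
  by rewrite pmulr_llt0; lra.
Qed.

(** First-order optimality on the side where cell [k] continues beyond [y]: the free path
    [y + t * us k] bounds [x]. *)
Lemma argmin_right x t y k : argmin x t y -> incell k y -> y < Y k -> x <= y + t * us k.
Proof. by move=> am ky yY; have [+ _] := clamp_spec k x t; rewrite -(argmin_clamp am ky); lra. Qed.

Lemma argmin_left x t y k : argmin x t y -> incell k y -> k = 0%N \/ Y k.-1 < y ->
  y + t * us k <= x.
Proof.
move=> am ky yY; have [_] := clamp_spec k x t; rewrite -(argmin_clamp am ky).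
by move/(_ yY); lra.
Qed.

(** A node can be left through either of its two cells, so both first-order conditions hold;
    together they describe the vacuum fan issued from [Y i]. *)
Lemma argmin_node x t i : argmin x t (Y i) ->
  Y i + t * us i <= x <= Y i + t * us i.+1.
Proof.
move=> am; apply/andP; split.
- apply: (argmin_left am (incell_node D i)); case: i {am} => [|i]; first by left.
  by right; exact: nodeS.
- by apply: (argmin_right am (incellS_node D i)); exact: nodeS.
Qed.

(* The cost is affine in [(x, t)], hence a convex combination of the costs at the
   ends of the segment from [(y, 0)] to [(x, t)]. *)
Lemma argmin_backward x t y s k' y' : 0 < t -> 0 <= s < t -> argmin x t y ->
  y' != y -> incell k' y' ->
  exists2 k, incell k y & cost k y (y + s / t * (x - y)) s < cost k' y' (y + s / t * (x - y)) s.
Proof.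
move=> t0 /andP[s0 st] am yy' ky'; have [k ky H] := am; exists k => //.
have cv j l : cost j l (y + s / t * (x - y)) s =
    (1 - s / t) * cost j l y 0 + s / t * cost j l x t.
  by rewrite /cost; field; rewrite gt_eqF.
have h0 := cost0_lt ky ky' yy'; have h1 := H _ _ ky'.
have st1 : 0 < 1 - s / t by rewrite subr_gt0 ltr_pdivrMr ?mul1r.
have st0 : 0 <= s / t by rewrite divr_ge0// ltW.
by rewrite !cv; apply: ltr_leD; [rewrite ltr_pM2l | rewrite ler_wpM2l].
Qed.

(** Strictness is inherited from the end at time 0, so the minimizer is unique along the segment
    before time [t]. This is what carries information about a region backward in time. *)
Lemma argmin_backward_eq x t y s y' : 0 < t -> 0 <= s < t -> argmin x t y ->
  argmin (y + s / t * (x - y)) s y' <-> y' = y.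
Proof.
move=> t0 st am; split => [am'|->].
- apply/eqP; apply/negPn/negP => yy'.
  have [k' ky' H] := am'; have [k ky] := argmin_backward t0 st am yy' ky'.
  by rewrite ltNge H.
- have [k ky H] := am; exists k => // k' y'' ky''.
  have [ey|ny] := eqVneq y'' y.
    by rewrite ey in ky'' *; rewrite (cost_eq _ _ ky ky'').
  have [j jy /ltW] := argmin_backward t0 st am ny ky''.
  by rewrite (cost_eq _ _ jy ky).
Qed.

End Argmin.

(** * Fronts and regions *)

Section Fronts.
Variables (R : realType) (D : pcdata R).
Local Notation Y := (node D).
Local Notation rs := (pcrho D).
Local Notation us := (pcu D).
Local Notation M := (umax D).
Local Notation incell := (incell D).
Local Notation cost := (cost D).
Local Notation argmin := (argmin D).
Implicit Types (x y t s : R) (e k : nat).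

(* Region [2 i] is Const i and region [2 i + 1] is Vac i; front [e] separates
   region [e] from region [e + 1]. *)
Definition left_of e x t : Prop :=
  if odd e then exists2 y, argmin x t y & y <= Y e./2
  else forall y, argmin x t y -> y < Y e./2.

(** A supremum exists without any knowledge of regularity. As [left_of] is stable under moving to
    the left, it holds at every point below the supremum and fails above it. *)
Definition front_pos e t : R := sup [set x | left_of e x t].
Local Notation z := front_pos.

Lemma left_of_down e x x' t : 0 <= t -> x' < x -> left_of e x t -> left_of e x' t.
Proof.
move=> t0 x'x; rewrite /left_of; case: ifP => _.
- move=> [y am yY]; have [y' am'] := argmin_exists D x' t0; exists y' => //.
  exact: le_trans (argmin_mono x'x am' am) yY.
- move=> H y' am'; have [y am] := argmin_exists D x t0.
  exact: le_lt_trans (argmin_mono x'x am' am) (H _ am).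
Qed.

Lemma left_of_low e x t : 0 <= t -> x < Y e./2 - t * M -> left_of e x t.
Proof.
move=> t0 xY; rewrite /left_of; case: ifP => _.
- have [y am] := argmin_exists D x t0; exists y => //.
  by have /andP[_] := argmin_bnd t0 am; lra.
- by move=> y am; have /andP[_] := argmin_bnd t0 am; lra.
Qed.

Lemma left_of_high e x t : 0 <= t -> left_of e x t -> x <= Y e./2 + t * M.
Proof.
move=> t0; rewrite /left_of; case: ifP => _.
- by move=> [y am yY]; have /andP[] := argmin_bnd t0 am; lra.
- have [y am] := argmin_exists D x t0 => /(_ _ am).
  by have /andP[] := argmin_bnd t0 am; lra.
Qed.

Lemma left_of_has_sup e t : 0 <= t -> has_sup [set x | left_of e x t].
Proof.
move=> t0; split; first by exists (Y e./2 - t * M - 1); apply: left_of_low => //; lra.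
by exists (Y e./2 + t * M) => x; exact: left_of_high.
Qed.

Lemma left_of_le e x t : 0 <= t -> left_of e x t -> x <= z e t.
Proof. by move=> t0 H; apply: ub_le_sup => //; case: (left_of_has_sup e t0). Qed.

Lemma lt_left_of e x t : 0 <= t -> x < z e t -> left_of e x t.
Proof.
move=> t0 /(sup_gt (proj1 (left_of_has_sup e t0)))[x' H xx'].
exact: left_of_down xx' H.
Qed.

Lemma front_pos_le e t c : 0 <= t -> (forall x, left_of e x t -> x <= c) -> z e t <= c.
Proof. by move=> t0 H; apply: ge_sup => //; case: (left_of_has_sup e t0). Qed.

Lemma front_pos_bnd e t : 0 <= t -> Y e./2 - t * M <= z e t <= Y e./2 + t * M.
Proof.
move=> t0; apply/andP; split.
- by apply/unstable.ler_ltP => x xY; apply: left_of_le => //; apply: left_of_low.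
- by apply: front_pos_le => // x; exact: left_of_high.
Qed.

Lemma front_pos0 e : z e 0 = Y e./2.
Proof. by have := front_pos_bnd e (lexx 0); rewrite mul0r subr0 addr0 => /andP[? ?]; lra. Qed.


Lemma front_posS e t : 0 <= t -> z e t <= z e.+1 t.
Proof.
move=> t0; apply/unstable.ler_ltP => x xz; apply: left_of_le => //.
(* For odd [e] membership at a point beyond [x] is needed, because [argmin_mono] compares minimizers
   at distinct positions only. *)
have /(lt_left_of t0) : (x + z e t) / 2 < z e t by lra.
have := lt_left_of t0 xz; rewrite /left_of /= uphalf_half; case: (odd e) => /=.
- move=> _ [y am yY] y' am'.
  apply: (le_lt_trans (argmin_mono (x' := (x + z e t) / 2) _ am' am)); first lra.
  apply: le_lt_trans yY _; exact: nodeS.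
- by move=> H _; have [y am] := argmin_exists D x t0; exists y => //; apply: ltW; exact: H.
Qed.

Lemma front_pos_mono e e' t : 0 <= t -> (e <= e')%N -> z e t <= z e' t.
Proof.
move=> t0 /subnKC <-; elim: (e' - e)%N => [|n IH]; first by rewrite addn0.
by rewrite addnS; exact: le_trans IH (front_posS _ t0).
Qed.

(** Momentum differences are at most [M] times mass differences. Hence, as time runs, labels on the
    right become relatively dearer along lines of slope [-M] and cheaper along lines of slope [M];
    being to the left of a front is preserved forward along the former and backward along the
    latter. *)
Lemma front_pos_lip1 e s t : 0 <= s -> s <= t ->
  z e s - M * (t - s) <= z e t <= z e s + M * (t - s).
Proof.
move=> s0 st; have t0 := le_trans s0 st.
have key k k' y y' x : incell k y -> incell k' y' -> y <= y' ->
    cost k' y' x s - cost k y x s <= cost k' y' (x - M * (t - s)) t - cost k y (x - M * (t - s)) t.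
  move=> ky ky' yy'; have := mom_le ky ky' yy'; rewrite ler_norml /cost => /andP[h _].
  have : 0 <= (t - s) * (mom D k' y' - mom D k y + M * (mass D k' y' - mass D k y)).
    by apply: mulr_ge0; lra.
  by lra.
have key' k k' y y' x : incell k y -> incell k' y' -> y <= y' ->
    cost k' y' (x + M * (t - s)) t - cost k y (x + M * (t - s)) t <= cost k' y' x s - cost k y x s.
  move=> ky ky' yy'; have := mom_le ky ky' yy'; rewrite ler_norml /cost => /andP[_ h].
  have : 0 <= (t - s) * (M * (mass D k' y' - mass D k y) - (mom D k' y' - mom D k y)).
    by apply: mulr_ge0; lra.
  by lra.
(* a minimizer at the earlier (resp. later) time beats all labels on its right *)
have step x a a' : 0 <= a -> 0 <= a' -> forall x',
   (forall k k' y y', incell k y -> incell k' y' -> y <= y' ->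
     cost k' y' x a - cost k y x a <= cost k' y' x' a' - cost k y x' a') ->
   left_of e x a -> left_of e x' a'.
  move=> a0 a'0 x' H; rewrite /left_of; case: ifP => _.
  - move=> [y am yY]; have [y' am'] := argmin_exists D x' a'0.
    have [yy'|yy'] := ltP y y'; last by exists y' => //; apply: le_trans yY.
    exists y => //; have [k ky Hk] := am; have [k' ky' Hk'] := am'.
    exists k => // j w jw; apply: le_trans (Hk' _ _ jw).
    by have := H _ _ _ _ ky ky' (ltW yy'); have := Hk _ _ ky'; lra.
  - move=> Hl y' am'; have [y am] := argmin_exists D x a0.
    rewrite ltNge; apply/negP => Yy'; have yY := Hl _ am.
    have [k ky Hk] := am; have [k' ky' Hk'] := am'.
    have := H _ _ _ _ ky ky' (ltW (lt_le_trans yY Yy')); have := Hk' _ _ ky; have := Hk _ _ ky'.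
    move=> h1 h2 h3.
    suff /Hl : argmin x a y' by rewrite ltNge Yy'.
    by exists k' => // j w jw; apply: le_trans (Hk _ _ jw); lra.
apply/andP; split.
- rewrite lerBlDr; apply: front_pos_le => // x lx; rewrite -lerBlDr.
  apply: left_of_le => //; apply: (step x s t) => // k k' y y'; exact: key.
- apply: front_pos_le => // x lx; rewrite -lerBlDr.
  apply: left_of_le => //; apply: (step x t s) => // k k' y y' ky ky' yy'.
  by have := key' _ _ _ _ (x - M * (t - s)) ky ky' yy'; rewrite subrK.
Qed.

Lemma front_pos_lip e s t : 0 <= s -> 0 <= t -> `|z e t - z e s| <= M * `|t - s|.
Proof.
move=> s0 t0; wlog st : s t s0 t0 / s <= t.
  move=> W; have [/W->//|/ltW/W] := leP s t.
  by rewrite distrC (distrC s); exact.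
rewrite (ger0_norm (x := t - s)) ?subr_ge0// ler_norml.
by have /andP[? ?] := front_pos_lip1 e s0 st; apply/andP; split; lra.
Qed.

Definition alive_reg k t : Prop := k = 0%N \/ z k.-1 t < z k t.

Definition in_reg k x t : Prop := (k = 0%N \/ z k.-1 t <= x) /\ x <= z k t.

(** The label that region [k] assigns to [(x, t)]: the foot of the characteristic in a constant
    region, the node emitting the fan in a vacuum. It is evaluated on the bounding fronts as
    well. *)
Definition edge k x t : R := if odd k then Y k./2 else x - t * us k./2.

(** Membership confines the minimizer to an open cell, where the two first-order conditions
    determine it, or to the node. The midpoints with the bounding fronts provide the second
    positions that [argmin_mono] requires. *)
Lemma region_interior k x t y : 0 <= t -> (k = 0%N \/ z k.-1 t < x) -> x < z k t ->
  argmin x t y -> y = edge k x t /\ incell k./2 y.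
Proof.
move=> t0 zx xz am.
have xz' : (x + z k t) / 2 < z k t by lra.
have xx' : x < (x + z k t) / 2 by lra.
have [y' am'] := argmin_exists D ((x + z k t) / 2) t0.
have yy' := argmin_mono xx' am am'.
have := lt_left_of t0 xz'; rewrite /left_of /edge.
case: zx => [k0|zx].
  subst k => /= /(_ _ am') y'Y.
  have ky : incell 0 y by split; [left | rewrite ltW// (le_lt_trans yy')].
  split => //.
  have := argmin_right am ky (le_lt_trans yy' y'Y).
  by have := argmin_left am ky (or_introl erefl); rewrite /=; lra.
case: k zx xz xz' xx' am' yy' => [|k] zx xz xz' xx' am' yy'.
  by exfalso; move: zx xz => /=; lra.
have zx2 : z k t < (x + z k t) / 2 by move: zx => /=; lra.
have x2x : (x + z k t) / 2 < x by move: zx => /=; lra.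
have nl : ~ left_of k ((x + z k t) / 2) t by move/(left_of_le t0); lra.
have nl2 : ~ left_of k x t by move/(left_of_le t0); move: zx => /=; lra.
move: nl nl2; rewrite /left_of /= uphalf_half; case: (odd k) => /= nl nl2.
- move=> /(_ _ am') y'Y.
  have Yy : Y k./2 < y by rewrite ltNge; apply/negP => h; apply: nl2; exists y.
  have ky : incell k./2.+1 y by split; [right; exact: ltW | exact/ltW/(le_lt_trans yy')].
  split=> //.
  have := argmin_right am ky (le_lt_trans yy' y'Y).
  by have := argmin_left am ky (or_intror Yy); rewrite add1n; lra.
- move=> [y3 am3 y3Y]; have yY : y <= Y k./2 := le_trans (argmin_mono xx' am am3) y3Y.
  suff Yy : Y k./2 <= y.
    have -> : y = Y k./2 by lra.
    by split => //; exact: incell_node.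
  rewrite leNgt; apply/negP => yY'; apply: nl => w amw.
  exact: le_lt_trans (argmin_mono x2x amw am) yY'.
Qed.

Lemma ge0_closure (f : R -> R) (a b x : R) : a < b -> continuous f ->
  (forall w, a < w -> w < b -> 0 <= f w) -> a <= x -> x <= b -> 0 <= f x.
Proof.
move=> ab cf H ax xb; rewrite leNgt; apply/negP => fx0.
have /nbhs_ballP[d /= d0 Hd] : \forall w \near x, f w < 0.
  exact: (cvgr_lt _ (cf x)).
have [w [aw wb wx]] : exists w, [/\ a < w, w < b & `|x - w| < d].
  pose q := Num.min (d / 2) ((b - a) / 4).
  have [q1 q2] : q <= d / 2 /\ q <= (b - a) / 4 by rewrite !ge_min !lexx orbT.
  have q0 : 0 < q by rewrite lt_min; apply/andP; split; lra.
  have [xm|xm] := leP x ((a + b) / 2).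
  - exists (x + q); split; [lra|lra|].
    by rewrite opprD addNKr normrN gtr0_norm; lra.
  - exists (x - q); split; [lra|lra|].
    by rewrite opprB addrC subrK gtr0_norm; lra.
by have := Hd w wx; have := H w aw wb; lra.
Qed.

Lemma continuous_quad (a b c : R) : continuous (fun x : R => a + b * x + c * x ^+ 2).
Proof.
move=> x; apply: cvgD; first apply: cvgD; [exact: cvg_cst | |].
- by apply: cvgM; [exact: cvg_cst | exact: cvg_id].
- by apply: cvgM; [exact: cvg_cst | apply: cvgM; exact: cvg_id].
Qed.

Lemma quad_closure (p q r a b x : R) : a < b ->
  (forall w, a < w -> w < b -> 0 <= p + q * w + r * w ^+ 2) -> a <= x -> x <= b ->
  0 <= p + q * x + r * x ^+ 2.
Proof. by move=> ab; apply: ge0_closure => //; exact: continuous_quad. Qed.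

(** The interior statement extends to the closed region: with [t] fixed, [edge] is affine in [x], so
    every condition is a quadratic inequality in [x], preserved by closure. *)
Lemma region_edge k x t : 0 <= t -> alive_reg k t -> in_reg k x t ->
  incell k./2 (edge k x t) /\
  forall k' y', incell k' y' -> cost k./2 (edge k x t) x t <= cost k' y' x t.
Proof.
move=> t0 ak [zx xz].
(* An open interval inside the region with [x] in its closure. Region 0 has no left front, hence the
   arbitrary [x - 1]. *)
have [a [ab ax za]] : exists a, [/\ a < z k t, a <= x & k = 0%N \/ z k.-1 t <= a].
  case: ak => [k0|ak].
    by exists (x - 1); split; [lra|lra|left].
  case: zx => [k0|zx]; first by exists (x - 1); split; [lra|lra|left].
  by exists (z k.-1 t); split => //; right.
have int w : a < w -> w < z k t -> incell k./2 (edge k w t) /\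
    forall k' y', incell k' y' -> cost k./2 (edge k w t) w t <= cost k' y' w t.
  move=> aw wz; have [y am] := argmin_exists D w t0.
  have zw : k = 0%N \/ z k.-1 t < w by case: za => [|za]; [left|right; lra].
  have [ey ky] := region_interior t0 zw wz am; rewrite -ey; split => // k' y'.
  exact: argmin_le.
have lin (f : R -> R) p q r : (forall w, f w = p + q * w + r * w ^+ 2) ->
    (forall w, a < w -> w < z k t -> 0 <= f w) -> 0 <= f x.
  move=> fE H; rewrite fE; apply: (quad_closure ab _ ax xz) => w aw wz.
  by rewrite -fE; exact: H.
have edE : exists p q, forall w, edge k w t = p + q * w.
  rewrite /edge; case: (odd k); first by exists (Y k./2); exists 0 => w; rewrite mul0r addr0.
  by exists (- (t * us k./2)); exists 1 => w; rewrite mul1r addrC.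
have [p [q edE']] := edE.
split.
  split.
  - have [k0|k0] := eqVneq k./2 0%N; first by left.
    right; rewrite -subr_ge0.
    apply: (lin (fun w => edge k w t - Y k./2.-1) (p - Y k./2.-1) q 0).
      by move=> w; rewrite edE'; ring.
    move=> w aw wz; rewrite subr_ge0.
    by have [[[k00|//] _] _] := int w aw wz; rewrite k00 in k0.
  - rewrite -subr_ge0; apply: (lin (fun w => Y k./2 - edge k w t) (Y k./2 - p) (- q) 0).
      by move=> w; rewrite edE'; ring.
    by move=> w aw wz; rewrite subr_ge0; have [[_ h] _] := int w aw wz.
move=> k' y' ky'; rewrite -subr_ge0.
pose c0 : R := cost k' y' 0 t - cost k./2 (Y k./2) 0 t
  - rs k./2 * ((p - Y k./2) * ((p + Y k./2) / 2 + t * us k./2)).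
pose c1 : R := mass D k./2 (Y k./2) - mass D k' y'
  - rs k./2 * (q * ((p + Y k./2) / 2 + t * us k./2) + (p - Y k./2) * (q / 2 - 1)).
pose c2 : R := - (rs k./2 * (q * (q / 2 - 1))).
apply: (lin (fun w => cost k' y' w t - cost k./2 (edge k w t) w t) c0 c1 c2).
  move=> w; rewrite edE' -[cost k./2 _ w t](subrK (cost k./2 (Y k./2) w t)) cost_cell.
  by rewrite /c0 /c1 /c2 /cost; field.
by move=> w aw wz; rewrite subr_ge0; have [_ h] := int w aw wz; exact: h.
Qed.

Lemma region_argmin k x t : 0 <= t -> alive_reg k t -> in_reg k x t ->
  argmin x t (edge k x t).
Proof. by move=> t0 ak ir; have [ci H] := region_edge t0 ak ir; exists k./2. Qed.

Lemma edge_interior_sub k x t : 0 < t -> (k = 0%N \/ z k.-1 t < x) -> x < z k t ->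
  argmin x t (edge k x t).
Proof.
move=> t0 zx xz; have [y am] := argmin_exists D x (ltW t0).
by have [<-] := region_interior (ltW t0) zx xz am.
Qed.

(** Converse of [region_interior]: a unique minimizer makes the existential and the universal clause
    of [left_of] agree, and its place tells the region. *)
Lemma unique_label_region k s x y : 0 <= s -> (forall w, argmin x s w -> w = y) ->
  (if odd k then y = Y k./2 else (k = 0%N \/ Y k./2.-1 < y) /\ y < Y k./2) ->
  (k = 0%N \/ z k.-1 s <= x) /\ x <= z k s.
Proof.
move=> s0 uq H; have [y' am'] := argmin_exists D x s0.
have ey := uq _ am'; rewrite {y'}ey in am'.
split; last first.
  apply: left_of_le => //; rewrite /left_of; case: (odd k) H => /=.
    by move=> ey; exists y => //; rewrite ey.
  by move=> [_ yY] w /uq ->.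
case: k H => [|k] /=; first by left.
move=> H; right; apply: front_pos_le => // w lw; rewrite leNgt; apply/negP => xw.
move: lw H; rewrite /left_of uphalf_half; case: (odd k) => /=.
- move=> [v am vY] [[//|/=] yY1 yY2]; have := argmin_mono xw am' am; lra.
- move=> Hl ey; have := Hl _; have [v am] := argmin_exists D w s0.
  move=> /(_ _ am); have := argmin_mono xw am' am; rewrite ey; lra.
Qed.

End Fronts.

(** * Life of the regions *)

Section Alive.
Variables (R : realType) (D : pcdata R).
Local Notation Y := (node D).
Local Notation rs := (pcrho D).
Local Notation us := (pcu D).
Local Notation M := (umax D).
Local Notation incell := (incell D).
Local Notation cost := (cost D).
Local Notation argmin := (argmin D).
Local Notation z := (front_pos D).
Local Notation edge := (edge D).
Implicit Types (x y t s : R) (e k l r : nat).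

Definition alive_at k t : bool := (k == 0%N) || (z k.-1 t < z k t).

Lemma alive_atP k t : reflect (alive_reg D k t) (alive_at k t).
Proof.
apply: (iffP orP) => -[/eqP|] h; by [left; apply/eqP | left | right].
Qed.

Lemma alive_at0 t : alive_at 0 t.
Proof. by []. Qed.

Lemma alive_atS k t : alive_at k.+1 t = (z k t < z k.+1 t).
Proof. by []. Qed.

Lemma dead_atS k t : 0 <= t -> ~~ alive_at k.+1 t -> z k t = z k.+1 t.
Proof.
move=> t0; rewrite alive_atS -leNgt => h.
by apply/eqP; rewrite eq_le h front_posS.
Qed.

Lemma dead_between e e' t : 0 <= t -> (e <= e')%N ->
  (forall k, (e < k <= e')%N -> ~~ alive_at k t) -> z e t = z e' t.
Proof.
move=> t0 /subnKC <-; elim: (e' - e)%N => [|n IH] H; first by rewrite addn0.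
rewrite addnS -dead_atS// -?addnS; last by apply: H; lia.
by apply: IH => k kn; apply: H; lia.
Qed.

Lemma alive_lt k e e' t : 0 <= t -> alive_at k t -> (e < k <= e')%N -> z e t < z e' t.
Proof.
move=> t0 ak /andP[ek ke']; case: k ak ek ke' => // k; rewrite alive_atS => ak ek ke'.
apply: le_lt_trans (front_pos_mono D t0 (_ : e <= k)%N) _; first by lia.
exact: lt_le_trans ak (front_pos_mono D t0 ke').
Qed.

Lemma alive_unbounded n t : 0 <= t -> exists r, (n < r)%N && alive_at r t.
Proof.
move=> t0; apply: contrapT => H.
have [j zj] := node_unbounded D (z n t + t * M).
have /andP[h _] := front_pos_bnd D (n + j.*2)%N t0.
have : Y j <= Y (n + j.*2)./2 by apply: node_le; lia.
suff e : z n t = z (n + j.*2)%N t by move: zj; rewrite e; lra.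
apply: dead_between => //; first by lia.
by move=> k kn; apply/negP => ak; apply: H; exists k; rewrite ak; lia.
Qed.

(** The default [e.+1] is not reached at times [t >= 0], by [alive_unbounded]. *)
Definition nxt e t : nat :=
  match pselect (exists r, (e < r)%N && alive_at r t) with
  | left ex => ex_minn ex
  | right _ => e.+1
  end.

Lemma nxtP e t : 0 <= t ->
  [/\ (e < nxt e t)%N, alive_at (nxt e t) t &
      forall k, (e < k < nxt e t)%N -> ~~ alive_at k t].
Proof.
move=> t0; rewrite /nxt; case: pselect => [ex|/(_ (alive_unbounded _ t0))//].
case: ex_minnP => r /andP[er ar] rmin; split => // k /andP[ek kr].
by apply/negP => ak; have := rmin k; rewrite ek ak => /(_ isT); lia.
Qed.

Fixpoint prv e t : nat :=
  if alive_at e t then e else if e is e'.+1 then prv e' t else 0%N.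

Lemma prvP e t : [/\ (prv e t <= e)%N, alive_at (prv e t) t &
      forall k, (prv e t < k <= e)%N -> ~~ alive_at k t].
Proof.
elim: e => [|e [p1 p2 p3]]; first by split => //= k; lia.
rewrite /=; case: ifP => a; first by split => // k; lia.
split => //; first exact: leq_trans p1 _.
move=> k /andP[pk]; rewrite leq_eqVlt => /orP[/eqP -> |ke]; first by rewrite a.
by apply: p3; rewrite pk.
Qed.

(** The segment from [(x, t)] back to its label at time 0 keeps that label as its only minimizer, so
    it stays in the closed region [k]. *)
Lemma backward_region k s x t : 0 <= s < t -> (k = 0%N \/ z k.-1 t < x) -> x < z k t ->
  (k = 0%N \/ z k.-1 s <= edge k x t + s / t * (x - edge k x t)) /\
  edge k x t + s / t * (x - edge k x t) <= z k s.
Proof.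
move=> st zx xz; have [s0 s1] := andP st; have t0 : 0 < t by lra.
have am : argmin x t (edge k x t) by apply: edge_interior_sub.
apply: (@unique_label_region _ _ _ _ _ (edge k x t)) => //.
  by move=> w aw; apply/(argmin_backward_eq w t0 st am).
case: ifP => ok; first by rewrite /edge ok.
have inner w : (k = 0%N \/ z k.-1 t < w) -> w < z k t -> incell k./2 (edge k w t).
  move=> zw wz; have [y amy] := argmin_exists D w (ltW t0).
  by have [<-] := region_interior (ltW t0) zw wz amy.
split.
- case: zx => [->|zx]; first by left.
  have h1 : z k.-1 t < (x + z k.-1 t) / 2 by lra.
  have h2 : (x + z k.-1 t) / 2 < z k t by lra.
  have [[k0|h] _] := inner _ (or_intror h1) h2.
    by left; case: (k) ok k0 => [|[|?]].
  by right; move: h; rewrite /edge ok; lra.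
- have h1 : k = 0%N \/ z k.-1 t < (x + z k t) / 2.
    by case: zx => [->|zx]; [left|right; lra].
  have h2 : (x + z k t) / 2 < z k t by lra.
  by have [_] := inner _ h1 h2; rewrite /edge ok; lra.
Qed.

(** Regions do not revive: backward segments from two points of the region are parallel in a
    constant region and meet only at time 0 in a vacuum, so at time [s > 0] they still show a
    positive width. *)
Lemma alive_at_earlier k s t : 0 < s -> s <= t -> alive_at k t -> alive_at k s.
Proof.
move=> s0; rewrite le_eqVlt => /orP[/eqP ->//|st]; case: k => // k.
rewrite !alive_atS => zz; have t0 : 0 < t by lra.
pose x1 := (z k t * 2 + z k.+1 t) / 3; pose x2 := (z k t + z k.+1 t * 2) / 3.
have x12 : x1 < x2 by rewrite /x1 /x2; lra.
have st' : 0 <= s < t by rewrite (ltW s0).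
have x1z : x1 < z k.+1 t by rewrite /x1; lra.
have x2z : x2 < z k.+1 t by rewrite /x2; lra.
have zx1 : k.+1 = 0%N \/ z k t < x1 by right; rewrite /x1; lra.
have zx2 : k.+1 = 0%N \/ z k t < x2 by right; rewrite /x2; lra.
have [h1' _] := backward_region st' zx1 x1z; case: h1' => // h1.
have [_ h2] := backward_region st' zx2 x2z.
apply: le_lt_trans h1 _; apply: lt_le_trans h2; rewrite /edge.
have st0 : 0 < s / t by rewrite divr_gt0.
case: (odd k.+1).
- by have : s / t * x1 < s / t * x2; [rewrite ltr_pM2l | lra].
- move: (us _) => v.
  have e (w : R) : w - t * v + s / t * (w - (w - t * v)) = w + s * v - t * v.
    by field; rewrite gt_eqF.
  by rewrite !e; lra.
Qed.

Lemma alive_at_const i t : 0 <= t -> t * M * 2 < minstep D -> alive_at i.*2 t.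
Proof.
move=> t0 tM; case: i => [//|i]; rewrite doubleS alive_atS.
have /andP[_ h1] := front_pos_bnd D i.*2.+1 t0.
have /andP[h2 _] := front_pos_bnd D i.*2.+2 t0.
have := node_step D i.
by move: h1 h2; rewrite /= uphalf_double -!doubleS !doubleK; lra.
Qed.

(** For such short times minimizers stay within the two cells next to [Y i], and inside the fan the
    first-order conditions exclude both of their interiors. *)
Lemma alive_at_vac i t : 0 < t -> t * M * 2 < minstep D -> us i < us i.+1 ->
  alive_at i.*2.+1 t.
Proof.
move=> t0 tM uu; rewrite alive_atS.
have cover x : Y i + t * us i < x -> x < Y i + t * us i.+1 ->
    forall w, argmin x t w -> w = Y i.
  move=> ax xb w am; have := argmin_bnd (ltW t0) am.
  have := node_step D i; have step0 := minstep_gt0 D.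
  have /andP[a1 a2] := pcu_bnd D i; have /andP[b1 b2] := pcu_bnd D i.+1.
  have t1 : t * us i.+1 <= t * M by rewrite ler_pM2l.
  have t2 : - (t * M) <= t * us i by rewrite -mulrN ler_pM2l.
  move=> hY /andP[w1 w2]; have [wY|Yw|//] := ltgtP w (Y i).
  - have ci : incell i w.
      split; last exact: ltW.
      case: i uu ax xb hY a1 a2 b1 b2 t1 t2 wY => [|i] *; first by left.
      by right; have := node_step D i => /=; lra.
    by have := argmin_right am ci wY; lra.
  - have ci : incell i.+1 w by split; [right; exact: ltW | lra].
    by have := argmin_left am ci (or_intror Yw); lra.
pose a := Y i + t * us i; pose b := Y i + t * us i.+1.
have ab : a < b by rewrite /a /b ltrD2l ltr_pM2l.
have hk x : a < x -> x < b -> z i.*2 t <= x /\ x <= z i.*2.+1 t.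
  move=> ax xb.
  have [] := @unique_label_region _ D i.*2.+1 t x (Y i) (ltW t0) (cover x ax xb).
    by rewrite /= odd_double /= uphalf_double.
  by case.
have [h1 _] := hk ((a * 2 + b) / 3) ltac:(lra) ltac:(lra).
have [_ h2] := hk ((a + b * 2) / 3) ltac:(lra) ltac:(lra).
lra.
Qed.

(** By [argmin_node] the region would lie in a fan of width [t * (us i.+1 - us i) <= 0]. *)
Lemma dead_at_vac i t : 0 < t -> us i.+1 <= us i -> ~~ alive_at i.*2.+1 t.
Proof.
move=> t0 uu; apply/negP; rewrite alive_atS => zz.
have H x : z i.*2 t < x -> x < z i.*2.+1 t -> Y i + t * us i <= x <= Y i + t * us i.+1.
  move=> zx xz; apply: argmin_node.
  have := @edge_interior_sub _ D i.*2.+1 x t t0 (or_intror zx) xz.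
  by rewrite /edge /= odd_double uphalf_double.
have uut : t * us i.+1 <= t * us i by rewrite ler_pM2l.
have /andP[h1 _] := H ((z i.*2 t + z i.*2.+1 t) / 2) ltac:(lra) ltac:(lra).
have /andP[_ h2] := H ((z i.*2 t + z i.*2.+1 t * 2) / 3) ltac:(lra) ltac:(lra).
lra.
Qed.

Lemma alive_at_right k t : 0 < t -> alive_at k t -> exists2 t', t < t' & alive_at k t'.
Proof.
move=> t0; case: k => [_|k]; first by exists (t + 1) => //; lra.
rewrite alive_atS => zz; have M0 := umax_ge0 D.
(* During a time [q] each of the two fronts moves by at most a third of the gap. *)
pose q := (z k.+1 t - z k t) / (3 * (M + 1)).
have q0 : 0 < q by rewrite divr_gt0; lra.
have qM : M * q <= (z k.+1 t - z k t) / 3.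
  rewrite /q; have -> : M * ((z k.+1 t - z k t) / (3 * (M + 1))) =
    (z k.+1 t - z k t) / 3 * (M / (M + 1)) by field; lra.
  rewrite ger_pMr; last lra.
  by rewrite ler_pdivrMr; lra.
exists (t + q); first lra.
rewrite alive_atS; have tq : t <= t + q by lra.
have := front_pos_lip1 D k (ltW t0) tq; have := front_pos_lip1 D k.+1 (ltW t0) tq.
have -> : t + q - t = q by ring.
by move=> /andP[? ?] /andP[? ?]; lra.
Qed.

(** Extinction time. The value 0 is added so that a vacuum that never opens gets 0 and not [-oo];
    only positive times are tested, because at time 0 the two fronts of a node coincide even if a
    vacuum opens there. *)
Definition dtime k : \bar R :=
  if k is 0 then +oo%E else
  ereal_sup ([set 0%E] `|` [set t%:E | t in [set t | 0 < t /\ alive_at k t]]).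

Lemma dtime_ge0 k : (0 <= dtime k)%E.
Proof.
case: k => [|k]; first exact: le0y.
by apply: le_ereal_sup_tmp; exists 0%E => //; left.
Qed.

(** The inequality is strict because a living region stays alive for some time ([alive_at_right]):
    the supremum is not attained. *)
Lemma dtimeP k t : 0 < t -> (t%:E < dtime k)%E = alive_at k t.
Proof.
move=> t0; case: k => [|k]; first by rewrite ltry.
apply/idP/idP => [|ak].
- move=> /ereal_sup_gt[_ [->|[s [s0 ak] <-]]]; rewrite lte_fin; first lra.
  by move=> ts; apply: alive_at_earlier ak => //; exact: ltW.
- have [t' tt' ak'] := alive_at_right t0 ak.
  apply: (@lt_le_trans _ _ t'%:E); first by rewrite lte_fin.
  by apply: le_ereal_sup_tmp; exists t'%:E => //; right; exists t' => //; split => //; lra.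
Qed.

Lemma dtime_leP k t : 0 < t -> (dtime k <= t%:E)%E = ~~ alive_at k t.
Proof. by move=> t0; rewrite leNgt dtimeP. Qed.

Lemma small_time : exists2 t, 0 < t & t * M * 2 < minstep D.
Proof.
have M0 := umax_ge0 D; have d0 := minstep_gt0 D.
exists (minstep D / (4 * (M + 1))); first by rewrite divr_gt0; lra.
have -> : minstep D / (4 * (M + 1)) * M * 2 = minstep D * (M / (M + 1) / 2) by field; lra.
rewrite gtr_pMr// ltr_pdivrMr// ltr_pdivrMr; lra.
Qed.

Lemma dtime_const i : (0 < dtime i.*2)%E.
Proof.
have [t t0 tM] := small_time; apply: (@lt_trans _ _ t%:E); first by rewrite lte_fin.
by rewrite dtimeP//; apply: alive_at_const => //; exact: ltW.
Qed.

Lemma dtime_vac i : us i < us i.+1 -> (0 < dtime i.*2.+1)%E.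
Proof.
move=> uu; have [t t0 tM] := small_time.
apply: (@lt_trans _ _ t%:E); first by rewrite lte_fin.
by rewrite dtimeP//; exact: alive_at_vac.
Qed.

Lemma dtime_novac i : us i.+1 <= us i -> dtime i.*2.+1 = 0%E.
Proof.
move=> uu; apply/eqP; rewrite eq_le dtime_ge0 andbT.
apply: ge_ereal_sup => _ [->//|[t [t0 ak] <-]].
by have := dead_at_vac t0 uu; rewrite ak.
Qed.

End Alive.

(** Caratheodory's form of differentiability, suited to secant slopes that are known exactly. *)
Lemma is_derive_secant (R : realType) (f g : R -> R) (t : R) :
  (\forall s \near t, f s - f t = (s - t) * g s) -> {for t, continuous g} ->
  is_derive t (1 : R) f (g t).
Proof.
move=> fg cg.
have H : (fun h : R => h^-1 *: ((f \o shift t) (h *: (1 : R)) - f t)) @ 0^' --> g t.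
  have cg' : (g \o shift t) h @[h --> (0 : R)^'] --> g t by apply/continuous_withinNshiftx.
  apply: cvg_trans cg'; apply: near_eq_cvg.
  have fg' : \forall h \near (0 : R), f (h + t) - f t = h * g (h + t).
    have /nbhs_ballP[e /= e0 He] := fg.
    apply/nbhs_ballP; exists e => //= h; rewrite /ball /= sub0r normrN => he.
    by rewrite He ?addrK// /ball /= opprD addrCA subrr addr0 normrN.
  near=> h; rewrite /= [h *: 1]mulr1.
  have -> : f (h + t) - f t = h * g (h + t) by near: h; exact: (cvg_within _ fg').
  by rewrite [RHS]mulKf//; near: h; exact: nbhs_dnbhs_neq.
by apply: DeriveDef; [apply/cvg_ex; exists (g t) | exact/cvg_lim].
Unshelve. all: by end_near. Qed.

(** * Clusters of fronts *)

Section Clusters.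
Variables (R : realType) (D : pcdata R).
Local Notation Y := (node D).
Local Notation rs := (pcrho D).
Local Notation us := (pcu D).
Local Notation M := (umax D).
Local Notation incell := (incell D).
Local Notation cost := (cost D).
Local Notation z := (front_pos D).
Local Notation edge := (edge D).
Local Notation alive_at := (alive_at D).
Implicit Types (x y t s : R) (e k l r : nat).

(** Constant extension to negative times, so that continuity and neighbourhoods need no restriction
    to [t >= 0]. *)
Definition front_path e t : R := z e (Num.max 0 t).

Lemma front_pathE e t : 0 <= t -> front_path e t = z e t.
Proof. by move=> t0; rewrite /front_path max_r. Qed.

Lemma front_path_lip e s t : `|front_path e t - front_path e s| <= M * `|t - s|.
Proof.
have M0 := umax_ge0 D.
apply: (@le_trans _ _ (M * `|Num.max 0 t - Num.max 0 s|)).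
  by apply: front_pos_lip; rewrite le_max lexx.
rewrite ler_wpM2l//.
by case: (lerP 0 t); case: (lerP 0 s) => *; case: (ler0P (t - s)); rewrite ?subr0 ?sub0r ?subrr ?normr0 ?normrN => *; rewrite ?ger0_norm; lra.
Qed.

Lemma front_path_continuous e : continuous (front_path e).
Proof.
move=> t; apply/cvgrPdist_le => eps eps0; have M0 := umax_ge0 D.
near=> s.
have st : `|t - s| <= eps / (M + 1).
  near: s; apply/nbhs_ballP; exists (eps / (M + 1)) => /=; first by rewrite divr_gt0; lra.
  by move=> s /= /ltW.
apply: le_trans (front_path_lip _ _ _) _.
apply: (@le_trans _ _ (M * (eps / (M + 1)))); first by rewrite ler_wpM2l.
rewrite mulrCA ger_pMr// ler_pdivrMr; lra.
Unshelve. all: by end_near. Qed.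

Lemma mass_cell k y : mass D k y = mass D k (Y k) + rs k * (y - Y k).
Proof. by have := cumul_cell D (fun k y => rs k * y) k (Y k) y; rewrite /mass; lra. Qed.

Lemma mom_cell k y : mom D k y = mom D k (Y k) + rs k * us k * (y - Y k).
Proof. by have := cumul_cell D (fun k y => rs k * us k * y) k (Y k) y; rewrite /mom; lra. Qed.

(** Mass, momentum and cost at the label assigned by region [k]; their differences across a wave are
    what the wave has absorbed. *)
Definition emass k x t := mass D k./2 (edge k x t).
Definition emom k x t := mom D k./2 (edge k x t).
Definition ecost k x t := cost k./2 (edge k x t) x t.

Definition edens k : R := if odd k then 0 else rs k./2.

Lemma emassB k x x' t t' : emass k x' t' - emass k x t =
  edens k * (x' - x - (t' - t) * us k./2).
Proof.
rewrite /emass /edens /edge; case: (odd k); first by rewrite subrr mul0r.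
by rewrite (mass_cell _ (x' - _)) (mass_cell _ (x - _)); ring.
Qed.

Lemma emomB k x x' t t' : emom k x' t' - emom k x t =
  edens k * us k./2 * (x' - x - (t' - t) * us k./2).
Proof.
rewrite /emom /edens /edge; case: (odd k); first by rewrite subrr mul0r mul0r.
by rewrite (mom_cell _ (x' - _)) (mom_cell _ (x - _)); ring.
Qed.

(* [ecost k] is a quadratic polynomial with gradient (- emass, emom), whence
   the exactness of the trapezoidal rule. *)
Lemma ecostB k x x' t t' : ecost k x' t' - ecost k x t =
  (t' - t) * ((emom k x t + emom k x' t') / 2)
  - (x' - x) * ((emass k x t + emass k x' t') / 2).
Proof.
rewrite /ecost /emass /emom /edge; case: (odd k).
  by rewrite /cost; field.
rewrite -[cost _ (x' - _) x' t'](subrK (cost k./2 (Y k./2) x' t')) cost_cell.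
rewrite -[cost _ (x - _) x t](subrK (cost k./2 (Y k./2) x t)) cost_cell.
rewrite (mass_cell _ (x' - _)) (mass_cell _ (x - _)).
rewrite (mom_cell _ (x' - _)) (mom_cell _ (x - _)) /cost.
by field.
Qed.

Definition minimal k y x t := forall k' y', incell k' y' -> cost k y x t <= cost k' y' x t.

(** What survives at the end of the life of a wave: instead of the regions [l] and [r] being alive,
    closed conditions on their edges, stable under limits in time ([cluster_closed]). *)
Definition cluster_at l r t : Prop :=
  [/\ z l t = z r.-1 t,
      incell l./2 (edge l (z l t) t), incell r./2 (edge r (z l t) t),
      minimal l./2 (edge l (z l t) t) (z l t) t &
      minimal r./2 (edge r (z l t) t) (z l t) t].

Lemma adjacent_cluster l r t : 0 <= t -> (l < r)%N -> alive_at l t -> alive_at r t ->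
  (forall k, (l < k < r)%N -> ~~ alive_at k t) -> cluster_at l r t.
Proof.
move=> t0 lr al ar dead.
have zz : z l t = z r.-1 t.
  by apply: dead_between => //; [lia | move=> k ?; apply: dead; lia].
have [|h1 h2] := region_edge t0 (alive_atP D l t al) (x := z l t).
  split => //; case: l {lr al dead zz} => [|l]; [by left|right; exact: front_posS].
have [|h3 h4] := region_edge t0 (alive_atP D r t ar) (x := z l t).
  rewrite zz; split => //; first by right.
  by case: r lr {ar dead zz h1 h2} => // r _; exact: front_posS.
by split.
Qed.

Lemma edge_path_continuous k l : continuous (fun t => edge k (front_path l t) t).
Proof.
move=> t; rewrite /edge; case: (odd k); first exact: cvg_cst.
apply: cvgB; first exact: front_path_continuous.
by apply: cvgM; [exact: cvg_id|exact: cvg_cst].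
Qed.

Lemma cost_path_continuous k (f : R -> R) l : continuous f ->
  continuous (fun t => cost k (f t) (front_path l t) t).
Proof.
move=> cf t; rewrite /cost.
have -> : (fun t => mom0 D k (f t) + t * mom D k (f t) - front_path l t * mass D k (f t)) =
  (fun t => cost k (Y k) (front_path l t) t + rs k * ((f t - Y k) * ((f t + Y k) / 2 + t * us k - front_path l t))).
  by apply/funext => s; rewrite -cost_cell /cost; ring.
rewrite /cost.
have cp := @front_path_continuous l.
have id : (fun x : R => x) @ t --> t by exact: cvg_id.
apply: cvgD.
  apply: cvgB; first apply: cvgD; first exact: cvg_cst.
  - by apply: cvgM => //; exact: cvg_cst.
  - by apply: cvgM; [exact: cp|exact: cvg_cst].
apply: cvgM; first exact: cvg_cst.
apply: cvgM; first by apply: cvgB; [exact: cf|exact: cvg_cst].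
apply: cvgB; last exact: cp.
apply: cvgD; last by apply: cvgM => //; exact: cvg_cst.
by apply: cvgM; [apply: cvgD; [exact: cf|exact: cvg_cst]|exact: cvg_cst].
Qed.

Lemma cluster_closed l r s t : 0 <= s -> s < t ->
  (forall w, s < w -> w < t -> cluster_at l r w) -> cluster_at l r t.
Proof.
move=> s0 st H; have t0 : 0 <= t by lra.
have clos (f : R -> R) : continuous f -> (forall w, s < w -> w < t -> 0 <= f w) -> 0 <= f t.
  by move=> cf Hf; apply: (ge0_closure st cf Hf); lra.
have E e w : s < w -> front_path e w = z e w by move=> sw; rewrite front_pathE; lra.
rewrite /cluster_at -!(E _ _ st).
have cin k : (forall w, s < w -> w < t -> incell k./2 (edge k (z l w) w)) ->
    incell k./2 (edge k (front_path l t) t).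
  move=> Hk; split.
  - have [k0|k0] := eqVneq k./2 0%N; first by left.
    right; rewrite -subr_ge0; apply: (clos (fun w => edge k (front_path l w) w - Y k./2.-1)).
      by move=> w; apply: cvgB; [exact: edge_path_continuous|exact: cvg_cst].
    move=> w sw wt; rewrite E// subr_ge0.
    by have [[k00|//] _] := Hk w sw wt; rewrite k00 in k0.
  - rewrite -subr_ge0; apply: (clos (fun w => Y k./2 - edge k (front_path l w) w)).
      by move=> w; apply: cvgB; [exact: cvg_cst|exact: edge_path_continuous].
    by move=> w sw wt; rewrite E// subr_ge0; have [] := Hk w sw wt.
have cmin k : (forall w, s < w -> w < t -> minimal k./2 (edge k (z l w) w) (z l w) w) ->
    minimal k./2 (edge k (front_path l t) t) (front_path l t) t.
  move=> Hk k' y' ky'; rewrite -subr_ge0.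
  apply: (clos (fun w => cost k' y' (front_path l w) w - cost k./2 (edge k (front_path l w) w) (front_path l w) w)).
    move=> w; apply: cvgB.
      by apply: (@cost_path_continuous k' (fun=> y') l) => ?; exact: cvg_cst.
    apply: (@cost_path_continuous k./2 (fun w => edge k (front_path l w) w) l).
    exact: edge_path_continuous.
  by move=> w sw wt; rewrite E// subr_ge0; apply: Hk.
split; [|apply: cin|apply: cin|apply: cmin|apply: cmin] => [|w sw wt|w sw wt|w sw wt|w sw wt];
  try by have [] := H w sw wt.
apply/eqP; rewrite -subr_eq0 -normr_le0; rewrite -oppr_ge0.
apply: (clos (fun w => - `|front_path l w - front_path r.-1 w|)).
  move=> w; apply: cvgN; apply: cvg_norm; apply: cvgB; exact: front_path_continuous.
by move=> w sw wt; have [e _ _ _ _] := H w sw wt; rewrite !E// e subrr normr0 oppr0.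
Qed.

Lemma cluster_ecost l r t : cluster_at l r t -> ecost l (z l t) t = ecost r (z l t) t.
Proof.
move=> [_ cl cr ml mr]; apply/eqP; rewrite eq_le; apply/andP; split; [exact: ml|exact: mr].
Qed.

Lemma cluster_edge_le l r t : (l < r)%N -> cluster_at l r t ->
  edge l (z l t) t <= edge r (z l t) t.
Proof.
move=> lr [_ cl cr _ _].
have [h|h] := ltnP l./2 r./2.
  apply: le_trans (proj2 cl) _; apply: le_trans (node_le D (_ : _ <= r./2.-1)%N) _; first lia.
  by case: cr => -[] //; lia.
have e : l./2 = r./2 by lia.
have [ol orr] : odd l = false /\ odd r by lia.
by rewrite {2}/edge orr -e; case: cl.
Qed.

(* Only contact discontinuities carry no mass. *)
Lemma cluster_edge_eq l r t : (l < r)%N -> cluster_at l r t ->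
  edge l (z l t) t = edge r (z l t) t ->
  edge l (z l t) t = Y l./2 /\ (r = l.+1 \/ r = l.+2 /\ ~~ odd l).
Proof.
move=> lr [_ cl cr _ _] e.
have [h|h] := ltnP l./2 r./2.
  have Yr : Y r./2.-1 <= edge r (z l t) t by case: cr => -[] //; lia.
  have Yl : edge l (z l t) t <= Y l./2 by case: cl.
  have /(node_le D) Ylr : (l./2 <= r./2.-1)%N by lia.
  split; first lra.
  have [//|ne] := eqVneq l./2 r./2.-1; last first.
    exfalso; have /(node_lt D) : (l./2 < r./2.-1)%N by lia.
    lra.
  move=> er; have : ~~ odd r.
    apply/negP => orr; move: e; rewrite {2}/edge orr => e.
    by have := node_lt D h; lra.
  by lia.
have el : l./2 = r./2 by lia.
have [ol orr] : odd l = false /\ odd r by lia.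
split; last by lia.
by rewrite e {1}/edge orr el.
Qed.

End Clusters.

Lemma half_le_succ l i : (l./2 <= i)%N -> (i.*2 < l)%N -> l = i.*2.+1.
Proof. by move=> h1 h2; have := odd_double_half l; case: (odd l); lia. Qed.

Lemma half_neq0 l i : (i.+1.*2 < l)%N -> l./2 <> 0%N.
Proof. by move=> h1 h2; have := odd_double_half l; rewrite h2; case: (odd l); lia. Qed.

(** * Mass, momentum and motion of a cluster *)

Section ClusterDynamics.
Variables (R : realType) (D : pcdata R).
Local Notation Y := (node D).
Local Notation rs := (pcrho D).
Local Notation us := (pcu D).
Local Notation M := (umax D).
Local Notation incell := (incell D).
Local Notation cost := (cost D).
Local Notation z := (front_pos D).
Local Notation edge := (edge D).
Local Notation alive_at := (alive_at D).
Local Notation path := (front_path D).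
Local Notation cluster_at := (cluster_at D).
Local Notation emass := (emass D).
Local Notation emom := (emom D).
Local Notation edens := (edens D).
Implicit Types (x y t s : R) (e k l r : nat).

Definition wmass l r t : R := emass r (path l t) t - emass l (path l t) t.
Definition wmom l r t : R := emom r (path l t) t - emom l (path l t) t.

Lemma wmass_ge0 l r t : 0 <= t -> (l < r)%N -> cluster_at l r t -> 0 <= wmass l r t.
Proof.
move=> t0 lr cl; have := cluster_edge_le lr cl; have [_ c1 c2 _ _] := cl.
by rewrite /wmass front_pathE// subr_ge0; exact: mass_le.
Qed.

Lemma wmass_gt0 l r t : 0 <= t -> (l < r)%N -> cluster_at l r t ->
  edge l (z l t) t != edge r (z l t) t -> 0 < wmass l r t.
Proof.
move=> t0 lr cl ne; have := cluster_edge_le lr cl; have [_ c1 c2 _ _] := cl.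
by rewrite le_eqVlt (negbTE ne) /= /wmass front_pathE// subr_gt0; exact: mass_lt.
Qed.

Lemma wmom_le l r t : 0 <= t -> (l < r)%N -> cluster_at l r t ->
  `|wmom l r t| <= M * wmass l r t.
Proof.
move=> t0 lr cl; have := cluster_edge_le lr cl; have [_ c1 c2 _ _] := cl.
by rewrite /wmass /wmom front_pathE//; exact: mom_le.
Qed.

(** Labels that meet at one point come from an interval of length at most [2 * M * t]. *)
Lemma wmass_le l r t : 0 <= t -> (l < r)%N -> cluster_at l r t ->
  wmass l r t <= rhomax D * (2 * M * t).
Proof.
move=> t0 lr cl; have le := cluster_edge_le lr cl; have [_ c1 c2 m1 m2] := cl.
rewrite /wmass front_pathE//; apply: le_trans (mass_rhomax c1 c2 le) _.
have a1 : argmin D (z l t) t (edge l (z l t) t) by exists l./2.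
have a2 : argmin D (z l t) t (edge r (z l t) t) by exists r./2.
have /andP[b1 _] := argmin_bnd t0 a1; have /andP[_ b2] := argmin_bnd t0 a2.
apply: ler_wpM2l; last lra.
by apply: ltW; apply: lt_le_trans (pcrho_gt0 D 0) (pcrho_le D 0).
Qed.

(** Equality of the two edge costs says that [z l t * wmass - t * wmom] is the first moment of the
    absorbed labels, which lie between the two edges. Overcompressivity is read off from this. *)
Lemma cluster_barycenter l r t : 0 <= t -> (l < r)%N -> cluster_at l r t ->
  edge l (z l t) t * wmass l r t <= z l t * wmass l r t - t * wmom l r t
    <= edge r (z l t) t * wmass l r t.
Proof.
move=> t0 lr cl; have le := cluster_edge_le lr cl; have [_ c1 c2 m1 m2] := cl.
have := cluster_ecost cl; have := mom0_bounds c1 c2 le.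
rewrite /wmass /wmom front_pathE// /ecost /cost /emass /emom.
by move=> /andP[? ?] ?; apply/andP; split; lra.
Qed.

Lemma wmass_continuous l r : continuous (wmass l r).
Proof.
have E k : continuous (fun t => emass k (path l t) t).
  move=> t; have -> : (fun t => emass k (path l t) t) =
      (fun t => emass k 0 0 + edens k * (path l t - t * us k./2)).
    apply/funext => s; have := emassB D k 0 (path l s) 0 s; rewrite !subr0; lra.
  apply: cvgD; first exact: cvg_cst.
  apply: cvgM; first exact: cvg_cst.
  apply: cvgB; first exact: front_path_continuous.
  by apply: cvgM; [exact: cvg_id|exact: cvg_cst].
by move=> t; apply: cvgB; exact: E.
Qed.

Lemma wmom_continuous l r : continuous (wmom l r).
Proof.
have E k : continuous (fun t => emom k (path l t) t).
  move=> t; have -> : (fun t => emom k (path l t) t) =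
      (fun t => emom k 0 0 + edens k * us k./2 * (path l t - t * us k./2)).
    apply/funext => s; have := emomB D k 0 (path l s) 0 s; rewrite !subr0; lra.
  apply: cvgD; first exact: cvg_cst.
  apply: cvgM; first exact: cvg_cst.
  apply: cvgB; first exact: front_path_continuous.
  by apply: cvgM; [exact: cvg_id|exact: cvg_cst].
by move=> t; apply: cvgB; exact: E.
Qed.

Section Derivatives.
Variables (l r : nat) (t : R).
Hypothesis lr : (l < r)%N.
Hypothesis near_cluster : \forall s \near t, 0 <= s /\ cluster_at l r s.
Hypothesis mass_pos : 0 < wmass l r t.

Let G s := (wmom l r t + wmom l r s) / (wmass l r t + wmass l r s).

Let G_continuous : {for t, continuous G}.
Proof.
apply: cvgM.
  by apply: cvgD; [exact: cvg_cst|exact: wmom_continuous].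
apply: cvgV; first by rewrite gt_eqF//; exact: addr_gt0.
by apply: cvgD; [exact: cvg_cst|exact: wmass_continuous].
Qed.

Let Gt : G t = wmom l r t / wmass l r t.
Proof. rewrite /G; field; apply/andP; split; by rewrite gt_eqF// addr_gt0. Qed.

(** The edge costs agree at both times; subtracting the two trapezoidal identities [ecostB] leaves a
    linear equation for the displacement. *)
Let path_secant : \forall s \near t, path l s - path l t = (s - t) * G s.
Proof.
have [t0 clt] := nbhs_singleton near_cluster.
suff step (s : R) : 0 <= s /\ cluster_at l r s -> path l s - path l t = (s - t) * G s.
  exact: filterS step near_cluster.
move=> [s0 cls]; have Ss := wmass_ge0 s0 lr cls.
have e1 := ecostB D l (z l t) (z l s) t s; have e2 := ecostB D r (z l t) (z l s) t s.
rewrite -(cluster_ecost clt) -(cluster_ecost cls) e1 in e2.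
have key : (path l s - path l t) * (wmass l r t + wmass l r s) =
    (s - t) * (wmom l r t + wmom l r s).
  rewrite /wmass /wmom !front_pathE//.
  lra.
have ne : wmass l r t + wmass l r s != 0 by rewrite gt_eqF// ltr_pwDl.
by apply: (mulIf ne); rewrite key /G; field.
Qed.

Lemma is_derive_path : is_derive t (1 : R) (path l) (wmom l r t / wmass l r t).
Proof. by rewrite -Gt; apply: is_derive_secant path_secant G_continuous. Qed.

Lemma is_derive_wmass : is_derive t (1 : R) (wmass l r)
  (edens r * (wmom l r t / wmass l r t - us r./2)
   - edens l * (wmom l r t / wmass l r t - us l./2)).
Proof.
rewrite -Gt; pose H s := edens r * (G s - us r./2) - edens l * (G s - us l./2).
apply: (@is_derive_secant _ _ H); last first.
  apply: cvgB; (apply: cvgM; first exact: cvg_cst);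
    by apply: cvgB; [exact: G_continuous|exact: cvg_cst].
apply: filterS path_secant => /= s es.
have := emassB D r (path l t) (path l s) t s; have := emassB D l (path l t) (path l s) t s.
by rewrite es /wmass /H; lra.
Qed.

Lemma is_derive_wmom : is_derive t (1 : R) (wmom l r)
  (edens r * us r./2 * (wmom l r t / wmass l r t - us r./2)
   - edens l * us l./2 * (wmom l r t / wmass l r t - us l./2)).
Proof.
rewrite -Gt; pose H s := edens r * us r./2 * (G s - us r./2) - edens l * us l./2 * (G s - us l./2).
apply: (@is_derive_secant _ _ H); last first.
  apply: cvgB; (apply: cvgM; first exact: cvg_cst);
    by apply: cvgB; [exact: G_continuous|exact: cvg_cst].
apply: filterS path_secant => /= s es.
have := emomB D r (path l t) (path l s) t s; have := emomB D l (path l t) (path l s) t s.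
by rewrite es /wmom /H; lra.
Qed.

End Derivatives.

Lemma prv_cluster k t : 0 <= t -> alive_at k.+1 t -> cluster_at (prv D k t) k.+1 t.
Proof.
move=> t0 ak; have [p1 p2 p3] := prvP D k t.
by apply: adjacent_cluster => // j jk; apply: p3; lia.
Qed.

Lemma nxt_cluster k t : 0 <= t -> alive_at k t -> cluster_at k (nxt D k t) t.
Proof. by move=> t0 ak; have [p1 p2 p3] := nxtP D k t0; apply: adjacent_cluster. Qed.

Lemma front_prv k t : 0 <= t -> z (prv D k t) t = z k t.
Proof. by move=> t0; have [p1 p2 p3] := prvP D k t; apply: dead_between. Qed.

Lemma front_nxt k t : 0 <= t -> z (nxt D k t).-1 t = z k t.
Proof.
move=> t0; have [p1 p2 p3] := nxtP D k t0; symmetry; apply: dead_between => //; first lia.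
by move=> j jk; apply: p3; lia.
Qed.

(** Arithmetic of absorption: [al] and [al + e] are the lengths of a cell absorbed at times [s] and
    [t], [mu] is the mass of the absorbing wave at time [s], and [w] the first moment of that mass
    about the edge. The conclusion says that absorbed lengths grow at least like the square root of
    time. *)
Lemma sqrt_growth (s t al mu rho e w : R) : 0 < s -> s <= t -> 0 <= al -> 0 < rho ->
  rho * al <= mu -> 0 <= al + e -> mu * al <= 2 * w ->
  (t - s) * w <= s * (mu * e + rho * e ^+ 2 / 2) ->
  al ^+ 2 * t <= (al + e) ^+ 2 * s.
Proof.
move=> s0 st al0 r0 ram ale mw H.
have [->|an] := eqVneq al 0.
  by rewrite expr0n mul0r mulr_ge0 ?sqr_ge0// ltW.
have al_gt0 : 0 < al by rewrite lt_neqAle eq_sym an.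
have mu0 : 0 < mu by apply: lt_le_trans ram; rewrite mulr_gt0.
have h1 : (t - s) * (mu * al) <= (t - s) * (2 * w) by rewrite ler_wpM2l ?subr_ge0.
have h2 : (t - s) * (mu * al) * al <= s * (2 * mu * e + rho * e ^+ 2) * al.
  by rewrite ler_wpM2r//; lra.
have h3 : s * (rho * al) * e ^+ 2 <= s * mu * e ^+ 2.
  by rewrite ler_wpM2r ?sqr_ge0// ler_wpM2l// ltW.
rewrite -subr_ge0 -(pmulr_rge0 _ mu0); move: h2 h3; lra.
Qed.

(** * Remaining lifetime of narrow regions *)

Section ConstGap.
Variables (i : nat) (s t : R).
Hypotheses (s0 : 0 < s) (st : s <= t) (ait : alive_at i.+1.*2 t).

Let t0 : 0 < t := lt_le_trans s0 st.
Let ais : alive_at i.+1.*2 s := alive_at_earlier s0 st ait.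

Let edgeE x w : edge i.+1.*2 x w = x - w * us i.+1.
Proof. by rewrite /edge odd_double doubleK. Qed.

Let absorbed w : 0 < w -> alive_at i.+1.*2 w ->
  Y i <= z i.*2.+1 w - w * us i.+1 /\ z i.+1.*2 w - w * us i.+1 <= Y i.+1.
Proof.
move=> w0 aw; split.
- have [|[+ _] _] := region_edge (ltW w0) (alive_atP D _ _ aw) (x := z i.*2.+1 w).
    by split; [right|exact: front_posS (ltW w0)].
  by rewrite edgeE doubleK => -[].
- have [|[_ +] _] := region_edge (ltW w0) (alive_atP D _ _ aw) (x := z i.+1.*2 w).
    by split => //; right; exact: front_posS (ltW w0).
  by rewrite edgeE doubleK.
Qed.

(** At time [t] the edge of the cell is no dearer than the far label [a] of the wave at time [s]; at
    time [s] the two cost the same. Eliminating the momentum between these relations gives the last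
    hypothesis of [sqrt_growth]. *)
Lemma const_gap_left :
  (z i.*2.+1 s - s * us i.+1 - Y i) ^+ 2 * t <= (z i.*2.+1 t - t * us i.+1 - Y i) ^+ 2 * s.
Proof.
have [as0 _] := absorbed s0 ais; have [at0 _] := absorbed t0 ait.
have cl := prv_cluster (ltW s0) ais; have [p1 p2 p3] := prvP D i.*2.+1 s.
have eq := cluster_ecost cl; have [_ cl1 cl2 _ _] := cl.
set l := prv D i.*2.+1 s in p1 p2 p3 cl eq cl1 cl2.
have [|cit mt] := region_edge (ltW t0) (alive_atP D _ _ ait) (x := z i.*2.+1 t).
  by split; [right|exact: front_posS (ltW t0)].
move: eq cl1 cl2 cit mt; rewrite /ecost (front_prv _ (ltW s0)) !edgeE !doubleK.
set c := z i.*2.+1 s; set c' := z i.*2.+1 t; set a := edge l c s => eq cl1 cl2 cit mt.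
have aY : a <= Y i by case: cl1 => _ h; apply: le_trans h (node_le D _); rewrite -ltnS ltn_half_double.
have mm := mass_le cl1 (incellS_node D i) aY.
have m0m := mom0_bounds cl1 (incellS_node D i) aY.
have := mt _ _ cl1; have c1 := cost_cell D i.+1 (c - s * us i.+1) (c' - t * us i.+1) c' t.
have k1 := mass_cell D i.+1 (c - s * us i.+1); have k2 := mass_cell D i.+1 (Y i).
have k3 : mom0 D i.+1 (c - s * us i.+1) - mom0 D i.+1 (Y i) =
    rs i.+1 * ((c - s * us i.+1) ^+ 2 / 2) - rs i.+1 * (Y i ^+ 2 / 2) by exact: cumul_cell.
have r0 := pcrho_gt0 D i.+1.
have -> : c' - t * us i.+1 - Y i = (c - s * us i.+1 - Y i) + ((c' - t * us i.+1) - (c - s * us i.+1)) by ring.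
move: as0 at0 k1 k2 k3 c1 eq; rewrite -/c -/c' /cost.
set b := c - s * us i.+1; set b' := c' - t * us i.+1 => as0 at0 k1 k2 k3 c1 eq ct.
set m := mass D i.+1 b in k1 c1 eq *; set m0 := mom0 D i.+1 b in k3 c1 eq *.
set q := mom D i.+1 b in c1 eq *.
set ma := mass D l./2 a in mm m0m eq ct *; set m0a := mom0 D l./2 a in m0m eq ct *.
set qa := mom D l./2 a in eq ct *.
set mY := mass D i.+1 (Y i) in mm m0m k2 *; set m0Y := mom0 D i.+1 (Y i) in m0m k3 *.
have {m0m}/andP[_ m0m] := m0m.
have cE : c = b + s * us i.+1 by rewrite /b; ring.
have cE' : c' = b' + t * us i.+1 by rewrite /b'; ring.
apply: (@sqrt_growth s t _ (m - ma) (rs i.+1) _ (b * (m - ma) - (m0 - m0a))) => //; try lra.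
(* The mass taken from the cell is uniform, with barycenter at half of [b - Y i] behind the edge;
   all other mass is at least [b - Y i] behind it. *)
- by have : 0 <= (b - Y i) * (m - ma - rs i.+1 * (b - Y i)); [apply: mulr_ge0; lra | nra].
- rewrite cE in eq; rewrite cE' in c1 ct.
  suff : s * ((m0 - m0a) + t * (q - qa) - (b' + t * us i.+1) * (m - ma) - rs i.+1 * (b' - b) ^+ 2 / 2) <= 0.
    have : t * ((m0 - m0a) + s * (q - qa) - (b + s * us i.+1) * (m - ma)) = 0.
      by rewrite [X in t * X](_ : _ = 0) ?mulr0//; lra.
    by lra.
  by rewrite pmulr_rle0//; lra.
Qed.

Lemma const_gap_right :
  (Y i.+1 - (z i.+1.*2 s - s * us i.+1)) ^+ 2 * t <=
  (Y i.+1 - (z i.+1.*2 t - t * us i.+1)) ^+ 2 * s.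
Proof.
have [_ as0] := absorbed s0 ais; have [_ at0] := absorbed t0 ait.
have cl := nxt_cluster (ltW s0) ais; have [p1 p2 p3] := nxtP D i.+1.*2 (ltW s0).
have eq := cluster_ecost cl; have [_ cl2 cl1 _ _] := cl.
set l := nxt D i.+1.*2 s in p1 p2 p3 cl eq cl1 cl2.
have [|cit mt] := region_edge (ltW t0) (alive_atP D _ _ ait) (x := z i.+1.*2 t).
  by split => //; right; exact: front_posS (ltW t0).
move: eq cl1 cl2 cit mt; rewrite /ecost !edgeE !doubleK.
set c := z i.+1.*2 s; set c' := z i.+1.*2 t; set a := edge l c s => eq cl1 cl2 cit mt.
have aY : Y i.+1 <= a.
  case: cl1 => -[] h _; first by case: (half_neq0 p1 h).
  have [h1|h1] := ltnP i.+1 l./2; first by apply: le_trans h; apply: node_le; rewrite -ltnS (ltn_predK h1).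
  have lE := half_le_succ h1 p1.
  by rewrite /a /edge lE /= odd_double /= uphalf_double.
have mm := mass_le (incell_node D i.+1) cl1 aY.
have m0m := mom0_bounds (incell_node D i.+1) cl1 aY.
have := mt _ _ cl1; have c1 := cost_cell D i.+1 (c - s * us i.+1) (c' - t * us i.+1) c' t.
have k1 := mass_cell D i.+1 (c - s * us i.+1).
have k3 : mom0 D i.+1 (c - s * us i.+1) - mom0 D i.+1 (Y i.+1) =
    rs i.+1 * ((c - s * us i.+1) ^+ 2 / 2) - rs i.+1 * (Y i.+1 ^+ 2 / 2) by exact: cumul_cell.
have r0 := pcrho_gt0 D i.+1.
have -> : Y i.+1 - (c' - t * us i.+1) =
  (Y i.+1 - (c - s * us i.+1)) + ((c - s * us i.+1) - (c' - t * us i.+1)) by ring.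
move: as0 at0 k1 k3 c1 eq; rewrite -/c -/c' /cost.
set b := c - s * us i.+1; set b' := c' - t * us i.+1 => as0 at0 k1 k3 c1 eq ct.
set m := mass D i.+1 b in k1 c1 eq *; set m0 := mom0 D i.+1 b in k3 c1 eq *.
set q := mom D i.+1 b in c1 eq *.
set ma := mass D l./2 a in mm m0m eq ct *; set m0a := mom0 D l./2 a in m0m eq ct *.
set qa := mom D l./2 a in eq ct *.
set mY := mass D i.+1 (Y i.+1) in mm m0m k1 *; set m0Y := mom0 D i.+1 (Y i.+1) in m0m k3 *.
have {m0m}/andP[m0m _] := m0m.
have cE : c = b + s * us i.+1 by rewrite /b; ring.
have cE' : c' = b' + t * us i.+1 by rewrite /b'; ring.
apply: (@sqrt_growth s t _ (ma - m) (rs i.+1) _ ((m0a - m0) - b * (ma - m))) => //; try lra.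
- by have : 0 <= (Y i.+1 - b) * (ma - m - rs i.+1 * (Y i.+1 - b)); [apply: mulr_ge0; lra | nra].
- rewrite cE in eq; rewrite cE' in c1 ct.
  suff : 0 <= s * ((m0a - m0) + t * (qa - q) - (b' + t * us i.+1) * (ma - m) + rs i.+1 * (b' - b) ^+ 2 / 2).
    have : t * ((m0a - m0) + s * (qa - q) - (b + s * us i.+1) * (ma - m)) = 0.
      by rewrite [X in t * X](_ : _ = 0) ?mulr0//; lra.
    by lra.
  by rewrite pmulr_rge0//; lra.
Qed.

(** A cell of length [L] keeps the gap [L - al - be]. A gap below [h] at time [s] and growth like
    the square root of time give [t * (L - h) ^ 2 <= s * L ^ 2] while the region lives; [h <= L / 2]
    then turns this into the factor 8. *)
Lemma const_gap_time (h : R) : 0 < h -> h <= minstep D / 2 ->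
  z i.+1.*2 s - z i.*2.+1 s < h -> (t - s) * minstep D <= s * (8 * h).
Proof.
move=> h0 hd gap; have [al0 be0] := absorbed s0 ais; have [al1 be1] := absorbed t0 ait.
have st1 := node_step D i; have gt0 : z i.*2.+1 t <= z i.+1.*2 t.
  exact: front_posS (ltW t0).
have A := const_gap_left; have B := const_gap_right.
set al := z i.*2.+1 s - s * us i.+1 - Y i in A.
set al' := z i.*2.+1 t - t * us i.+1 - Y i in A.
set be := Y i.+1 - (z i.+1.*2 s - s * us i.+1) in B.
set be' := Y i.+1 - (z i.+1.*2 t - t * us i.+1) in B.
have [p0 p1 p2 p3] : [/\ 0 <= al, 0 <= al', 0 <= be & 0 <= be'] by split; rewrite /al /al' /be /be'; lra.
set L := Y i.+1 - Y i in st1; have L0 : 0 < L by rewrite subr_gt0; exact: nodeS.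
have e1 : L - h < al + be by rewrite /L /al /be; lra.
have e2 : al' + be' <= L by rewrite /L /al' /be'; lra.
have hL : h <= L / 2 by lra.
(* Cross term of the squared sums: the geometric mean of [A] and [B]. *)
have C : (al * be) * t <= (al' * be') * s.
  rewrite -(@ler_pXn2r _ 2)// ?nnegrE ?mulr_ge0//; try exact: ltW.
  by rewrite !exprMn -[leLHS](_ : (al ^+ 2 * t) * (be ^+ 2 * t) = _) -?[leRHS](_ : (al' ^+ 2 * s) * (be' ^+ 2 * s) = _);
    [apply: ler_pM => //; apply: mulr_ge0; rewrite ?sqr_ge0// ltW|ring|ring].
have E1 : (al + be) ^+ 2 * t <= (al' + be') ^+ 2 * s by lra.
have E2 : (L - h) ^+ 2 * t <= (al + be) ^+ 2 * t.
  by rewrite ler_wpM2r ?(ltW t0)// ler_pXn2r// ?nnegrE; lra.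
have E3 : (al' + be') ^+ 2 * s <= L ^+ 2 * s.
  by rewrite ler_wpM2r ?(ltW s0)// ler_pXn2r// ?nnegrE; lra.
have E4 : (t - s) * (L - h) ^+ 2 <= s * (2 * L * h).
  have : 0 <= s * h ^+ 2 by rewrite mulr_ge0 ?sqr_ge0// ltW.
  by lra.
have E5 : (t - s) * (L ^+ 2 / 4) <= (t - s) * (L - h) ^+ 2.
  by rewrite ler_wpM2l ?subr_ge0//; nra.
have E6 : (t - s) * L <= s * (8 * h).
  by rewrite -(ler_pM2r L0); lra.
apply: le_trans E6; rewrite ler_wpM2l ?subr_ge0//.
Qed.

End ConstGap.
(** Both neighbours being dead, the wave on each side has absorbed the entire adjacent cell, so the
    barycenter of its mass is at least [minstep D / 2] away from the node. While the vacuum lives,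
    each front stays on the inner side of the line that joins this barycenter at time 0 to the
    position of the front at time [s]; the two lines converge. *)
Lemma vac_gap_time i (s t h : R) : 0 < s -> s <= t -> alive_at i.*2.+1 t ->
  ~~ alive_at i.*2 s -> ~~ alive_at i.+1.*2 s -> 0 < h -> h <= minstep D / 2 ->
  z i.*2.+1 s - z i.*2 s < h -> (t - s) * minstep D <= s * (8 * h).
Proof.
move=> s0 st avt dl dr h0 hd gap; have t0 : 0 < t := lt_le_trans s0 st.
have avs := alive_at_earlier s0 st avt.
have edgeE x w : edge i.*2.+1 x w = Y i by rewrite /edge /= odd_double uphalf_double.
have half : (i.*2.+1)./2 = i by rewrite /= uphalf_double.
have step_t w x : 0 < w -> alive_at i.*2.+1 w -> z i.*2 w <= x -> x <= z i.*2.+1 w ->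
    minimal D i (Y i) x w.
  move=> w0 aw zx xz; have [|_] := region_edge (ltW w0) (alive_atP D _ _ aw) (x := x).
    by split => //; right.
  by rewrite edgeE half.
have zt := front_posS D i.*2 (ltW t0).
have LEFT : s * z i.*2 t >= t * z i.*2 s - (t - s) * (Y i - minstep D / 2).
  case: i dl avt avs half edgeE step_t zt gap {dr} => [|j] dl avt avs half edgeE step_t zt gap.
    by rewrite alive_at0 in dl.
  have cl := prv_cluster (ltW s0) avs; have [p1 p2 p3] := prvP D j.+1.*2 s.
  have eq := cluster_ecost cl; have [_ cl1 cl2 _ _] := cl.
  set l := prv D j.+1.*2 s in p1 p2 p3 cl eq cl1 cl2.
  have lj : (l < j.+1.*2)%N.
    by rewrite ltn_neqAle p1 andbT; apply: contraNneq dl => <-.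
  have mt := step_t _ _ t0 avt (lexx _) zt.
  move: eq cl1; rewrite /ecost (front_prv _ (ltW s0)) edgeE half.
  set c := z j.+1.*2 s in gap *; set c' := z j.+1.*2 t in mt zt *; set a := edge l c s => eq cl1.
  have aY : a <= Y j by case: cl1 => _ h'; apply: le_trans h' (node_le D _); rewrite -ltnS ltn_half_double.
  have mm := mass_le cl1 (incellS_node D j) aY.
  have m0m := mom0_bounds cl1 (incellS_node D j) aY.
  have k2 := mass_cell D j.+1 (Y j).
  have k3 : mom0 D j.+1 (Y j) - mom0 D j.+1 (Y j.+1) =
    rs j.+1 * (Y j ^+ 2 / 2) - rs j.+1 * (Y j.+1 ^+ 2 / 2) by exact: cumul_cell.
  have mlt := mass_lt cl1 (incell_node D j.+1) (le_lt_trans aY (nodeS D j)).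
  have := mt _ _ cl1; move: eq; rewrite /cost => eq ct.
  have r0 := pcrho_gt0 D j.+1; have stp := node_step D j.
  set m := mass D j.+1 (Y j.+1) in k2 mlt eq ct; set m0 := mom0 D j.+1 (Y j.+1) in k3 eq ct.
  set q := mom D j.+1 (Y j.+1) in eq ct.
  set ma := mass D l./2 a in mm m0m eq ct mlt; set m0a := mom0 D l./2 a in m0m eq ct.
  set qa := mom D l./2 a in eq ct.
  set mY := mass D j.+1 (Y j) in mm m0m k2; set m0Y := mom0 D j.+1 (Y j) in m0m k3.
  have {m0m}/andP[_ m0m] := m0m.
  set y0 := Y j in k2 k3 stp m0m; set y1 := Y j.+1 in k2 k3 stp *; set ro := rs j.+1 in r0 k2 k3.
  set d := minstep D in stp *.
  have mu0 : 0 < m - ma by lra.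
  have bary : m0 - m0a <= (y1 - d / 2) * (m - ma).
    have e : m - ma = (mY - ma) + ro * (y1 - y0) by lra.
    have d0 : 0 < d := minstep_gt0 D.
    have : 0 <= ro * (y1 - y0) * ((y1 - y0) / 2 - d / 2) by apply: mulr_ge0; [apply: mulr_ge0|]; lra.
    have n1 : 0 <= mY - ma by rewrite subr_ge0.
    have n2 : 0 <= y1 - y0 - d / 2 by lra.
    have := mulr_ge0 n1 n2.
    by rewrite e; lra.
  rewrite -(ler_pM2r mu0).
  have : (t - s) * (m0 - m0a) <= (t - s) * ((y1 - d / 2) * (m - ma)) by rewrite ler_wpM2l ?subr_ge0.
  have : t * (m0 + s * q - c * m - (m0a + s * qa - c * ma)) = 0.
    by rewrite [X in t * X](_ : _ = 0) ?mulr0//; lra.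
  have : 0 <= s * ((m0a + t * qa - c' * ma) - (m0 + t * q - c' * m)).
    by rewrite pmulr_rge0//; lra.
  by lra.
have RIGHT : s * z i.*2.+1 t <= t * z i.*2.+1 s - (t - s) * (Y i + minstep D / 2).
  have cl := nxt_cluster (ltW s0) avs; have [p1 p2 p3] := nxtP D i.*2.+1 (ltW s0).
  have eq := cluster_ecost cl; have [_ cl2 cl1 _ _] := cl.
  set l := nxt D i.*2.+1 s in p1 p2 p3 cl eq cl1 cl2.
  have lj : (i.+1.*2 < l)%N.
    rewrite ltn_neqAle doubleS p1 andbT; apply: contraNneq dr => e.
    by rewrite doubleS e.
  have mt := step_t _ _ t0 avt zt (lexx _).
  move: eq cl1; rewrite /ecost edgeE half.
  set c := z i.*2.+1 s in gap *; set c' := z i.*2.+1 t in mt zt *; set a := edge l c s => eq cl1.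
  have aY : Y i.+1 <= a.
    case: cl1 => -[] h' _; first by case: (half_neq0 lj h').
    have [h1|h1] := ltnP i.+1 l./2; first by apply: le_trans h'; apply: node_le; rewrite -ltnS (ltn_predK h1).
    have lE := half_le_succ h1 lj.
    by rewrite /a /edge lE /= odd_double /= uphalf_double.
  have mm := mass_le (incell_node D i.+1) cl1 aY.
  have m0m := mom0_bounds (incell_node D i.+1) cl1 aY.
  have ci0 := incellS_node D i.
  have k2 := mass_cell D i.+1 (Y i).
  have k3 : mom0 D i.+1 (Y i) - mom0 D i.+1 (Y i.+1) =
    rs i.+1 * (Y i ^+ 2 / 2) - rs i.+1 * (Y i.+1 ^+ 2 / 2) by exact: cumul_cell.
  have mlt := mass_lt ci0 cl1 (lt_le_trans (nodeS D i) aY).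
  have := mt _ _ cl1; move: eq; rewrite (cost_eq c s (incell_node D i) ci0).
  rewrite (cost_eq c' t (incell_node D i) ci0) /cost => eq ct.
  have r0 := pcrho_gt0 D i.+1; have stp := node_step D i.
  set m := mass D i.+1 (Y i) in k2 mlt eq ct; set m0 := mom0 D i.+1 (Y i) in k3 eq ct.
  set q := mom D i.+1 (Y i) in eq ct.
  set ma := mass D l./2 a in mm m0m eq ct mlt; set m0a := mom0 D l./2 a in m0m eq ct.
  set qa := mom D l./2 a in eq ct.
  set mY := mass D i.+1 (Y i.+1) in mm m0m k2; set m0Y := mom0 D i.+1 (Y i.+1) in m0m k3.
  have {m0m}/andP[m0m _] := m0m.
  set y0 := Y i in k2 k3 stp *; set y1 := Y i.+1 in k2 k3 stp m0m; set ro := rs i.+1 in r0 k2 k3.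
  set d := minstep D in stp *.
  have mu0 : 0 < ma - m by lra.
  have bary : (y0 + d / 2) * (ma - m) <= m0a - m0.
    have e : ma - m = (ma - mY) + ro * (y1 - y0) by lra.
    have d0 : 0 < d := minstep_gt0 D.
    have : 0 <= ro * (y1 - y0) * ((y1 - y0) / 2 - d / 2) by apply: mulr_ge0; [apply: mulr_ge0|]; lra.
    have n1 : 0 <= ma - mY by rewrite subr_ge0.
    have n2 : 0 <= y1 - y0 - d / 2 by lra.
    have := mulr_ge0 n1 n2.
    by rewrite e; lra.
  rewrite -(ler_pM2r mu0).
  have : (t - s) * ((y0 + d / 2) * (ma - m)) <= (t - s) * (m0a - m0) by rewrite ler_wpM2l ?subr_ge0.
  have : t * (m0 + s * q - c * m - (m0a + s * qa - c * ma)) = 0.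
    by rewrite [X in t * X](_ : _ = 0) ?mulr0//; lra.
  have : 0 <= s * ((m0a + t * qa - c' * ma) - (m0 + t * q - c' * m)).
    by rewrite pmulr_rge0//; lra.
  by lra.
set g := z i.*2.+1 s - z i.*2 s in gap.
have d0 := minstep_gt0 D.
have H1 : (t - s) * minstep D <= t * g.
  have : 0 <= s * (z i.*2.+1 t - z i.*2 t) by rewrite mulr_ge0 ?subr_ge0// ltW.
  by rewrite /g; lra.
have H2 : t * g <= t * h by rewrite ler_wpM2l ?(ltW t0)// ltW.
have H3 : (t - s) * h <= (t - s) * (minstep D / 2) by rewrite ler_wpM2l ?subr_ge0.
have : 0 <= s * h by apply: mulr_ge0; exact: ltW.
lra.
Qed.

End ClusterDynamics.

(** * Waves and tracking *)

Section Waves.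
Variables (R : realType) (D : pcdata R).
Local Notation Y := (node D).
Local Notation rs := (pcrho D).
Local Notation us := (pcu D).
Local Notation M := (umax D).
Local Notation z := (front_pos D).
Local Notation edge := (edge D).
Local Notation alive_at := (alive_at D).
Local Notation path := (front_path D).
Local Notation cluster_at := (cluster_at D).
Local Notation dtime := (dtime D).
Local Notation emass := (emass D).
Local Notation emom := (emom D).
Local Notation wmass := (wmass D).
Local Notation wmom := (wmom D).
Implicit Types (x y t s : R) (e k l r : nat).

(** The last extinction among the regions strictly between [l] and [r], and 0 if there are none. *)
Definition birth l r : \bar R :=
  foldr (fun k c => Order.max (dtime k) c) 0%E (iota l.+1 (r - l.+1)).

Lemma birth_le l r (c : \bar R) : (0 <= c)%E ->
  (birth l r <= c)%E <-> (forall k, (l < k < r)%N -> (dtime k <= c)%E).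
Proof.
move=> c0; rewrite /birth.
have -> : (forall k, (l < k < r)%N -> (dtime k <= c)%E) <->
    (forall k, k \in iota l.+1 (r - l.+1) -> (dtime k <= c)%E).
  by split => H k kk; apply: H; move: kk; rewrite mem_iota; lia.
elim: (iota _ _) => [|k s IH] /=; first by split.
rewrite ge_max; split.
- by move=> /andP[h /IH H] j; rewrite inE => /orP[/eqP -> //|]; exact: H.
- move=> H; rewrite H ?mem_head//=; apply/IH => j js; apply: H.
  by rewrite inE js orbT.
Qed.

Lemma birth_ge0 l r : (0 <= birth l r)%E.
Proof. by rewrite /birth; elim: (iota _ _) => //= k s IH; rewrite le_max IH orbT. Qed.

Lemma birth_attained l r : birth l r = 0%E \/
  exists2 k, (l < k < r)%N & birth l r = dtime k.
Proof.
rewrite /birth; have : forall k, k \in iota l.+1 (r - l.+1) -> (l < k < r)%N.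
  by move=> k; rewrite mem_iota; lia.
elim: (iota _ _) => [|k s IH] H /=; first by left.
case: (leP (dtime k) _) => _; last by right; exists k => //; apply: H; exact: mem_head.
by apply: IH => j js; apply: H; rewrite inE js orbT.
Qed.

Definition wave_ok (p : nat * nat) : bool :=
  (p.1 < p.2)%N && (birth p.1 p.2 < Order.min (dtime p.1) (dtime p.2))%E.

(** A single front, that is an edge of a vacuum, or the two fronts of a node with equal velocities,
    between which no vacuum ever opens. These are the groups without mass: see [contact_wmass0] and
    [shadow_wmass_gt0]. *)
Definition contact l r : bool :=
  (r == l.+1) || [&& r == l.+2, ~~ odd l & us l./2 == us l./2.+1].

Definition birth_time l r : R := fine (birth l r).

Definition reg k : region := if odd k then Vac k./2 else Const k./2.

(** Contribution of one front to the mass of its wave. A single term has no definite sign; only the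
    sum over a wave is a mass. *)
Definition xi e t : R := emass e.+1 (path e t) t - emass e (path e t) t.

Definition wave_strength l r t : R :=
  if contact l r then 0 else \sum_(l <= e < r) xi e t.

Definition wave_line l r t : R :=
  if contact l r then Y l./2 + us (uphalf l) * t else path l t.

(** Simple shadow waves are treated apart because [wmom / wmass] is [0 / 0] at time 0. *)
Definition wave_speed l r t : R :=
  if contact l r then us (uphalf l) else
  if (r == l.+2) && ~~ odd l then riemann_speed rs us l./2 else
  wmom l r t / wmass l r t.

Definition wave_x l r (d : R) : R := if birth_time l r == 0 then 0 else d.

(** The profile is exact for every [d]: density is strength over width and velocity is the speed, so
    the limits required of profiles reduce to equalities. *)
Definition wave_of l r : wave R :=
  Wave (~~ contact l r) (wave_line l r (birth_time l r)) (birth_time l r)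
    (Order.min (dtime l) (dtime r)) (wave_line l r) (wave_speed l r)
    (wave_strength l r) (reg l) (reg r) (wave_x l r)
    (fun d t => wave_strength l r t / (d * (t - birth_time l r) + 2 * wave_x l r d))
    (fun d t => wave_speed l r t).

Definition pc_pattern : pattern R :=
  @Pattern R {p : nat * nat | wave_ok p} (fun p => wave_of (val p).1 (val p).2)
    (fun i x t => (x - Y i) / t).

Lemma wave_ok_lt l r : wave_ok (l, r) -> (l < r)%N.
Proof. by case/andP. Qed.

Lemma birthE l r : wave_ok (l, r) -> birth l r = (birth_time l r)%:E.
Proof.
move=> /andP[_ /= H]; rewrite /birth_time fineK// ge0_fin_numE ?birth_ge0//.
exact: lt_le_trans H (leey _).
Qed.

Lemma birth_time_ge0 l r : 0 <= birth_time l r.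
Proof. exact: fine_ge0 (birth_ge0 l r). Qed.

Section OneWave.
Variables (l r : nat).
Hypothesis ok : wave_ok (l, r).
Let lr : (l < r)%N := wave_ok_lt ok.
Let w := wave_of l r.

Lemma wave_life_le t k : life w t -> (l < k < r)%N -> (dtime k <= t%:E)%E.
Proof.
move=> [h _]; have t0 : 0 <= t := le_trans (birth_time_ge0 l r) h.
have t0' : (0 <= t%:E)%E by rewrite lee_fin.
move: k; apply: (iffLR (birth_le l r t0')).
by rewrite (birthE ok) lee_fin.
Qed.

(** At the death time a bounding region is gone; the closed conditions of [cluster_at] are reached
    there as limits from earlier times. *)
Lemma life_cluster t : life w t -> 0 < t -> cluster_at l r t.
Proof.
move=> [h1 h2] t0.
have adj s : 0 < s -> birth_time l r <= s -> (s%:E < Order.min (dtime l) (dtime r))%E ->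
    cluster_at l r s.
  move=> s0 bs; rewrite lt_min !dtimeP// => /andP[al ar].
  apply: adjacent_cluster => //; first exact: ltW.
  move=> k lk; rewrite -dtime_leP//; apply: le_trans (_ : _ <= birth l r)%E _.
    by apply: (iffLR (birth_le l r (birth_ge0 l r))).
  by rewrite birthE// lee_fin.
move: h2 => /=; rewrite le_eqVlt => /orP[/eqP e|]; last exact: adj.
have bt : birth_time l r < t.
  by have /andP[_] := ok; rewrite /= -e birthE// lte_fin.
apply: (@cluster_closed _ _ l r (birth_time l r)) => //; first exact: birth_time_ge0.
move=> s bs st; apply: adj; [exact: le_lt_trans (birth_time_ge0 l r) bs|exact: ltW|].
by rewrite -e lte_fin.
Qed.

Lemma open_life_near t : open_life w t -> \forall s \near t, open_life w s.
Proof.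
move=> [h1 h2].
have d1 : \forall s \near t, (s%:E < death w)%E.
  move: h2; case: (death w) => [c| |] // h2; last first.
    by apply/nbhs_ballP; exists 1 => //= s _; rewrite ltry.
  by rewrite lte_fin in h2; apply: filterS (lt_nbhsl h2) => s; rewrite lte_fin.
by near=> s; split; near: s; [exact: lt_nbhsr | exact: d1].
Unshelve. all: by end_near. Qed.

Lemma open_life_life t : open_life w t -> life w t.
Proof. by move=> [h1 h2]; split; exact: ltW. Qed.

Lemma alive_life t : alive w t -> life w t.
Proof. by move=> [h1 h2]; split => //; exact: ltW. Qed.

Lemma open_life_gt0 t : open_life w t -> 0 < t.
Proof. by move=> [h _]; exact: le_lt_trans (birth_time_ge0 l r) h. Qed.

Lemma near_cluster t : open_life w t -> \forall s \near t, 0 <= s /\ cluster_at l r s.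
Proof.
move=> /open_life_near; apply: filterS => s os.
by split; [exact/ltW/open_life_gt0 | apply: life_cluster; [exact: open_life_life|exact: open_life_gt0]].
Qed.

End OneWave.

Lemma front_path_cluster l r t e : 0 <= t -> cluster_at l r t -> (l <= e < r)%N ->
  path e t = path l t.
Proof.
move=> t0 [zz _ _ _ _] /andP[le er]; rewrite !front_pathE//.
apply/eqP; rewrite eq_le; apply/andP; split; last exact: front_pos_mono.
by rewrite zz; apply: front_pos_mono => //; lia.
Qed.

Lemma sum_xi l r t : 0 <= t -> (l < r)%N -> cluster_at l r t ->
  \sum_(l <= e < r) xi e t = wmass l r t.
Proof.
move=> t0 lr cl.
rewrite (@eq_big_nat _ _ _ _ _ _ (fun e => emass e.+1 (path l t) t - emass e (path l t) t)).
  exact: (telescope_sumr (fun e => emass e (path l t) t) (ltnW lr)).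
by move=> e le; rewrite /xi (front_path_cluster t0 cl).
Qed.

(** At a node [mass] and [mom] may be computed in either adjacent cell. Choosing cell [uphalf e] for
    both edges shows that front [e] involves labels of one velocity only. *)
Lemma xi_mom e t : us (uphalf e) * xi e t =
  emom e.+1 (path e t) t - emom e (path e t) t.
Proof.
rewrite /xi /emass /emom /edge /= uphalf_half; case oe: (odd e) => /=.
- rewrite add1n (_ : mass D e./2 (Y e./2) = mass D e./2.+1 (Y e./2)); last first.
    by apply: cumul_eq; [exact: incell_node|exact: incellS_node].
  rewrite (_ : mom D e./2 (Y e./2) = mom D e./2.+1 (Y e./2)); last first.
    by apply: cumul_eq; [exact: incell_node|exact: incellS_node].
  rewrite mass_cell mom_cell (mass_cell _ _ (Y e./2)) (mom_cell _ _ (Y e./2)).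
  by ring.
- by rewrite add0n mass_cell mom_cell (mass_cell _ _ (_ - _)) (mom_cell _ _ (_ - _)); ring.
Qed.

Lemma sum_xi_mom l r t : 0 <= t -> (l < r)%N -> cluster_at l r t ->
  \sum_(l <= e < r) us (uphalf e) * xi e t = wmom l r t.
Proof.
move=> t0 lr cl.
rewrite (@eq_big_nat _ _ _ _ _ _ (fun e => emom e.+1 (path l t) t - emom e (path l t) t)).
  exact: (telescope_sumr (fun e => emom e (path l t) t) (ltnW lr)).
by move=> e le; rewrite xi_mom (front_path_cluster t0 cl).
Qed.

Lemma xi_continuous e : continuous (xi e).
Proof.
have E k : continuous (fun t => emass k (path e t) t).
  move=> t; have -> : (fun t => emass k (path e t) t) =
      (fun t => emass k 0 0 + edens D k * (path e t - t * us k./2)).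
    apply/funext => s; have := emassB D k 0 (path e s) 0 s; rewrite !subr0; lra.
  apply: cvgD; first exact: cvg_cst.
  apply: cvgM; first exact: cvg_cst.
  apply: cvgB; first exact: front_path_continuous.
  by apply: cvgM; [exact: cvg_id|exact: cvg_cst].
by move=> t; apply: cvgB; exact: E.
Qed.

Lemma ecost_even i x t y : ecost D i.*2 x t = cost D i y x t
  - rs i * (x - t * us i - y) ^+ 2 / 2.
Proof.
rewrite /ecost /edge odd_double doubleK.
by have := cost_cell D i y (x - t * us i) x t; lra.
Qed.

Lemma ecost_odd i x t : ecost D i.*2.+1 x t = cost D i (Y i) x t.
Proof. by rewrite /ecost /edge /= odd_double uphalf_double. Qed.

Lemma costS_node i x t : cost D i.+1 (Y i) x t = cost D i (Y i) x t.
Proof. by apply: cost_eq; [exact: incellS_node|exact: incell_node]. Qed.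

Lemma sqr_weight_eq0 (c x : R) : 0 < c -> c * x ^+ 2 / 2 = 0 -> x = 0.
Proof.
move=> c0 /eqP; rewrite mulf_eq0 invr_eq0 pnatr_eq0 orbF mulf_eq0 (gt_eqF c0) /=.
by rewrite sqrf_eq0 => /eqP.
Qed.

(** For a single front, equality of the edge costs says that a positive multiple of the squared
    distance to the line vanishes. For two fronts of equal velocity both edges are the same label,
    which the two cells squeeze to the node. *)
Lemma contact_line l r t : 0 < t -> (l < r)%N -> contact l r -> cluster_at l r t ->
  z l t = Y l./2 + us (uphalf l) * t.
Proof.
move=> t0 lr; rewrite /contact => /orP[/eqP er|/and3P[/eqP er ol /eqP eu]] cl.
- have := cluster_ecost cl; rewrite er.
  have [i [el|el]] : exists i, l = i.*2 \/ l = i.*2.+1.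
      by exists l./2; have := odd_double_half l; case: (odd l); [right|left]; lia.
  + rewrite el (ecost_even _ _ _ (Y i)) ecost_odd doubleK uphalf_double => h.
    have /sqr_weight_eq0 := pcrho_gt0 D i; move/(_ (z i.*2 t - t * us i - Y i)).
    by move=> /(_ ltac:(lra)); lra.
  + rewrite el -doubleS (ecost_even _ _ _ (Y i)) ecost_odd costS_node /= !uphalf_double doubleK => h.
    have /sqr_weight_eq0 := pcrho_gt0 D i.+1; move/(_ (z i.*2.+1 t - t * us i.+1 - Y i)).
    by move=> /(_ ltac:(lra)); lra.
- have [_ [_ c1] c2 _ _] := cl.
  have [i el] : exists i, l = i.*2 by exists l./2; have := odd_double_half l; rewrite (negbTE ol); lia.
  move: c1 c2; rewrite er el /edge /= !odd_double /= doubleK uphalf_double /=.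
  move: eu; rewrite el doubleK => eu.
  by move=> c1 [[//|/=] c2 _]; move: c2; rewrite -eu; lra.
Qed.

Lemma contact_wmass0 l r t : 0 < t -> (l < r)%N -> contact l r -> cluster_at l r t ->
  wmass l r t = 0.
Proof.
move=> t0 lr co cl; have zE := contact_line t0 lr co cl.
rewrite /wmass front_pathE ?(ltW t0)// zE.
have [_ cll clr _ _] := cl; rewrite zE in cll clr.
suff e : edge l (Y l./2 + us (uphalf l) * t) t = edge r (Y l./2 + us (uphalf l) * t) t.
  rewrite /emass e in cll *; apply/eqP; rewrite subr_eq0; apply/eqP.
  exact: cumul_eq clr cll.
rewrite /edge.
move: co; rewrite /contact => /orP[/eqP ->|/and3P[/eqP -> ol /eqP eu]] /=.
- by rewrite uphalf_half; case: (odd l) => /=; rewrite ?add1n ?add0n; ring.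
- by rewrite negbK (negbTE ol) uphalf_half (negbTE ol) add0n /= -eu.
Qed.

(** With [a] and [b] the lengths absorbed on the two sides, equality of the edge costs reads
    [rs i * a ^+ 2 = rs i.+1 * b ^+ 2]; its square root produces the weights of the Riemann
    speed. *)
Lemma simple_formula i t : 0 < t -> cluster_at i.*2 i.*2.+2 t ->
  [/\ us i.+1 <= us i, z i.*2 t = Y i + riemann_speed rs us i * t,
      wmass i.*2 i.*2.+2 t = Num.sqrt (rs i * rs i.+1) * (us i - us i.+1) * t &
      wmom i.*2 i.*2.+2 t = riemann_speed rs us i * wmass i.*2 i.*2.+2 t].
Proof.
move=> t0 cl; have := cluster_ecost cl; have [_ [_ c1] [+ _] _ _] := cl.
rewrite -doubleS (ecost_even _ _ _ (Y i)) (ecost_even _ _ _ (Y i)) costS_node.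
move: c1; rewrite /edge /= !odd_double !doubleK => c1 [//|/= c2] eqc.
have w1 : wmass i.*2 i.+1.*2 t = rs i.+1 * (z i.*2 t - t * us i.+1 - Y i) + rs i * (Y i + t * us i - z i.*2 t).
  rewrite /wmass front_pathE ?(ltW t0)// /emass /edge !odd_double !doubleK.
  rewrite mass_cell (mass_cell D i).
  have := cumulS D (fun k y => rs k * y) i; have := mass_cell D i.+1 (Y i).
  by rewrite /mass; lra.
have w2 : wmom i.*2 i.+1.*2 t = rs i.+1 * us i.+1 * (z i.*2 t - t * us i.+1 - Y i) + rs i * us i * (Y i + t * us i - z i.*2 t).
  rewrite /wmom front_pathE ?(ltW t0)// /emom /edge !odd_double !doubleK.
  rewrite mom_cell (mom_cell D i).
  have := cumulS D (fun k y => rs k * us k * y) i; have := mom_cell D i.+1 (Y i).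
  by rewrite /mom; lra.
rewrite w1 w2 /riemann_speed.
have r0 := pcrho_gt0 D i; have r1 := pcrho_gt0 D i.+1.
rewrite sqrtrM ?(ltW r0)//.
have s0 : 0 < Num.sqrt (rs i) by rewrite sqrtr_gt0.
have s1 : 0 < Num.sqrt (rs i.+1) by rewrite sqrtr_gt0.
have e0 : rs i = Num.sqrt (rs i) ^+ 2 by rewrite sqr_sqrtr// ltW.
have e1 : rs i.+1 = Num.sqrt (rs i.+1) ^+ 2 by rewrite sqr_sqrtr// ltW.
move: eqc s0 s1 e0 e1.
move: (Num.sqrt (rs i)) (Num.sqrt (rs i.+1)) => p q eqc s0 s1 e0 e1.
move: eqc; rewrite e0 e1.
set X := z i.*2 t in c1 c2 *; set a := Y i + t * us i - X; set b := X - t * us i.+1 - Y i.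
have a0 : 0 <= a by rewrite /a; lra.
have b0 : 0 <= b by rewrite /b; lra.
have -> : X - t * us i - Y i = - a by rewrite /a; ring.
move=> eqc; have {eqc}pq : p * a = q * b.
  apply: (pexpIrn (n := 2)); rewrite ?nnegrE ?mulr_ge0 ?(ltW s0) ?(ltW s1)//.
  by rewrite !exprMn; rewrite sqrrN in eqc; lra.
have ab : a + b = t * (us i - us i.+1) by rewrite /a /b; ring.
have pq0 : p + q != 0 by rewrite gt_eqF// addr_gt0.
split.
- rewrite -subr_ge0 -(pmulr_rge0 _ t0); lra.
- apply: (mulIf pq0); rewrite mulrDl [_ * t * _]mulrAC divfK//.
  have : p * (Y i + t * us i - X) = q * (X - t * us i.+1 - Y i) by [].
  by lra.
- have -> : p * q * (us i - us i.+1) * t = p * q * (a + b) by rewrite ab; ring.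
  have h1 : q * (q * b) = q * (p * a) by rewrite pq.
  have h2 : p * (p * a) = p * (q * b) by rewrite pq.
  by lra.
- apply: (mulIf pq0); rewrite [X in _ = X]mulrAC divfK//.
  have e : q * b = p * a by [].
  have -> : (q ^+ 2 * us i.+1 * b + p ^+ 2 * us i * a) * (p + q) =
    (us i.+1 * q * (q * b) + us i * p * (p * a)) * (p + q) by ring.
  have -> : (p * us i + q * us i.+1) * (q ^+ 2 * b + p ^+ 2 * a) =
    (p * us i + q * us i.+1) * (q * (q * b) + p * (p * a)) by ring.
  by rewrite e; ring.
Qed.

(** Constant regions have positive lifetime, so a wave born at time 0 has at most one region, a
    vacuum, between its two sides. *)
Lemma contact_simple_dec l r t : (l < r)%N -> life (wave_of l r) t -> wave_ok (l, r) ->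
  birth_time l r = 0 -> ~~ contact l r -> r = l.+2 /\ ~~ odd l.
Proof.
move=> lr lf ok b0 nc.
have dz k : (l < k < r)%N -> (dtime k <= 0)%E.
  by apply: (iffLR (birth_le l r (lexx 0%E))); rewrite birthE// b0.
have evn k : (l < k < r)%N -> odd k.
  move=> lk; apply/negPn/negP => ok'; have := dz k lk.
  have -> : k = k./2.*2 by have := odd_double_half k; rewrite (negbTE ok'); lia.
  by rewrite leNgt dtime_const.
have [e|ne] := eqVneq r l.+1; first by rewrite /contact e eqxx in nc.
have o1 : odd l.+1 by apply: evn; lia.
have [->|ne2] := eqVneq r l.+2; first by move: o1.
have : odd l.+2 by apply: evn; lia.
by move: o1; rewrite /= => /negbTE ->.
Qed.

End Waves.

Lemma continuous_sum (R : realType) (I : Type) (s : seq I) (f : I -> R -> R) :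
  (forall i, continuous (f i)) -> continuous (fun t => \sum_(i <- s) f i t).
Proof.
move=> cf; elim: s => [|i s IH] t.
  by under eq_fun do rewrite big_nil; exact: cvg_cst.
by under eq_fun do rewrite big_cons; apply: cvgD; [exact: cf|exact: IH].
Qed.

Section Pattern.
Variables (R : realType) (D : pcdata R).
Local Notation Y := (node D).
Local Notation rs := (pcrho D).
Local Notation us := (pcu D).
Local Notation M := (umax D).
Local Notation z := (front_pos D).
Local Notation edge := (edge D).
Local Notation alive_at := (alive_at D).
Local Notation path := (front_path D).
Local Notation cluster_at := (cluster_at D).
Local Notation dtime := (dtime D).
Local Notation emass := (emass D).
Local Notation emom := (emom D).
Local Notation wmass := (wmass D).
Local Notation wmom := (wmom D).
Local Notation wave_ok := (wave_ok D).
Local Notation wave_of := (wave_of D).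
Local Notation birth := (birth D).
Local Notation birth_time := (birth_time D).
Local Notation contact := (contact D).
Local Notation xi := (xi D).
Local Notation P := (pc_pattern D).
Implicit Types (x y t s : R) (e k l r : nat).

Lemma adjacent_wave l r t : 0 < t -> (l < r)%N -> alive_at l t -> alive_at r t ->
  (forall k, (l < k < r)%N -> ~~ alive_at k t) -> wave_ok (l, r) /\ alive (wave_of l r) t.
Proof.
move=> t0 lr al ar dead; have t0' : (0 <= t%:E)%E by rewrite lee_fin ltW.
have bt : (birth l r <= t%:E)%E.
  by apply/(birth_le D l r t0') => k lk; rewrite dtime_leP// dead.
have tm : (t%:E < Order.min (dtime l) (dtime r))%E by rewrite lt_min !dtimeP// al ar.
have ok : wave_ok (l, r) by apply/andP; split => //; exact: le_lt_trans bt tm.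
by split => //; split => //; rewrite -lee_fin /= -birthE.
Qed.

Lemma front_wave e t : 0 < t ->
  wave_ok (prv D e t, nxt D e t) /\ alive (wave_of (prv D e t) (nxt D e t)) t.
Proof.
move=> t0; have [p1 p2 p3] := prvP D e t; have [n1 n2 n3] := nxtP D e (ltW t0).
apply: adjacent_wave => //; first exact: leq_ltn_trans n1.
move=> k /andP[pk kn]; have [ke|ek] := leqP k e; first by apply: p3; rewrite pk.
by apply: n3; rewrite ek.
Qed.

Section OneWave.
Variables (l r : nat).
Hypothesis ok : wave_ok (l, r).
Let lr : (l < r)%N := wave_ok_lt ok.
Let w := wave_of l r.

Lemma wave_line_path t : life w t -> line w t = path l t.
Proof.
move=> lf; rewrite /= /wave_line; case: ifP => // co.
have t0 : 0 <= t := le_trans (birth_time_ge0 D l r) (proj1 lf).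
rewrite front_pathE//; move: t0; rewrite le_eqVlt => /orP[/eqP <-|t0].
  by rewrite front_pos0 mulr0 addr0.
by rewrite (contact_line t0 lr co)//; exact: life_cluster.
Qed.

Lemma wave_strengthE t : life w t -> 0 < t -> strength w t = wmass l r t.
Proof.
move=> lf t0; have cl := life_cluster ok lf t0; rewrite /= /wave_strength.
by case: ifP => co; [rewrite (contact_wmass0 t0 lr co cl) | rewrite (sum_xi (ltW t0) lr cl)].
Qed.

Lemma shadow_wmass_gt0 t : ~~ contact l r -> life w t -> 0 < t -> 0 < wmass l r t.
Proof.
move=> nc lf t0; have cl := life_cluster ok lf t0.
apply: wmass_gt0 => //; first exact: ltW.
apply/negP => /eqP e; have [_ [er|[er ol]]] := cluster_edge_eq lr cl e.
  by move: nc; rewrite /contact er eqxx.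
move: nc; rewrite /contact er eqxx ol /= => /norP[_ /eqP]; apply.
move: e; rewrite er /edge /= negbK (negbTE ol) /= => e.
have : t * (us l./2 - us l./2.+1) = 0 by lra.
by move/eqP; rewrite mulf_eq0 gt_eqF//= subr_eq0 => /eqP.
Qed.

Lemma shadow_speedE t : ~~ contact l r -> life w t -> 0 < t ->
  speed w t = wmom l r t / wmass l r t.
Proof.
move=> nc lf t0; have S0 := shadow_wmass_gt0 nc lf t0.
rewrite /= /wave_speed (negbTE nc); case: ifP => // /andP[/eqP er ol].
have cl := life_cluster ok lf t0; rewrite er in cl S0 *.
have el : l = l./2.*2 by have := odd_double_half l; rewrite (negbTE ol); lia.
rewrite el in cl S0 *; have [_ _ _ ->] := simple_formula t0 cl.
by rewrite doubleK mulfK// gt_eqF.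
Qed.

Lemma xi0 e : xi e 0 = 0.
Proof.
rewrite /xi front_pathE// front_pos0 /emass /edge /= uphalf_half !mul0r !subr0.
case: (odd e) => /=; rewrite ?add0n ?subrr// add1n; apply/eqP; rewrite subr_eq0; apply/eqP.
by apply: cumul_eq; [exact: incellS_node|exact: incell_node].
Qed.

Lemma wave_strength0 : wave_strength D l r 0 = 0.
Proof.
rewrite /wave_strength; case: ifP => // _; rewrite big1_seq// => e _; exact: xi0.
Qed.

Lemma wave_strength_ge0 t : life w t -> 0 <= strength w t.
Proof.
move=> lf; have := le_trans (birth_time_ge0 D l r) (proj1 lf).
rewrite le_eqVlt => /orP[/eqP <-|t0]; first by rewrite /= wave_strength0.
rewrite wave_strengthE//; apply: wmass_ge0 => //; first exact: ltW.
exact: life_cluster.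
Qed.

Lemma wave_momentum t : life w t -> 0 < t -> strength w t * speed w t = wmom l r t.
Proof.
move=> lf t0; rewrite wave_strengthE//; have cl := life_cluster ok lf t0.
case co : (contact l r); last first.
  have nc : ~~ contact l r by rewrite co.
  by rewrite shadow_speedE// mulrC divfK// gt_eqF// shadow_wmass_gt0.
have := wmom_le (ltW t0) lr cl; rewrite (contact_wmass0 t0 lr co cl) mulr0 normr_le0 => /eqP ->.
by rewrite mul0r.
Qed.

Lemma shadow_born0 : ~~ contact l r -> birth_time l r = 0 ->
  [/\ r = l.+2, ~~ odd l & us l./2.+1 < us l./2].
Proof.
move=> nc b0.
have lf : life w (birth_time l r).
  by split => //; have /andP[_ /ltW] := ok; rewrite birthE.
have [er ol] := contact_simple_dec lr lf ok b0 nc; split => //.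
have el : l = l./2.*2 by have := odd_double_half l; rewrite (negbTE ol); lia.
rewrite lt_neqAle; apply/andP; split.
  apply/eqP => e; move: nc; rewrite /contact er eqxx ol e eqxx /=.
  by rewrite orbT.
rewrite leNgt; apply/negP => /dtime_vac.
have b0' : (birth l r <= 0)%E by rewrite birthE// b0.
have := (iffLR (birth_le D l r (lexx 0%E)) b0') l.+1.
by rewrite -el er => /(_ ltac:(lia)); rewrite leNgt => /negP.
Qed.

Lemma simple_life t : r = l.+2 -> ~~ odd l -> life w t -> 0 <= t ->
  path l t = Y l./2 + riemann_speed rs us l./2 * t.
Proof.
move=> er ol lf; rewrite le_eqVlt => /orP[/eqP <-|t0].
  by rewrite front_pathE// front_pos0 mulr0 addr0.
have cl := life_cluster ok lf t0.
have el : l = l./2.*2 by have := odd_double_half l; rewrite (negbTE ol); lia.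
rewrite er el in cl; have [_ h _ _] := simple_formula t0 cl.
by rewrite front_pathE ?(ltW t0)// {1}el.
Qed.

Lemma simple_strength t : ~~ contact l r -> r = l.+2 -> ~~ odd l -> life w t -> 0 <= t ->
  strength w t = Num.sqrt (rs l./2 * rs l./2.+1) * (us l./2 - us l./2.+1) * t.
Proof.
move=> nc er ol lf; rewrite le_eqVlt => /orP[/eqP <-|t0].
  by rewrite /= wave_strength0 mulr0.
rewrite wave_strengthE//; have cl := life_cluster ok lf t0.
have el : l = l./2.*2 by have := odd_double_half l; rewrite (negbTE ol); lia.
rewrite er el in cl; have [_ _ h _] := simple_formula t0 cl.
by rewrite er {1 2}el.
Qed.

Lemma edens_left k : edens D k * us k./2 = dens rs (reg k) * vel_left us (reg k) /\
  edens D k * us k./2 = dens rs (reg k) * vel_right us (reg k) /\ edens D k = dens rs (reg k).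
Proof. by rewrite /edens /reg; case: (odd k) => /=; rewrite ?mul0r. Qed.

Lemma wave_shadow_profile : ~~ contact l r -> shadow_profile w.
Proof.
move=> nc; have b0 := birth_time_ge0 D l r.
split.
- split => [d d0|/= b00 d d0]; rewrite /= /wave_x; last by rewrite b00 eqxx.
  by case: ifP => // _; exact: ltW.
- move=> /= bgt; exists 1 => //.
  apply: cvg_near_cst; near=> d; have d0 : 0 < d by near: d; exact: nbhs_right_gt.
  by rewrite /wave_x gt_eqF// divff// gt_eqF.
- move=> t lf /= bt; have t0 := le_lt_trans b0 bt.
  pose c := t - birth_time l r + (if birth_time l r == 0 then 0 else 2).
  have c0 : 0 < c by rewrite /c; case: ifP => _; lra.
  exists (strength w t / c).
    by rewrite divr_gt0// wave_strengthE// shadow_wmass_gt0.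
  apply: cvg_near_cst; near=> d; have d0 : 0 < d by near: d; exact: nbhs_right_gt.
  rewrite invrK -mulrA; congr (_ * _).
  have -> : d * (t - birth_time l r) + 2 * wave_x D l r d = d * c.
    by rewrite /c /wave_x; case: ifP => _; ring.
  by rewrite invfM mulrAC mulVf ?mul1r// gt_eqF.
- by move=> t lf; exact: cvg_cst.
- move=> t lf; apply: cvg_near_cst; near=> d.
  have d0 : 0 < d by near: d; exact: nbhs_right_gt.
  have t0 : 0 <= t := le_trans b0 (proj1 lf).
  rewrite /strip_mass [is_shadow w]nc /width /=.
  (* The width vanishes only at time 0 for a wave born then, where the strength vanishes too. *)
  have [e|ne] := eqVneq (d * (t - birth_time l r) + 2 * wave_x D l r d) 0; last first.
    by rewrite mulrC divfK.
  rewrite e mul0r; suff -> : t = 0 by rewrite wave_strength0.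
  have x0 : 0 <= wave_x D l r d by rewrite /wave_x; case: ifP => // _; exact: ltW.
  have dt0 : 0 <= d * (t - birth_time l r) by apply: mulr_ge0; [exact: ltW | rewrite subr_ge0; exact: (proj1 lf)].
  have bz : birth_time l r = 0.
    apply/eqP; apply/negPn/negP => bn; have : wave_x D l r d = d by rewrite /wave_x (negbTE bn).
    by lra.
  have : d * (t - birth_time l r) = 0 by lra.
  by move/eqP; rewrite mulf_eq0 (gt_eqF d0) /= bz subr0 => /eqP.
Unshelve. all: by end_near. Qed.

Lemma wave_shadow_wave : ~~ contact l r -> shadow_wave rs us w.
Proof.
move=> nc; have b0 := birth_time_ge0 D l r.
have lfp t : life w t -> time0 w < t -> 0 < t by move=> _ bt; exact: le_lt_trans b0 bt.
split => //.
- split.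
  + have -> : line w = path l by apply/funext => t; rewrite /= /wave_line (negbTE nc).
    by apply: continuous_subspaceT => t; exact: front_path_continuous.
  + case simp : ((r == l.+2) && ~~ odd l).
      have -> : speed w = cst (riemann_speed rs us l./2).
        by apply/funext => t; rewrite /= /wave_speed (negbTE nc) simp.
      by apply: continuous_subspaceT => t; exact: cvg_cst.
    have -> : speed w = (fun t => wmom l r t / wmass l r t).
      by apply/funext => t; rewrite /= /wave_speed (negbTE nc) simp.
    (* Among shadow waves only the simple ones are born at time 0; for the others the quotient is
       continuous on the whole closed life. *)
    have bn : 0 < birth_time l r.
      rewrite lt_neqAle b0 andbT eq_sym; apply/eqP => bz.
      by have [er ol _] := shadow_born0 nc bz; rewrite er eqxx ol in simp.
    apply: continuous_in_subspaceT => t /set_mem lf.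
    have t0 : 0 < t := lt_le_trans bn (proj1 lf).
    apply: cvgM; first exact: wmom_continuous.
    by apply: cvgV; [rewrite gt_eqF// shadow_wmass_gt0|exact: wmass_continuous].
  + have -> : strength w = (fun t => \sum_(l <= e < r) xi e t).
      by apply/funext => t; rewrite /= /wave_strength (negbTE nc).
    by apply: continuous_subspaceT; apply: continuous_sum => e; exact: xi_continuous.
- move=> t ol; have t0 := open_life_gt0 ol; have lf := open_life_life ol.
  have nr := near_cluster ok ol; have S0 := shadow_wmass_gt0 nc lf t0.
  have near_life : \forall s \near t, life w s /\ 0 < s.
    apply: filterS (open_life_near ol) => s os.
    by split; [exact: open_life_life | exact: open_life_gt0 os].
  have [e1 [e2 e3]] := edens_left r; have [f1 [f2 f3]] := edens_left l.
  rewrite shadow_speedE//; split.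
  + have -> : line w = path l by apply/funext => s; rewrite /= /wave_line (negbTE nc).
    exact: is_derive_path.
  + apply: (near_eq_is_derive (f := wmass l r)).
      by apply: filterS near_life => s [ls s0]; rewrite wave_strengthE.
    have := is_derive_wmass lr nr S0; congr is_derive.
    by rewrite /= -e2 -f1 -e3 -f3; ring.
  + apply: (near_eq_is_derive (f := wmom l r)).
      by apply: filterS near_life => s [ls s0]; rewrite wave_momentum.
    have := is_derive_wmom lr nr S0; congr is_derive.
    rewrite /= !expr2 !mulrA -e2 -f1.
    have -> : edens D r * us r./2 * vel_right us (reg r) = edens D r * us r./2 * us r./2.
      by rewrite /edens /reg; case: (odd r); rewrite ?mul0r.
    have -> : edens D l * us l./2 * vel_left us (reg l) = edens D l * us l./2 * us l./2.
      by rewrite /edens /reg; case: (odd l); rewrite ?mul0r.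
    by ring.
- exact: wave_shadow_profile.
Qed.

(** Dividing [cluster_barycenter] by the mass gives [edge l <= z - t * speed <= edge r]. Next to a
    constant region this is the claim; next to a vacuum [argmin_node] places [z] in the fan. *)
Lemma wave_admissible t : alive w t ->
  if is_shadow w then (vel_right us (rreg w) <= speed w t <= vel_left us (lreg w) : Prop)
    else speed w t = vel_left us (lreg w) /\ speed w t = vel_right us (rreg w).
Proof.
move=> al; have lf := alive_life al; rewrite [is_shadow w]/=.
case co : (contact l r) => /=.
  rewrite /wave_speed co; move: co; rewrite /contact => /orP[/eqP ->|/and3P[/eqP -> ol /eqP eu]].
    by rewrite /reg /= uphalf_half; case ol : (odd l) => /=; rewrite ?add0n ?add1n.
  by rewrite /reg /= negbK (negbTE ol) /= uphalf_half (negbTE ol) add0n eu.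
have nc : ~~ contact l r by rewrite co.
have t0 := le_trans (birth_time_ge0 D l r) (proj1 lf).
(* At time 0 the barycenter inequality is void; the wave is then simple and its speed is a weighted
   mean of the two velocities. *)
move: t0; rewrite le_eqVlt => /orP[/eqP tz|t0].
  have bz : birth_time l r = 0.
    by apply/eqP; rewrite eq_le birth_time_ge0 andbT tz; exact: (proj1 lf).
  have [er ol uu] := shadow_born0 nc bz.
  rewrite /wave_speed co er eqxx ol /= /reg /= negbK (negbTE ol) /= /riemann_speed.
  have s0 : 0 < Num.sqrt (rs l./2) by rewrite sqrtr_gt0 pcrho_gt0.
  have s1 : 0 < Num.sqrt (rs l./2.+1) by rewrite sqrtr_gt0 pcrho_gt0.
  rewrite ler_pdivlMr ?addr_gt0// ler_pdivrMr ?addr_gt0//.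
  apply/andP; split.
  - have : Num.sqrt (rs l./2) * us l./2.+1 <= Num.sqrt (rs l./2) * us l./2 by rewrite ler_pM2l// ltW.
    by lra.
  - have : Num.sqrt (rs l./2.+1) * us l./2.+1 <= Num.sqrt (rs l./2.+1) * us l./2 by rewrite ler_pM2l// ltW.
    by lra.
have := shadow_speedE nc lf t0; rewrite /= => ->.
have S0 := shadow_wmass_gt0 nc lf t0; have cl := life_cluster ok lf t0.
have /andP[h1 h2] := cluster_barycenter (ltW t0) lr cl.
set v := wmom l r t / wmass l r t.
have vS : wmom l r t = v * wmass l r t by rewrite /v divfK// gt_eqF.
rewrite vS mulrA -mulrBl ler_pM2r// in h1; rewrite vS mulrA -mulrBl ler_pM2r// in h2.
have [_ c1 c2 m1 m2] := cl.
have nodeb k : odd k -> incell D k./2 (edge k (z l t) t) -> minimal D k./2 (edge k (z l t) t) (z l t) t ->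
    Y k./2 + t * us k./2 <= z l t <= Y k./2 + t * us k./2.+1.
  move=> ok' c m; apply: argmin_node; exists k./2; first exact: incell_node.
  by move: m; rewrite /edge ok'.
apply/andP; split; rewrite -(ler_pM2l t0) /reg.
- case orr : (odd r) => /=; last by move: h2; rewrite /edge orr; lra.
  have /andP[n1 n2] := nodeb r orr c2 m2.
  by move: h2; rewrite /edge orr; lra.
- case oll : (odd l) => /=; last by move: h1; rewrite /edge oll; lra.
  have /andP[n1 n2] := nodeb l oll c1 m1.
  by move: h1; rewrite /edge oll; lra.
Qed.

End OneWave.
End Pattern.

(** * Interactions *)

Section Tracking.
Variables (R : realType) (D : pcdata R).
Local Notation Y := (node D).
Local Notation rs := (pcrho D).
Local Notation us := (pcu D).
Local Notation M := (umax D).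
Local Notation z := (front_pos D).
Local Notation alive_at := (alive_at D).
Local Notation path := (front_path D).
Local Notation dtime := (dtime D).
Local Notation wave_ok := (wave_ok D).
Local Notation wave_of := (wave_of D).
Local Notation birth := (birth D).
Local Notation birth_time := (birth_time D).
Local Notation contact := (contact D).
Local Notation xi := (xi D).
Local Notation P := (pc_pattern D).
Implicit Types (x y t s : R) (e k l r : nat).

Lemma wave_dead l r k : wave_ok (l, r) -> (l < k < r)%N ->
  (dtime k <= (birth_time l r)%:E)%E.
Proof. by move=> ok; apply: (iffLR (birth_le D l r _)); rewrite ?birthE// lee_fin birth_time_ge0. Qed.

Lemma wave_death_gt l r : wave_ok (l, r) ->
  ((birth_time l r)%:E < dtime l)%E /\ ((birth_time l r)%:E < dtime r)%E.
Proof. by move=> ok; have /andP[_] := ok; rewrite birthE// lt_min => /andP[]. Qed.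

Lemma wave_birth_life l r : wave_ok (l, r) -> life (wave_of l r) (birth_time l r).
Proof. by move=> ok; split => //; have /andP[_ /ltW] := ok; rewrite birthE. Qed.

(** The regions from [l] to [r] that survive up to the birth time cut the new wave into its incoming
    waves, one for each pair of consecutive indices; the inner ones die exactly then. *)
Lemma interaction_chain l r : wave_ok (l, r) -> 0 < birth_time l r ->
  exists n (s : nat -> nat),
    [/\ s 0%N = l, s n.+2 = r,
        forall i j, (i < j)%N -> (j <= n.+2)%N -> (s i < s j)%N,
        forall k, (l <= k <= r)%N -> ((birth_time l r)%:E <= dtime k)%E ->
          exists2 j, (j <= n.+2)%N & k = s j &
        (forall j, (j <= n.+2)%N -> ((birth_time l r)%:E <= dtime (s j))%E) /\
        forall j, (0 < j < n.+2)%N -> dtime (s j) = (birth_time l r)%:E].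
Proof.
move=> ok T0; set T := birth_time l r in T0 *.
have lr := wave_ok_lt ok; have [dl dr] := wave_death_gt ok.
pose mid := [seq k <- iota l.+1 (r - l.+1) | (T%:E <= dtime k)%E].
have LE : [seq k <- iota l (r - l).+1 | (T%:E <= dtime k)%E] = l :: rcons mid r.
  rewrite /= (ltW dl); congr (_ :: _).
  have -> : (r - l = (r - l.+1) + 1)%N by lia.
  rewrite iotaD filter_cat -cats1; congr (_ ++ _).
  have -> : (l.+1 + (r - l.+1) = r)%N by lia.
  by rewrite /= (ltW dr).
have srt : sorted ltn (l :: rcons mid r).
  by rewrite -LE; apply: sorted_filter; [exact: ltn_trans|exact: iota_ltn_sorted].
have memL k : (k \in l :: rcons mid r) = (l <= k <= r)%N && (T%:E <= dtime k)%E.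
  rewrite -LE mem_filter mem_iota andbC; congr (_ && _).
  by apply/idP/idP => /andP[? ?]; apply/andP; split; lia.
(* The birth time, being positive, is the extinction time of some inner region, so at least two
   waves come in. *)
have midn : (0 < size mid)%N.
  have [b0|[k lk bk]] := birth_attained D l r.
    by move: T0; rewrite /T /birth_time b0 /= ltxx.
  have : k \in mid.
    by rewrite mem_filter mem_iota -bk birthE// lexx; apply/andP; split => //; apply/andP; split; lia.
  by case: (mid).
have sz : size (l :: rcons mid r) = (size mid).+2 by rewrite /= size_rcons.
have mono i j : (i < j)%N -> (j <= (size mid).-1.+2)%N ->
    (nth 0 (l :: rcons mid r) i < nth 0 (l :: rcons mid r) j)%N.
  by move=> ij jn; apply: (sorted_ltn_nth ltn_trans 0%N srt); rewrite ?inE ?sz //; lia.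
exists (size mid).-1, (fun j => nth 0%N (l :: rcons mid r) j); split => //.
- by rewrite /= prednK// nth_rcons ltnn eqxx.
- move=> k lk Tk; have : k \in l :: rcons mid r by rewrite memL lk.
  move=> /(nthP 0%N)[j jn <-]; exists j => //.
  by move: jn; rewrite sz; lia.
- have inL j : (j <= (size mid).-1.+2)%N -> nth 0 (l :: rcons mid r) j \in l :: rcons mid r.
    by move=> jn; apply: mem_nth; rewrite sz; lia.
  have Tle j : (j <= (size mid).-1.+2)%N -> (T%:E <= dtime (nth 0%N (l :: rcons mid r) j))%E.
    by move=> /inL; rewrite memL => /andP[].
  split => // j /andP[j0 jn]; apply/eqP; rewrite eq_le Tle ?(ltnW jn)// andbT.
  apply: wave_dead => //; apply/andP; split.
    by have := mono 0%N j j0 (ltnW jn).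
  have := mono j (size mid).-1.+2 jn (leqnn _).
  by rewrite /= prednK// nth_rcons ltnn eqxx.
Qed.

Lemma chain_between n (s : nat -> nat) i k :
  (forall i j, (i < j)%N -> (j <= n)%N -> (s i < s j)%N) -> (i < n)%N ->
  (s i < k < s i.+1)%N -> ~ exists2 j, (j <= n)%N & k = s j.
Proof.
move=> mono lin /andP[h1 h2] [j jn e]; subst k.
have [ij|ji] := ltnP i j; last first.
  move: ji; rewrite leq_eqVlt => /orP[/eqP e|ji]; first by rewrite e ltnn in h1.
  by have := mono _ _ ji (ltnW lin); lia.
move: ij; rewrite leq_eqVlt => /orP[/eqP e|ij]; first by rewrite e ltnn in h2.
by have := mono _ _ ij jn; lia.
Qed.

Lemma sum_chain (n : nat) (s : nat -> nat) (F : nat -> R) :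
  (forall i, (i < n)%N -> (s i <= s i.+1)%N) ->
  \sum_(s 0%N <= e < s n) F e = \sum_(i < n) \sum_(s i <= e < s i.+1) F e.
Proof.
elim: n => [|n IH] H; first by rewrite big_geq// big_ord0.
have le0 m : (m <= n)%N -> (s 0%N <= s m)%N.
  elim: m => [//|m IHm] mn; apply: leq_trans (IHm (ltnW mn)) (H m _).
  exact: leq_trans mn (leqnSn n).
rewrite (@big_cat_nat _ _ _ (s n)) ?H ?le0//= IH ?big_ord_recr//.
by move=> i lin; apply: H; exact: ltnW.
Qed.

Lemma line_lt_alive l r p q k t : 0 < t -> alive_at k t ->
  life (wave_of l r) t -> life (wave_of p q) t -> wave_ok (l, r) -> wave_ok (p, q) ->
  (l < k <= p)%N -> line (wave_of l r) t < line (wave_of p q) t.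
Proof.
move=> t0 ak lf1 lf2 ok1 ok2 lkp.
by rewrite !wave_line_path// !front_pathE ?(ltW t0)//; apply: alive_lt (ltW t0) ak lkp.
Qed.

Lemma wave_z l r t : 0 <= t -> wave_ok (l, r) -> life (wave_of l r) t ->
  line (wave_of l r) t = z l t.
Proof. by move=> t0 ok lf; rewrite wave_line_path// front_pathE. Qed.

(** The second conclusion serves [terminal_waves]: an incoming wave is recognised by its regions and
    its death time alone. *)
Lemma wave_interaction (w : front P) : 0 < time0 (P w) ->
  exists n (f : 'I_n.+2 -> front P), interaction f w /\
   (forall p q, ((val w).1 <= p)%N -> (q <= (val w).2)%N -> wave_ok (p, q) ->
     Order.min (dtime p) (dtime q) = (time0 (P w))%:E -> exists k : 'I_n.+2, val (f k) = (p, q)).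
Proof.
case: w => [[l r] ok] /=; set T := birth_time l r => T0.
have lr := wave_ok_lt ok; have [dl dr] := wave_death_gt ok.
have [n [s [s0 sn mono allk [Tle Teq]]]] := interaction_chain ok T0.
rewrite -/T in allk Tle Teq.
have bt j k : (j < n.+2)%N -> (s j < k < s j.+1)%N -> (dtime k < T%:E)%E.
  move=> jn jk; rewrite ltNge; apply/negP => Tk.
  apply: (chain_between mono jn jk); apply: allk => //.
  have h1 : (l <= s j)%N.
    by rewrite -s0; case: (j) jn => // j' j'n; apply: ltnW; apply: mono => //; exact: ltnW.
  have h2 : (s j.+1 <= r)%N.
    rewrite -sn; move: jn; rewrite leq_eqVlt => /orP[/eqP [->]//|jn].
    by apply: ltnW; apply: mono.
  by case/andP: jk => *; apply/andP; split; lia.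
have okf (j : 'I_n.+2) : wave_ok (s j, s j.+1).
  apply/andP; split; first by apply: mono => //; exact: ltn_ord.
  apply: (@lt_le_trans _ _ T%:E); last first.
    by rewrite /= le_min (Tle _ (ltn_ord j)) (Tle _ (ltnW (ltn_ord j))).
  have [->|[k jk ->]] := birth_attained D (s j) (s j.+1); first by rewrite lte_fin.
  by apply: bt jk; exact: ltn_ord.
pose f (j : 'I_n.+2) : front P := exist _ (s j, s j.+1) (okf j).
have lts (i j : nat) : (i <= j)%N -> (j <= n.+2)%N -> (s i <= s j)%N.
  by rewrite leq_eqVlt => /orP[/eqP -> //|ij] jn; apply: ltnW; exact: mono.
have fdeath j : death (P (f j)) = T%:E.
  have jn := ltn_ord j; rewrite /=; apply/eqP.
  rewrite eq_le le_min (Tle _ jn) (Tle _ (ltnW jn)).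
  rewrite andbT ge_min.
  have [j0|j0] := posnP (j : nat).
    by rewrite (Teq j.+1) ?lexx ?orbT//= j0.
  by rewrite (Teq (j : nat)) ?lexx//= j0.
have lfw : life (wave_of l r) T := wave_birth_life ok.
have flife j : life (P (f j)) T.
  split; last by rewrite fdeath.
  rewrite -lee_fin -birthE//; last exact: okf.
  apply: ltW; have /andP[_ h] := okf j; apply: lt_le_trans h _.
  by have := fdeath j; rewrite /= => ->; exact: lexx.
have zl e : (l <= e < r)%N -> z e T = z l T.
  move=> le; have cl := life_cluster ok lfw T0.
  by have := front_path_cluster (ltW T0) cl le; rewrite !front_pathE ?(ltW T0).
have posE : line (wave_of l r) T = z l T by rewrite wave_z// ltW.
have posE' : wave_line D l r T = z l T := posE.
have fline j : line (P (f j)) T = z l T.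
  have jn := ltn_ord j.
  transitivity (z (s j) T); first exact: wave_z (ltW T0) (okf j) (flife j).
  apply: zl; rewrite -s0 -sn lts ?(ltnW jn)//=.
  by apply: mono => //; exact: ltn_ord.
have alL : alive_at l T by rewrite -dtimeP.
have alR : alive_at r T by rewrite -dtimeP.
(* Regions [l] and [r] have positive width at time [T], so a wave through the same point cannot
   reach beyond them. *)
have inside p q : (p < q)%N -> z p T = z l T -> (forall k, (p < k < q)%N -> (dtime k <= T%:E)%E) ->
    (l <= p)%N /\ (q <= r)%N.
  move=> pq zp dead; have lp : (l <= p)%N.
    rewrite leqNgt; apply/negP => pl.
    by have := alive_lt (ltW T0) alL (_ : p < l <= l)%N; rewrite pl leqnn zp ltxx => /(_ isT).
  split => //; rewrite leqNgt; apply/negP => rq.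
  have [rp|pr] := leqP r p.
    by have := alive_lt (ltW T0) alR (_ : l < r <= p)%N; rewrite lr rp zp ltxx => /(_ isT).
  by have := dead r; rewrite pr rq => /(_ isT); rewrite leNgt dr.
have find p q : wave_ok (p, q) -> (l <= p)%N -> (q <= r)%N ->
    Order.min (dtime p) (dtime q) = T%:E -> exists k : 'I_n.+2, val (f k) = (p, q).
  move=> okpq lp qr mT; have pq := wave_ok_lt okpq.
  have /andP[Tp Tq] : (T%:E <= dtime p)%E && (T%:E <= dtime q)%E by rewrite -le_min mT.
  have bpq : birth_time p q < T.
    by rewrite -lte_fin -birthE// -mT; case/andP: okpq.
  have [i lin ei] := allk p ltac:(lia) Tp; have [j jn ej] := allk q ltac:(lia) Tq.
  have ij : (i < j)%N.
    by rewrite ltnNge; apply/negP => ji; have := lts _ _ ji lin; rewrite -ei -ej; lia.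
  have ej' : j = i.+1.
    apply/eqP; rewrite eqn_leq ij andbT leqNgt; apply/negP => ij'.
    have sij : (p < s i.+1 < q)%N by rewrite ei ej !mono//; exact: leq_trans (ltnW ij') jn.
    have := wave_dead okpq sij; rewrite leNgt; apply/negP/negPn.
    by apply: lt_le_trans (Tle _ _); [rewrite lte_fin | exact: leq_trans (ltnW ij') jn].
  have iN : (i < n.+2)%N by rewrite -ej'.
  by exists (Ordinal iN); rewrite /= -ei -ej' -ej.
exists n, f; split; last by move=> p q lp qr okpq /=; exact: find.
split.
- split => //=; apply/negP => co.
  have [e1|[e2 ol]] : r = l.+1 \/ r = l.+2 /\ ~~ odd l /\ us l./2 == us l./2.+1.
    by move: co => /orP[/eqP ->|/and3P[/eqP -> ? ?]]; [left|right].
  + have [b0|[k lk _]] := birth_attained D l r; last by lia.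
    by move: T0; rewrite /T /birth_time b0 ltxx.
  + have [b0|[k lk bk]] := birth_attained D l r; first by move: T0; rewrite /T /birth_time b0 ltxx.
    have ek : k = l./2.*2.+1.
      by have := odd_double_half l; rewrite (negbTE (proj1 ol)); lia.
    move: T0; rewrite /T /birth_time bk ek dtime_novac ?ltxx//.
    by case: ol => _ /eqP ->.
- split.
  + case=> [[p q] okpq]; split.
      by case=> j <-; split; [exact: fdeath|rewrite fline /= posE'].
    rewrite /= posE' => -[dT lT]; have pq := wave_ok_lt okpq.
    have lfv : life (wave_of p q) T.
      split; last by rewrite /= dT.
      by rewrite -lee_fin /= -birthE// -dT; case/andP: okpq => _ /ltW.
    have {}lT : z p T = z l T by rewrite -lT; symmetry; exact: wave_z (ltW T0) okpq lfv.
    have [lp qr] := inside p q pq lT (fun k kk => wave_life_le okpq lfv kk).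
    have [k ek] := find p q okpq lp qr dT; exists k.
    exact: val_inj.
  + case=> [[p q] okpq] /= bT; rewrite posE' bT => pT.
    have lfv : life (wave_of p q) T by rewrite /T -bT; exact: wave_birth_life.
    have zp : z p T = z l T by rewrite -pT; symmetry; exact: wave_z (ltW T0) okpq lfv.
    have pq := wave_ok_lt okpq; have [dp dq] := wave_death_gt okpq.
    have [lp qr] := inside p q pq zp (fun k kk => wave_life_le okpq lfv kk).
    apply: val_inj => /=; rewrite bT in dp dq.
    have ep : p = l.
      apply/eqP; rewrite eqn_leq lp andbT leqNgt; apply/negP => pl.
      have := wave_dead ok (_ : l < p < r)%N; rewrite pl (leq_trans pq qr) => /(_ isT).
      by rewrite leNgt dp.
    have eq : q = r.
      apply/eqP; rewrite eqn_leq qr leqNgt; apply/negP => qr'.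
      have := wave_dead ok (_ : l < q < r)%N; rewrite qr' (leq_ltn_trans lp pq) => /(_ isT).
      by rewrite leNgt dq.
    by rewrite ep eq.
- move=> j k jk t [oj1 oj2] [ok1 ok2].
  have t0 : 0 < t := le_lt_trans (birth_time_ge0 D _ _) oj1.
  apply: (@line_lt_alive _ _ _ _ (s j.+1)) => //; [| | |exact: okf|exact: okf|].
  + by rewrite -dtimeP//; apply: lt_le_trans oj2 _; rewrite /= ge_min lexx orbT.
  + by split; exact: ltW.
  + by split; exact: ltW.
  + rewrite lts// ?(ltnW (ltn_ord k))// andbT; apply: mono => //; exact: ltn_ord.
- by rewrite /= s0 sn.
(* Strength and momentum of every wave are sums over its fronts, so conservation is concatenation of
   index ranges; exact profiles make strip masses equal to strengths. *)
- have sumE : wave_strength D l r T = \sum_(k < n.+2) wave_strength D (s k) (s k.+1) T.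
    have strE p q : wave_ok (p, q) -> life (wave_of p q) T -> wave_strength D p q T = \sum_(p <= e < q) xi e T.
      move=> okpq lf; have := wave_strengthE okpq lf T0; rewrite /= => ->.
      by rewrite (sum_xi (ltW T0) (wave_ok_lt okpq))//; exact: life_cluster.
    rewrite strE// -{1}s0 -{1}sn sum_chain; last by move=> i lin; apply: lts.
    by apply: eq_bigr => k _; rewrite strE//; exact: flife.
  split => //=.
  + have momE p q : wave_ok (p, q) -> life (wave_of p q) T ->
        wave_strength D p q T * wave_speed D p q T = \sum_(p <= e < q) us (uphalf e) * xi e T.
      move=> okpq lf; have := wave_momentum okpq lf T0; rewrite /= => ->.
      by rewrite (sum_xi_mom (ltW T0) (wave_ok_lt okpq))//; exact: life_cluster.
    rewrite momE// -{1}s0 -{1}sn sum_chain; last by move=> i lin; apply: lts.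
    by apply: eq_bigr => k _; rewrite momE//; exact: flife.
  + move=> d d0; have massE p q : wave_ok (p, q) -> life (wave_of p q) T ->
        strip_mass d (wave_of p q) T = wave_strength D p q T.
      move=> okpq lf; rewrite /strip_mass /=; case: ifP => nc; last first.
        by rewrite /wave_strength; move/negbT: nc; rewrite negbK => ->.
      rewrite /width /= mulrC divfK//.
      have b0 := birth_time_ge0 D p q; have bT : birth_time p q <= T := proj1 lf.
      rewrite /wave_x; case: ifP => [/eqP bz|bn].
        by rewrite mulr0 addr0 bz subr0 mulf_neq0// gt_eqF.
      have : 0 <= d * (T - birth_time p q) by rewrite mulr_ge0 ?subr_ge0// ltW.
      by move=> h; rewrite gt_eqF//; lra.
    by rewrite massE// sumE; apply: eq_bigr => k _; rewrite massE//; exact: flife.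
Qed.

End Tracking.

Section TrackingTheorem.
Variables (R : realType) (D : pcdata R).
Local Notation Y := (node D).
Local Notation rs := (pcrho D).
Local Notation us := (pcu D).
Local Notation M := (umax D).
Local Notation z := (front_pos D).
Local Notation alive_at := (alive_at D).
Local Notation path := (front_path D).
Local Notation dtime := (dtime D).
Local Notation wave_ok := (wave_ok D).
Local Notation wave_of := (wave_of D).
Local Notation birth := (birth D).
Local Notation birth_time := (birth_time D).
Local Notation contact := (contact D).
Local Notation P := (pc_pattern D).
Implicit Types (x y t s : R) (e k l r : nat).

Lemma half_cases l : l = l./2.*2 /\ odd l = false \/ l = l./2.*2.+1 /\ odd l.
Proof. by have := odd_double_half l; case: (odd l); [right|left]; split => //; lia. Qed.

Definition mkfront (p : nat * nat) (ok : wave_ok p) : front P := exist _ p ok.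

Lemma wave_okE l r : wave_ok (l, r) =
  (l < r)%N && (birth l r < Order.min (dtime l) (dtime r))%E.
Proof. by []. Qed.

Lemma birth_adjacent l : birth l l.+1 = 0%E.
Proof. by rewrite /birth subnn. Qed.

Lemma birth_gap1 l : birth l l.+2 = dtime l.+1.
Proof.
have [h|[k kl ->]] := birth_attained D l l.+2; last by congr dtime; lia.
apply/eqP; rewrite eq_le; apply/andP; split; first by rewrite h dtime_ge0.
by apply: (iffLR (birth_le D l l.+2 (birth_ge0 D l l.+2))); rewrite ?lexx//; lia.
Qed.

Lemma riemann_waves i S : riemann Y rs us i S -> exists w : front P, S (P w).
Proof.
have bz l r : birth l r = 0%E -> birth_time l r = 0 by rewrite /birth_time => ->.
case=> [[uu ->]|[[uu [->| ->]]|[uu ->]]].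
- have b0 : birth i.*2 i.*2.+2 = 0%E by rewrite birth_gap1 dtime_novac// uu.
  have ok : wave_ok (i.*2, i.*2.+2).
    by rewrite wave_okE b0 lt_min dtime_const -doubleS dtime_const andbT; lia.
  have co : contact i.*2 i.*2.+2.
    by rewrite /contact eqxx odd_double doubleK uu eqxx orbT.
  exists (mkfront ok); split => //=.
  + by rewrite co.
  + by rewrite /wave_line co bz// mulr0 addr0 doubleK.
  + exact: bz.
  + by rewrite /reg /= negbK odd_double /= doubleK.
  + move=> t; rewrite /wave_line /wave_speed /wave_strength co doubleK uphalf_double.
    by split.
- have b0 := birth_adjacent i.*2.
  have ok : wave_ok (i.*2, i.*2.+1).
    by rewrite wave_okE b0 lt_min dtime_const dtime_vac// ltnSn.
  have co : contact i.*2 i.*2.+1 by rewrite /contact eqxx.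
  exists (mkfront ok); split => //=.
  + by rewrite co.
  + by rewrite /wave_line co bz// mulr0 addr0 doubleK.
  + exact: bz.
  + by rewrite /reg /= odd_double /= doubleK uphalf_double.
  + move=> t; rewrite /wave_line /wave_speed /wave_strength co doubleK uphalf_double.
    by split.
- have b0 := birth_adjacent i.*2.+1.
  have ok : wave_ok (i.*2.+1, i.*2.+2).
    by rewrite wave_okE b0 lt_min dtime_vac// -doubleS dtime_const ltnSn.
  have co : contact i.*2.+1 i.*2.+2 by rewrite /contact eqxx.
  exists (mkfront ok); split => //=.
  + by rewrite co.
  + by rewrite /wave_line co bz// mulr0 addr0 /= uphalf_double.
  + exact: bz.
  + by rewrite /reg /= negbK odd_double /= uphalf_double doubleK.
  + move=> t; rewrite /wave_line /wave_speed /wave_strength co /= uphalf_double doubleK.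
    by split.
- have b0 : birth i.*2 i.*2.+2 = 0%E by rewrite birth_gap1 dtime_novac// ltW.
  have ok : wave_ok (i.*2, i.*2.+2).
    by rewrite wave_okE b0 lt_min dtime_const -doubleS dtime_const andbT; lia.
  have co : ~~ contact i.*2 i.*2.+2.
    rewrite /contact doubleK; apply/negP => /orP[/eqP|/and3P[_ _ /eqP]]; [lia|lra].
  have ol : ~~ odd i.*2 by rewrite odd_double.
  exists (mkfront ok); split => //.
  + have lf : life (wave_of i.*2 i.*2.+2) 0 by rewrite -(bz _ _ b0); exact: wave_birth_life.
    have -> : pos0 (P (mkfront ok)) = line (wave_of i.*2 i.*2.+2) 0 by rewrite /= bz.
    by rewrite wave_z// front_pos0 doubleK.
  + exact: bz.
  + by rewrite /= /reg /= negbK odd_double /= doubleK.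
  + move=> t lf; have t0 : 0 <= t := le_trans (birth_time_ge0 D _ _) (proj1 lf).
    have := simple_strength ok co erefl ol lf t0; have := simple_life ok erefl ol lf t0.
    rewrite -(wave_line_path ok lf) doubleK => h1 h2; split => //.
    by rewrite /= /wave_speed (negbTE co) eqxx odd_double doubleK.
Qed.

Lemma initial_waves (w : front P) : time0 (P w) = 0 ->
  exists i S, riemann Y rs us i S /\ S (P w).
Proof.
case: w => [[l r] ok] /= b0; have lr := wave_ok_lt ok.
have bb : birth l r = 0%E by rewrite birthE// b0.
have [dl dr] : (0 < dtime l)%E /\ (0 < dtime r)%E.
  by have := wave_death_gt ok; rewrite b0.
case co : (contact l r); last first.
  have nc : ~~ contact l r by rewrite co.
  have [er ol uu] := shadow_born0 ok nc b0.
  exists l./2, (simple_shadow Y rs us l./2); split; first by right; right.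
  have el : l = l./2.*2 by have [[]|[_ h]] := half_cases l; rewrite ?h// in ol *.
  split => //.
  + have lf : life (wave_of l r) 0 by rewrite -b0; exact: wave_birth_life.
    have := wave_z (lexx 0) ok lf; rewrite front_pos0 => <-.
    by rewrite /= b0.
  + by rewrite /= /reg er /= negbK (negbTE ol).
  + move=> t lf; have t0 : 0 <= t := le_trans (birth_time_ge0 D _ _) (proj1 lf).
    have := simple_strength ok nc er ol lf t0; have := simple_life ok er ol lf t0.
    rewrite -(wave_line_path ok lf) => h1 h2; split => //.
    by rewrite /= /wave_speed co er eqxx ol.
move: (co); rewrite /contact => /orP[/eqP er|/and3P[/eqP er ol /eqP eu]].
- have [[el ol]|[el ol]] := half_cases l.
  + have uu : us l./2 < us l./2.+1.
      by rewrite ltNge; apply/negP => /(dtime_novac (D := D)); rewrite -el -er => h; rewrite h ltxx in dr.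
    exists l./2, (contact_from (Y l./2) (us l./2) (Const l./2) (Vac l./2)).
    split; first by right; left; split => //; left.
    rewrite er in co *; split => //=.
    * by rewrite co.
    * by rewrite /wave_line co -er b0 mulr0 addr0.
    * by rewrite -er.
    * by rewrite /reg /= ol /= uphalf_half ol.
    * by move=> t; rewrite /wave_line /wave_speed /wave_strength co uphalf_half ol.
  + have uu : us l./2 < us l./2.+1.
      by rewrite ltNge; apply/negP => /(dtime_novac (D := D)); rewrite -el => h; rewrite h ltxx in dl.
    exists l./2, (contact_from (Y l./2) (us l./2.+1) (Vac l./2) (Const l./2.+1)).
    split; first by right; left; split => //; right.
    rewrite er in co *; split => //=.
    * by rewrite co.
    * by rewrite /wave_line co -er b0 mulr0 addr0.
    * by rewrite -er.
    * by rewrite /reg /= ol /= uphalf_half ol.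
    * by move=> t; rewrite /wave_line /wave_speed /wave_strength co uphalf_half ol.
- exists l./2, (contact_from (Y l./2) (us l./2) (Const l./2) (Const l./2.+1)).
  split; first by left.
  rewrite er in co *; split => //=.
  * by rewrite co.
  * by rewrite /wave_line co -er b0 mulr0 addr0.
  * by rewrite -er.
  * by rewrite /reg /= negbK (negbTE ol).
  * by move=> t; rewrite /wave_line /wave_speed /wave_strength co uphalf_half (negbTE ol).
Qed.

(** The outgoing wave is found from what is alive at the death time [T]; since [p] or [q] dies at
    [T], it is born exactly then. *)
Lemma terminal_waves (v : front P) : (death (P v) < +oo)%E ->
  exists n (f : 'I_n.+2 -> front P) (w : front P), interaction f w /\ exists i : 'I_n.+2, f i = v.
Proof.
case: v => [[p q] ok] /=; set T' := Order.min _ _ => Tfin.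
have pq := wave_ok_lt ok; have b0 := birth_time_ge0 D p q.
have bT : ((birth_time p q)%:E < T')%E by rewrite -birthE//; case/andP: ok.
have [T ET] : exists T, T' = T%:E.
  by case: T' bT Tfin => [T| |] //; exists T.
rewrite ET lte_fin in bT; have T0 : 0 < T by exact: le_lt_trans b0 bT.
(* Starting [nxt] from [q.-1] allows [q] itself, just as [prv] allows [p]: one of the two may
   survive. *)
have := prvP D p T; have := nxtP D q.-1 (ltW T0).
move: (prv D p T) (nxt D q.-1 T) => l r [r1 r2 r3] [l1 l2 l3].
have qr : (q <= r)%N by rewrite -(ltn_predK pq).
have lr : (l < r)%N by exact: leq_ltn_trans l1 (leq_trans pq qr).
have dead_in k : (p < k < q)%N -> (dtime k < T%:E)%E.
  move=> kk; apply: le_lt_trans (wave_dead ok kk) _; by rewrite lte_fin.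
have Tp : (T%:E <= dtime p)%E by rewrite -ET ge_min lexx.
have Tq : (T%:E <= dtime q)%E by rewrite -ET ge_min lexx orbT.
have dead k : (l < k < r)%N -> ~~ alive_at k T.
  move=> /andP[lk kr]; have [kp|pk] := leqP k p; first by apply: l3; rewrite lk.
  have [qk|kq] := leqP q k; first by apply: r3; rewrite kr andbT; lia.
  by rewrite -dtime_leP// ltW// dead_in// pk.
have [okw _] := adjacent_wave T0 lr l2 r2 dead.
have bw : birth_time l r = T.
  apply/eqP; rewrite eq_le; apply/andP; split.
    rewrite -lee_fin -birthE//; apply/(birth_le D l r); first by rewrite lee_fin ltW.
    by move=> k /dead; rewrite dtime_leP.
  have mid k : (l < k < r)%N -> dtime k = T%:E -> T <= birth_time l r.
    by move=> kk dk; have := wave_dead okw kk; rewrite dk lee_fin.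
  have : dtime p = T%:E \/ dtime q = T%:E.
    by move: ET; rewrite /T'; case: (leP (dtime p) (dtime q)) => _ ->; [left|right].
  case=> dT.
  - apply: (mid p) => //; apply/andP; split; last exact: leq_trans pq qr.
    rewrite ltn_neqAle l1 andbT; apply/eqP => e.
    by move: l2; rewrite e -dtimeP// dT ltxx.
  - apply: (mid q) => //; apply/andP; split; first exact: leq_ltn_trans l1 pq.
    rewrite ltn_neqAle qr andbT; apply/eqP => e.
    by move: r2; rewrite -e -dtimeP// dT ltxx.
pose w := mkfront okw.
have T0' : 0 < time0 (P w) by rewrite /= bw.
have [n [f [H1 H2]]] := wave_interaction T0'.
exists n, f, w; split => //.
have [k ek] := H2 p q l1 qr ok ltac:(by rewrite /= bw).
by exists k; apply: val_inj.
Qed.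

(** Both regions of [v] have positive width at [t], which separates its fronts from all others; a
    wave through the same point belongs to the same maximal group. *)
Lemma waves_noncrossing (v w : front P) t : open_life (P v) t -> life (P w) t ->
  line (P v) t = line (P w) t -> v = w.
Proof.
case: v w => [[p q] ok] [[l r] okw] ov lw lvw.
have t0 := open_life_gt0 ov; have lv := open_life_life ov.
have zz : z p t = z l t.
  by rewrite -(wave_z (ltW t0) ok lv) -(wave_z (ltW t0) okw lw).
have pq := wave_ok_lt ok; have lr := wave_ok_lt okw.
have [b2 d2] := ov; rewrite /= lt_min in d2; have {d2}/andP[dp dq] := d2.
have [_ dw] := lw; rewrite /= le_min in dw; have {dw}/andP[dl dr] := dw.
have ap : alive_at p t by rewrite -dtimeP.
have aq : alive_at q t by rewrite -dtimeP.
have vdead k : (p < k < q)%N -> (dtime k < t%:E)%E.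
  by move=> kk; apply: le_lt_trans (wave_dead ok kk) _; rewrite lte_fin.
have wdead k : (l < k < r)%N -> (dtime k <= t%:E)%E.
  by move=> kk; exact: (wave_life_le okw lw kk).
have pl : (p <= l)%N.
  rewrite leqNgt; apply/negP => h; have := alive_lt (ltW t0) ap (_ : l < p <= p)%N.
  by rewrite h leqnn zz ltxx => /(_ isT).
have lq : (l < q)%N.
  rewrite ltnNge; apply/negP => h; have := alive_lt (ltW t0) aq (_ : p < q <= l)%N.
  by rewrite pq h zz ltxx => /(_ isT).
have el : l = p.
  apply/eqP; rewrite eqn_leq pl andbT leqNgt; apply/negP => h.
  by have := vdead l; rewrite h lq ltNge dl => /(_ isT).
have er : r = q.
  apply/eqP; rewrite eqn_leq; apply/andP; split; rewrite leqNgt; apply/negP => h.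
    by have := wdead q; rewrite lq h leNgt dq => /(_ isT).
  by have := vdead r; rewrite -el lr h ltNge dr => /(_ isT).
by apply: val_inj; rewrite /= el er.
Qed.

Lemma lines_finite t (A : R) : 0 < t -> finite_set [set x : R | `|x| <= A /\
  exists w : front P, alive (P w) t /\ line (P w) t = x].
Proof.
move=> t0; have [n An] := node_unbounded D (A + t * M).
apply: (@sub_finite_set _ _ [set z e t | e in `I_n.*2]); last first.
  by apply: finite_image; exact: finite_II.
move=> x [xA [[[l r] ok] [al lx]]]; exists l.
  rewrite /= ltnNge; apply/negP => nl.
  have /andP[h _] := front_pos_bnd D l (ltW t0).
  have : Y n <= Y l./2 by apply: node_le; lia.
  have : z l t <= A.
    by rewrite -(wave_z (ltW t0) ok (alive_life al)); apply: le_trans xA; rewrite -lx ler_norm.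
  by lra.
by rewrite -lx; symmetry; exact: wave_z (ltW t0) ok (alive_life al).
Qed.

Definition inside k x t : Prop := (k = 0%N \/ z k.-1 t < x) /\ x < z k t.

Lemma inside_alive k x t : inside k x t -> alive_at k t.
Proof. by move=> [[-> //|h1] h2]; rewrite /alive_at (lt_trans h1 h2) orbT. Qed.

Lemma inside_unique j k x t : 0 <= t -> inside j x t -> inside k x t -> j = k.
Proof.
move=> t0; wlog jk : j k / (j <= k)%N.
  by move=> W hj hk; case: (leqP j k) => [/W->//|/ltnW/W->].
move=> [_ xj] [[k0|xk] _]; first by lia.
move: jk; rewrite leq_eqVlt => /orP[/eqP //|jk].
exfalso; have : z j t <= z k.-1 t by apply: front_pos_mono => //; lia.
by lra.
Qed.

Lemma inside_exists x t : 0 < t -> (forall e, z e t != x) -> exists k, inside k x t.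
Proof.
move=> t0 off; have [n xn] := node_unbounded D (x + t * M).
have ex : exists k, x < z k t.
  exists n.*2; have /andP[h _] := front_pos_bnd D n.*2 (ltW t0).
  by rewrite doubleK in h; lra.
case: (ex_minnP ex) => k xk kmin; exists k; split => //.
case: k xk kmin => [|k] xk kmin; [by left|right => /=].
by rewrite lt_neqAle off leNgt; apply/negP => /kmin; rewrite ltnn.
Qed.

Lemma off_lines_fronts x t : 0 < t -> off_lines P x t -> forall e, z e t != x.
Proof.
move=> t0 off e; apply/eqP => ze; have [ok al] := front_wave D e t0.
apply: (off (mkfront ok) al).
transitivity (z (prv D e t) t); first exact: wave_z (ltW t0) ok (alive_life al).
by rewrite front_prv ?(ltW t0).
Qed.

Lemma wave_alive_regions l r t : wave_ok (l, r) -> 0 < t -> alive (wave_of l r) t ->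
  [/\ alive_at l t, alive_at r t & z r.-1 t = z l t].
Proof.
move=> ok t0 al; have [b d] := al; rewrite /= lt_min !dtimeP// in d; case/andP: d => a1 a2.
split => //; have lr := wave_ok_lt ok.
have [<- _ _ _ _] := life_cluster ok (alive_life al) t0; by [].
Qed.

Lemma inside_in_region k x t : 0 < t -> inside k x t -> in_region P x t (reg k).
Proof.
move=> t0 ins; have ak := inside_alive ins; have [zx xz] := ins.
have [n1 n2 n3] := nxtP D k (ltW t0).
have [ok al] := adjacent_wave t0 n1 ak n2 n3.
right; exists (mkfront ok); split => //.
  by apply: (lt_le_trans xz); rewrite le_eqVlt; apply/orP; left; apply/eqP; symmetry;
    exact: wave_z (ltW t0) ok (alive_life al).
case=> [[p q] okv] av.
have -> : line (P (mkfront okv)) t = z p t := wave_z (ltW t0) okv (alive_life av).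
have -> : line (P (mkfront ok)) t = z k t := wave_z (ltW t0) ok (alive_life al).
have [kp|pk] := leqP k p; first by right; apply: front_pos_mono => //; exact: ltW.
left; case: zx => [k0|zx]; first by lia.
apply: le_trans (ltW zx); apply: front_pos_mono; [exact: ltW|lia].
Qed.

Lemma in_region_inside x t (r : region) : 0 < t -> off_lines P x t -> in_region P x t r ->
  exists2 k, r = reg k & inside k x t.
Proof.
move=> t0 off; have offz := off_lines_fronts t0 off; have t0' := ltW t0.
case=> -[[[p q] ok] [al]].
- have -> : line (P (mkfront ok)) t = z p t := wave_z t0' ok (alive_life al).
  move=> zx <- H; have [a1 a2 e] := wave_alive_regions ok t0 al.
  exists q => //; split; first by right; rewrite e.
  have [okv av] := front_wave D q t0.
  have := H (mkfront okv) av.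
  have -> : line (P (mkfront okv)) t = z q t.
    by rewrite -(front_prv D q t0'); exact: wave_z t0' okv (alive_life av).
  rewrite (lt_neqAle x) eq_sym offz /=; case=> // zqp.
  have lr := wave_ok_lt ok.
  have : z p t < z q t by apply: alive_lt t0' a2 _; rewrite lr leqnn.
  by lra.
- have -> : line (P (mkfront ok)) t = z p t := wave_z t0' ok (alive_life al).
  move=> zx <- H; have [a1 a2 e] := wave_alive_regions ok t0 al.
  exists p => //; split => //.
  case: p ok al zx H a1 e => [|p] ok al zx H a1 e; [by left|right => /=].
  have [okv av] := front_wave D p t0.
  have := H (mkfront okv) av.
  have -> : line (P (mkfront okv)) t = z p t.
    by rewrite -(front_prv D p t0'); exact: wave_z t0' okv (alive_life av).
  rewrite (lt_neqAle _ x) offz /=; case=> // zqp.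
  by have := a1; rewrite alive_atS; lra.
Qed.

Theorem pc_tracking : tracking Y rs us P.
Proof.
split.
- split.
  + case=> [[l r] ok]; split.
    * exact: birth_time_ge0.
    * by rewrite /= -birthE//; case/andP: ok.
    * exact: wave_shadow_wave ok.
  + move=> i uu; split.
    * apply: continuous_in_subspaceT => /= -[x t] /set_mem /= [t0 _].
      apply: cvgM; first by apply: cvgB; [exact: cvg_fst|exact: cvg_cst].
      by apply: cvgV; [rewrite gt_eqF|exact: cvg_snd].
    * by move=> t t0; split; rewrite /= addrAC subrr add0r mulfK// gt_eqF.
- by split; [exact: riemann_waves|exact: initial_waves].
- split; last exact: terminal_waves.
  by move=> w w0; have [n [f [H _]]] := wave_interaction w0; exists n, f.
- exact: waves_noncrossing.
- split; first exact: lines_finite.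
  move=> x t t0 off; have [k ins] := inside_exists t0 (off_lines_fronts t0 off).
  exists (reg k); split; first exact: inside_in_region.
  move=> r /(in_region_inside t0 off)[j -> insj].
  by rewrite (inside_unique (ltW t0) ins insj).
Qed.

Theorem pc_admissible : admissible us P.
Proof. by case=> [[l r] ok] t al; exact: wave_admissible ok t al. Qed.

End TrackingTheorem.

Lemma measurable_fun_invr (R : realType) : measurable_fun setT (fun x : R => x^-1).
Proof.
have m0 : measurable [set (0 : R)] by exact: measurable_set1.
have -> : [set: R] = [set 0] `|` ~` [set 0] by rewrite setUv.
apply/measurable_funU => //; first exact: measurableC.
split.
- apply: (eq_measurable_fun (fun=> 0 : R)); last exact: measurable_cst.
  by move=> x; rewrite inE /= => ->; rewrite invr0.
- apply: open_continuous_measurable_fun; first exact/closed_openC/closed_eq.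
  by move=> x; rewrite inE /= => /eqP x0; exact: inv_continuous.
Qed.

(** * Representation by functions *)

Section Pick.
Variable p : nat -> Prop.

(** The least index is taken so that the set on which a given index is picked is measurable. *)
Definition pick_first : option nat :=
  if pselect (exists n, `[< p n >]) is left ex then Some (ex_minn ex) else None.

Lemma pick_firstP : match pick_first with
  | Some n => p n /\ forall m, p m -> (n <= m)%N
  | None => forall n, ~ p n
  end.
Proof.
rewrite /pick_first; case: pselect => [ex|nex].
- case: ex_minnP => n /asboolP pn H; split => // m pm; apply: H; exact/asboolP.
- by move=> n pn; apply: nex; exists n; exact/asboolP.
Qed.

Lemma pick_first_eq n : p n -> (forall m, p m -> (n <= m)%N) -> pick_first = Some n.
Proof.
have := pick_firstP; case: pick_first => [m [pm Hm] pn Hn|H /H//].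
by congr Some; apply/eqP; rewrite eqn_leq Hm// Hn.
Qed.

Lemma pick_first_None : (forall n, ~ p n) -> pick_first = None.
Proof. by have := pick_firstP; case: pick_first => [m [pm _] /(_ m)|]. Qed.

End Pick.

Section Representation.
Variables (R : realType) (D : pcdata R) (eps : R).
Hypothesis eps0 : 0 < eps.
Local Notation Y := (node D).
Local Notation rs := (pcrho D).
Local Notation us := (pcu D).
Local Notation M := (umax D).
Local Notation z := (front_pos D).
Local Notation alive_at := (alive_at D).
Local Notation path := (front_path D).
Local Notation wave_ok := (wave_ok D).
Local Notation wave_of := (wave_of D).
Local Notation birth_time := (birth_time D).
Local Notation contact := (contact D).
Local Notation inside := (inside D).
Local Notation P := (pc_pattern D).
Implicit Types (x y t s : R) (e k l r n : nat).

(** Waves are enumerated by natural numbers; the default pair [(0, 0)] is harmless because it is not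
    [wave_ok]. *)
Definition wave_index n : nat * nat := odflt (0%N, 0%N) (unpickle n).
Local Notation W n := (wave_of (wave_index n).1 (wave_index n).2).

Definition in_strip n x t : Prop := wave_ok (wave_index n) /\ strip eps (W n) t x.

(** A common scheme for density and velocity, so that both show the same wave where strips overlap.
    Times [t <= 0] carry the initial states. *)
Definition piecewise (a b c : nat -> R -> R -> R) x t : R :=
  if 0 < t then
    match pick_first (fun n => in_strip n x t) with
    | Some n => a n x t
    | None => if pick_first (fun k => inside k x t) is Some k then b k x t else 0
    end
  else if pick_first (fun i => x <= Y i) is Some i then c i x t else 0.

Definition rho_eps := piecewise (fun n _ t => prof_rho (W n) eps t)
  (fun k _ _ => edens D k) (fun i _ _ => rs i).

Definition region_velocity k x t : R :=
  if odd k then (x - Y k./2) / t else us k./2.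

Definition u_eps := piecewise (fun n _ t => prof_u (W n) eps t)
  region_velocity (fun i _ _ => us i).

Lemma wave_index_front (w : front P) : exists n, wave_index n = val w.
Proof. by exists (pickle (val w)); rewrite /wave_index pickleK. Qed.

Lemma piecewise_strip x t n : 0 < t -> in_strip n x t ->
  exists n', in_strip n' x t /\ forall a b c, piecewise a b c x t = a n' x t.
Proof.
move=> t0 ins; have := pick_firstP (fun n => in_strip n x t).
case E : pick_first => [n'|]; last by move=> /(_ n).
by move=> [h _]; exists n'; split => // *; rewrite /piecewise t0 E.
Qed.

Lemma piecewise_region x t k : 0 < t -> (forall n, ~ in_strip n x t) -> inside k x t ->
  forall a b c, piecewise a b c x t = b k x t.
Proof.
move=> t0 ns ins a b c; rewrite /piecewise t0 (pick_first_None ns).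
rewrite (pick_first_eq ins)// => m insm.
by rewrite (inside_unique (ltW t0) ins insm).
Qed.

Lemma piecewise_initial x t i : t <= 0 -> (i = 0%N \/ Y i.-1 < x) -> x <= Y i ->
  forall a b c, piecewise a b c x t = c i x t.
Proof.
move=> t0 Yx xY a b c; rewrite /piecewise ltNge t0 /=.
rewrite (@pick_first_eq (fun i => x <= Y i) i)// => m xm.
case: Yx => [->//|Yx]; rewrite leqNgt; apply/negP => mi.
have /(node_le D) : (m <= i.-1)%N by lia.
by lra.
Qed.

Lemma pc_represents : represents Y rs us eps P rho_eps u_eps.
Proof.
split.
- by move=> x xY; split; apply: (@piecewise_initial _ _ 0%N) => //; left.
- move=> i x /andP[Yx xY]; split; apply: (@piecewise_initial _ _ i.+1) => //; by right.
- move=> x t t0 [w sw]; have [n en] := wave_index_front w.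
  have ins : in_strip n x t.
    by split; [rewrite en; exact: valP w | rewrite en].
  have [n' [[ok' s'] H]] := piecewise_strip t0 ins.
  by exists (mkfront ok'); split => //; exact: H.
- move=> x t r t0 ns off ir.
  have [k -> insk] := in_region_inside t0 off ir.
  have ns' n : ~ in_strip n x t by move=> [ok s]; exact: (ns (mkfront ok) s).
  split; rewrite ?/rho_eps ?/u_eps (piecewise_region t0 ns' insk).
    by rewrite /edens /reg; case: (odd k).
  by rewrite /region_velocity /reg; case: (odd k).
Qed.

Lemma rho_eps_ge0 x t : 0 <= rho_eps x t.
Proof.
have [t0|t0] := ltP 0 t; rewrite /rho_eps /piecewise; last first.
  rewrite ltNge t0 /=; case: pick_first => // i; exact/ltW/pcrho_gt0.
rewrite t0; have := pick_firstP (fun n => in_strip n x t).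
case: pick_first => [n [[ok st] _]|_]; last first.
  case: pick_first => // k; rewrite /edens; case: ifP => // _; exact/ltW/pcrho_gt0.
case: st => _ al _; move: ok al; rewrite [wave_index n]surjective_pairing => ok al.
rewrite /= mulr_ge0//; first exact: (wave_strength_ge0 ok (alive_life al)).
rewrite invr_ge0 addr_ge0//.
  by rewrite mulr_ge0 ?(ltW eps0)// subr_ge0; case: al.
by rewrite mulr_ge0// /wave_x; case: ifP => // _; exact: ltW.
Qed.

Lemma shadow_speed_bnd l r t : wave_ok (l, r) -> ~~ contact l r ->
  life (wave_of l r) t -> 0 < t -> `|wave_speed D l r t| <= M.
Proof.
move=> ok nc lf t0; have := shadow_speedE ok nc lf t0; rewrite /= => ->.
have S0 := shadow_wmass_gt0 ok nc lf t0.
rewrite normrM normfV (gtr0_norm S0) ler_pdivrMr//.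
apply: wmom_le; [exact: ltW|exact: wave_ok_lt ok|exact: life_cluster].
Qed.

Lemma inside_velocity_bnd k x t : 0 < t -> inside k x t -> `|region_velocity k x t| <= M.
Proof.
move=> t0 ins; rewrite /region_velocity; case ok : (odd k); last exact: pcu_le.
have ak := inside_alive ins; have [zx xz] := ins.
have am : argmin D x t (edge D k x t).
  by apply: edge_interior_sub.
rewrite /edge ok in am; have /andP[h1 h2] := argmin_node am.
have /andP[a1 _] := pcu_bnd D k./2; have /andP[_ b1] := pcu_bnd D k./2.+1.
rewrite ler_norml ler_pdivlMr// ler_pdivrMr//.
have : t * - M <= t * us k./2 by rewrite ler_pM2l.
have : t * us k./2.+1 <= t * M by rewrite ler_pM2l.
by move=> *; apply/andP; split; lra.
Qed.

Lemma u_eps_bnd x t : `|u_eps x t| <= M.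
Proof.
have M0 := umax_ge0 D.
have [t0|t0] := ltP 0 t; rewrite /u_eps /piecewise; last first.
  rewrite ltNge t0 /=; case: pick_first => [i|]; [exact: pcu_le|by rewrite normr0].
rewrite t0; have := pick_firstP (fun n => in_strip n x t).
case: pick_first => [n [[ok st] _]|_]; last first.
  have := pick_firstP (fun k => inside k x t).
  by case: pick_first => [k [ins _]|_]; [exact: inside_velocity_bnd|rewrite normr0].
case: st => nc al _; move: ok al nc; rewrite [wave_index n]surjective_pairing => ok al nc.
by apply: (shadow_speed_bnd ok nc _ t0); exact: alive_life.
Qed.

(** A bound for fixed [eps], as integrability requires: masses grow at most linearly in time, while
    widths are at least [t * eps / (1 + tau)]. *)
Lemma rho_eps_bnd (tau : R) : 0 <= tau -> exists K : R, forall x t, t <= tau -> rho_eps x t <= K.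
Proof.
move=> tau0; pose B := rhomax D; have M0 := umax_ge0 D.
have B0 : 0 < B by apply: lt_le_trans (pcrho_gt0 D 0) (pcrho_le D 0).
have K2 : 0 <= B * (2 * M) * (1 + tau) / eps.
  by rewrite divr_ge0// ?(ltW eps0)// mulr_ge0 ?addr_ge0// !mulr_ge0// ltW.
exists (B + B * (2 * M) * (1 + tau) / eps) => x t ttau.
have regb k : edens D k <= B.
  by rewrite /edens; case: ifP => _; [exact: ltW|exact: pcrho_le].
have [t0|t0] := ltP 0 t; rewrite /rho_eps /piecewise; last first.
  rewrite ltNge t0 /=; case: pick_first => [i|]; last by rewrite addr_ge0// ltW.
  by apply: le_trans (pcrho_le D i) _; rewrite lerDl.
rewrite t0; have := pick_firstP (fun n => in_strip n x t).
case: pick_first => [n [[ok st] _]|_]; last first.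
  case: pick_first => [k|]; last by rewrite addr_ge0// ltW.
  by apply: le_trans (regb k) _; rewrite lerDl.
case: st => nc al _; move: ok al nc; rewrite [wave_index n]surjective_pairing.
move: (wave_index n).1 (wave_index n).2 => l r ok al nc; have lf := alive_life al.
have cl := life_cluster ok lf t0.
rewrite /=; set w := (X in _ / X).
have b0 := birth_time_ge0 D l r; have bt : birth_time l r <= t := proj1 lf.
have sE : wave_strength D l r t = wmass D l r t := wave_strengthE ok lf t0.
have sle : wave_strength D l r t <= B * (2 * M) * t.
  rewrite sE; have := wmass_le (ltW t0) (wave_ok_lt ok) cl; rewrite -/B; lra.
have [tw tw0] : t * eps <= w * (1 + tau) /\ 0 < w.
  rewrite /w /wave_x; case: ifP => [/eqP bz|bn].
    rewrite mulr0 addr0 bz subr0; split; last exact: mulr_gt0.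
    have : 0 <= eps * t * tau by rewrite !mulr_ge0// ltW.
    by lra.
  have h : 0 <= eps * (t - birth_time l r) by rewrite mulr_ge0 ?subr_ge0// ltW.
  split; last by apply: ltr_wpDl => //; apply: mulr_gt0.
  have h2 : t * eps <= tau * eps by rewrite ler_pM2r.
  have : 0 <= eps * (t - birth_time l r) * (1 + tau) by rewrite mulr_ge0// addr_ge0.
  have e0 : 0 < eps := eps0.
  have : 0 <= tau * eps by rewrite mulr_ge0// ltW.
  by lra.
rewrite ler_pdivrMr//; apply: le_trans sle _.
have BM : 0 <= B * (2 * M) by rewrite !mulr_ge0// ltW.
have : B * (2 * M) * t <= B * (2 * M) * (1 + tau) / eps * w.
  have -> : B * (2 * M) * (1 + tau) / eps * w = B * (2 * M) * (w * (1 + tau) / eps) by ring.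
  by rewrite ler_wpM2l// ler_pdivlMr.
have : 0 <= B * w by rewrite mulr_ge0// ltW.
by lra.
Qed.

Lemma measurable_timed (f : R -> R) : measurable_fun setT f ->
  measurable_fun setT (fun p : R * R => f p.2).
Proof. by move=> mf; apply: measurableT_comp => //; exact: measurable_snd. Qed.

Lemma measurable_front_path e : measurable_fun setT (fun p : R * R => path e p.2).
Proof. by apply: measurable_timed; apply: continuous_measurable_fun; exact: front_path_continuous. Qed.

Lemma measurable_lt_set (f g : R * R -> R) : measurable_fun setT f -> measurable_fun setT g ->
  measurable [set p | f p < g p].
Proof.
move=> mf mg; have := measurable_fun_ltr mf mg => /(_ measurableT [set true]).
by rewrite setTI; apply.
Qed.

Lemma measurable_positive_time : measurable [set p : R * R | 0 < p.2].
Proof. by apply: measurable_lt_set; [exact: measurable_cst|exact: measurable_snd]. Qed.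

Lemma measurable_inside k : measurable [set p : R * R | 0 < p.2 /\ inside k p.1 p.2].
Proof.
have -> : [set p : R * R | 0 < p.2 /\ inside k p.1 p.2] =
    [set p | 0 < p.2] `&` ([set p | p.1 < path k p.2] `&`
      (if k == 0%N then setT else [set p | path k.-1 p.2 < p.1])).
  apply/seteqP; split => [[x t] /= [t0 [zx xz]]|[x t] /= [t0 [xz zx]]].
  - split => //; rewrite !front_pathE ?(ltW t0)//; split => //.
    case: eqVneq => // k0 /=; rewrite front_pathE ?(ltW t0)//.
    by case: zx => // k00; rewrite k00 in k0.
  - rewrite front_pathE ?(ltW t0)// in xz; split => //; split => //.
    by move: zx; case: eqVneq => [->|k0] /=; [left|right; move: zx; rewrite front_pathE ?(ltW t0)].
apply: measurableI; first exact: measurable_positive_time.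
apply: measurableI.
  by apply: measurable_lt_set; [exact: measurable_fst|exact: measurable_front_path].
case: ifP => _ //.
by apply: measurable_lt_set; [exact: measurable_front_path|exact: measurable_fst].
Qed.

Lemma measurable_wave_line l r : measurable_fun setT (fun p : R * R => wave_line D l r p.2).
Proof.
apply: (@measurable_timed (fun t => wave_line D l r t)); rewrite /wave_line.
case: (contact l r); apply: continuous_measurable_fun; last exact: front_path_continuous.
move=> t; apply: cvgD; first exact: cvg_cst.
by apply: cvgM; [exact: cvg_cst|exact: cvg_id].
Qed.

Lemma measurable_in_strip n : measurable [set p : R * R | 0 < p.2 /\ in_strip n p.1 p.2].
Proof.
have [ok|nok] := boolP (wave_ok (wave_index n)); last first.
  rewrite (_ : [set _ | _] = set0)//; apply/seteqP; split => // p [_ [ok _]].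
  by rewrite ok in nok.
have [sh|nsh] := boolP (is_shadow (W n)); last first.
  rewrite (_ : [set _ | _] = set0)//; apply/seteqP; split => // p [_ [_ [sh _ _]]].
  by rewrite sh in nsh.
have -> : [set p : R * R | 0 < p.2 /\ in_strip n p.1 p.2] =
    [set p | 0 < p.2] `&` ((~` [set p | p.2 < time0 (W n)] `&`
      [set p : R * R | (p.2%:E < death (W n))%E]) `&`
      [set p | `|p.1 - line (W n) p.2| < eps / 2 * (p.2 - time0 (W n)) + prof_x (W n) eps]).
  apply/seteqP; split => [p [t0 [_ [_ [h1 h2] h3]]]|p [t0 [[h1 h2] h3]]].
    by split => //; split => //; split => //=; apply/negP; rewrite -leNgt.
  split => //; split => //; split => //; split => //.
  by move/negP: h1; rewrite -leNgt.
apply: measurableI; first exact: measurable_positive_time.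
apply: measurableI.
  apply: measurableI.
    apply: measurableC; apply: measurable_lt_set; [exact: measurable_snd|exact: measurable_cst].
  case: (death (W n)) => [c| |].
  - by apply: measurable_lt_set; [exact: measurable_snd|exact: measurable_cst].
  - by rewrite (_ : [set _ | _] = setT)//; apply/seteqP; split => // p _ /=; rewrite ltry.
  - by rewrite (_ : [set _ | _] = set0)//; apply/seteqP; split.
apply: measurable_lt_set.
  apply: measurableT_comp; first exact: normr_measurable.
  by apply: measurable_funB; [exact: measurable_fst|exact: measurable_wave_line].
apply: measurable_funD; last exact: measurable_cst.
apply: measurable_funM; first exact: measurable_cst.
by apply: measurable_funB; [exact: measurable_snd|exact: measurable_cst].
Qed.

Lemma measurable_piecewise (a b c : nat -> R -> R -> R) :
  (forall n, measurable_fun setT (fun p : R * R => a n p.1 p.2)) ->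
  (forall n, measurable_fun setT (fun p : R * R => b n p.1 p.2)) ->
  (forall n, measurable_fun setT (fun p : R * R => c n p.1 p.2)) ->
  measurable_fun setT (fun p : R * R => piecewise a b c p.1 p.2).
Proof.
move=> ma mb mc.
pose pos := [set p : R * R | 0 < p.2].
pose st n := [set p : R * R | 0 < p.2 /\ in_strip n p.1 p.2].
pose E n := st n `\` \bigcup_(m in [set m | (m < n)%N]) st m.
pose rg k := [set p : R * R | 0 < p.2 /\ inside k p.1 p.2].
pose F k := rg k `\` \bigcup_m st m.
pose G i := ~` pos `&` (~` [set p : R * R | Y i < p.1] `&`
   (if i == 0%N then setT else [set p : R * R | Y i.-1 < p.1])).
have mpos : measurable pos by exact: measurable_positive_time.
have mst n : measurable (st n) by exact: measurable_in_strip.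
have mE n : measurable (E n).
  apply: measurableD => //; apply: bigcup_measurable => m _; exact: mst.
have mF k : measurable (F k).
  apply: measurableD; first exact: measurable_inside.
  by apply: bigcup_measurable => m _; exact: mst.
have mG i : measurable (G i).
  apply: measurableI; first exact: measurableC.
  apply: measurableI.
    by apply: measurableC; apply: measurable_lt_set; [exact: measurable_cst|exact: measurable_fst].
  case: ifP => // _.
  by apply: measurable_lt_set; [exact: measurable_cst|exact: measurable_fst].
have mUE : measurable (\bigcup_n E n) by apply: bigcup_measurable.
have mUF : measurable (\bigcup_n F n) by apply: bigcup_measurable.
have mUG : measurable (\bigcup_n G n) by apply: bigcup_measurable.
(* Outside [U] are the points on fronts that no strip covers; there the default value 0 is taken. *)
pose U := \bigcup_n E n `|` (\bigcup_n F n `|` \bigcup_n G n).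
have mU : measurable U by apply: measurableU => //; exact: measurableU.
have nost x t k : F k (x, t) -> forall n, ~ in_strip n x t.
  by move=> [[t0 _] nU] n ins; apply: nU; exists n.
rewrite -(setUv U); apply/measurable_funU => //; first exact: measurableC.
split; [apply/measurable_funU => //; first exact: measurableU; split|].
- apply/measurable_fun_bigcup => // n.
  apply: (eq_measurable_fun (fun p : R * R => a n p.1 p.2)); last exact: measurable_funS (ma n).
  move=> [x t]; rewrite inE => -[[t0 ins] nE]; rewrite /piecewise /= t0.
  rewrite (pick_first_eq ins)// => m insm; rewrite leqNgt; apply/negP => mn.
  by apply: nE; exists m.
- apply/measurable_funU => //; split; apply/measurable_fun_bigcup => // k.
  + apply: (eq_measurable_fun (fun p : R * R => b k p.1 p.2)); last exact: measurable_funS (mb k).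
    move=> [x t]; rewrite inE => Fk; have [[t0 ins] _] := Fk.
    by rewrite /= (piecewise_region t0 (nost _ _ _ Fk) ins).
  + apply: (eq_measurable_fun (fun p : R * R => c k p.1 p.2)); last exact: measurable_funS (mc k).
    move=> [x t]; rewrite inE => -[/negP nt [/negP xY Yx]]; rewrite /= (@piecewise_initial _ _ k)//.
    * by rewrite leNgt.
    * by move: Yx; case: eqVneq => [->|_] /=; [left|right].
    * by rewrite leNgt.
- apply: (eq_measurable_fun (fun _ : R * R => 0 : R)); last exact: measurable_cst.
  move=> [x t]; rewrite inE => nU; rewrite /piecewise /=; case: ifPn => t0.
    have := pick_firstP (fun n => in_strip n x t).
    case: pick_first => [n [ins Hn]|ns].
      exfalso; apply: nU; left; exists n => //; split => // -[m mn [_ insm]].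
      by have := Hn m insm; rewrite leqNgt => /negP; apply.
    have := pick_firstP (fun k => inside k x t); case: pick_first => // k [ins _].
    exfalso; apply: nU; right; left; exists k => //; split => // -[m _ [_ insm]].
    exact: ns insm.
  have := pick_firstP (fun i => x <= Y i); case: pick_first => // i [xY Hi].
  exfalso; apply: nU; right; right; exists i => //; split; first exact/negP.
  split; first by apply/negP; rewrite -leNgt.
  case: eqVneq => // i0 /=; rewrite ltNge; apply/negP => /Hi.
  by case: i i0 {xY Hi} => // i _; rewrite ltnn.
Qed.

Lemma measurable_wave_strength l r : measurable_fun setT (wave_strength D l r).
Proof.
rewrite /wave_strength; case: (contact l r); first exact: measurable_cst.
apply: continuous_measurable_fun; apply: continuous_sum => e; exact: xi_continuous.
Qed.

Lemma measurable_wave_speed l r : measurable_fun setT (wave_speed D l r).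
Proof.
rewrite /wave_speed; case: (contact l r); first exact: measurable_cst.
case: (_ && _); first exact: measurable_cst.
apply: measurable_funM; first by apply: continuous_measurable_fun; exact: wmom_continuous.
apply: measurableT_comp; first exact: measurable_fun_invr.
by apply: continuous_measurable_fun; exact: wmass_continuous.
Qed.

Lemma measurable_rho_eps : measurable_fun setT (fun p : R * R => rho_eps p.1 p.2).
Proof.
apply: measurable_piecewise => n; [|exact: measurable_cst|exact: measurable_cst].
apply: (@measurable_timed (fun t => prof_rho (W n) eps t)).
apply: measurable_funM; first exact: measurable_wave_strength.
apply: measurableT_comp; first exact: measurable_fun_invr.
apply: measurable_funD; last exact: measurable_cst.
apply: measurable_funM; first exact: measurable_cst.
by apply: measurable_funB; [exact: measurable_id|exact: measurable_cst].
Qed.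

Lemma measurable_u_eps : measurable_fun setT (fun p : R * R => u_eps p.1 p.2).
Proof.
apply: measurable_piecewise => n; last exact: measurable_cst.
  apply: (@measurable_timed (fun t => prof_u (W n) eps t)).
  exact: measurable_wave_speed.
rewrite /region_velocity; case: (odd n); last exact: measurable_cst.
apply: measurable_funM.
  by apply: measurable_funB; [exact: measurable_fst|exact: measurable_cst].
apply: measurableT_comp; first exact: measurable_fun_invr.
exact: measurable_snd.
Qed.

End Representation.

(** * Calculus *)

Section OneVariable.
Variable R : realType.
Local Notation mu := (@lebesgue_measure R).
Implicit Types (a b t x y : R).

Lemma is_derive_continuous (f : R -> R) t d : is_derive t (1 : R) f d -> {for t, continuous f}.
Proof. by move=> [df _]; apply: differentiable_continuous; apply/derivable1_diffP. Qed.

Lemma mean_value (f df : R -> R) x y : (forall w, is_derive w (1 : R) f (df w)) ->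
  exists2 c, `|c - x| <= `|y - x| & f y - f x = df c * (y - x).
Proof.
move=> H; have cf : continuous f by move=> w; exact: is_derive_continuous (H w).
have [xy|yx|->] := ltgtP x y; last by exists y; rewrite ?subrr ?mulr0.
- have [|c cxy e] := @MVT R f df x y xy (fun w _ => H w).
    exact: continuous_subspaceT.
  by exists c => //; move: cxy; rewrite in_itv /= => /andP[? ?]; rewrite !gtr0_norm; lra.
- have [|c cxy e] := @MVT R f df y x yx (fun w _ => H w).
    exact: continuous_subspaceT.
  exists c; last by lra.
  by move: cxy; rewrite in_itv /= => /andP[? ?]; rewrite !ltr0_norm; lra.
Qed.

Lemma derive0_const (f : R -> R) (s : seq R) a b : a <= b -> continuous f ->
  (forall t, a < t -> t < b -> t \notin s -> is_derive t (1 : R) f 0) -> f a = f b.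
Proof.
move=> + cf; elim: s a b => [|c s IH] a b.
  rewrite le_eqVlt => /orP[/eqP -> //|ab] H.
  have [||c _ e] := @MVT R f (fun=> 0) a b ab.
  - by move=> w; rewrite in_itv /= => /andP[aw wb]; exact: H.
  - exact: continuous_subspaceT.
  - by apply/eqP; rewrite eq_sym -subr_eq0 e mul0r.
move=> ab H; have [/andP[ac cb]|nc] := boolP ((a < c) && (c < b)).
- transitivity (f c).
    apply: IH; first exact: ltW.
    by move=> t ta tc ts; apply: H => //; [lra|rewrite inE negb_or ts lt_eqF].
  apply: IH; first exact: ltW.
  by move=> t ta tc ts; apply: H => //; [lra|rewrite inE negb_or ts gt_eqF].
- apply: IH => // t ta tb ts; apply: H => //; rewrite inE negb_or ts andbT.
  by apply: contra nc => /eqP <-; rewrite ta tb.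
Qed.

Lemma open_itvD_seq (s : seq R) a b : open [set t | a < t /\ t < b /\ t \notin s].
Proof.
have -> : [set t | a < t /\ t < b /\ t \notin s] = `]a, b[%classic `&` ~` [set` s].
  apply/seteqP; split => t /=; rewrite in_itv /=.
    by move=> [-> [-> /negP h]].
  by move=> [/andP[-> ->] /negP h].
apply: openI; first exact: interval_open.
apply: closed_openC; elim: s => [|c s IH].
  have -> : [set` ([::] : seq R)] = set0 by apply/seteqP; split.
  exact: closed0.
have -> : [set` c :: s] = [set c] `|` [set` s].
  apply/seteqP; split => t /=; rewrite inE.
    by move=> /orP[/eqP ->|]; [left|right].
  by move=> [->|->]; rewrite ?eqxx ?orbT.
by apply: closedU => //; exact: closed_eq.
Qed.

(** The integral of the patched derivative is Lipschitz, so its difference with [f] is continuous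
    and remains constant across the exceptional points. In the application these include the
    interaction times, at which front speeds may jump. *)
Lemma FTC_exceptional (f g : R -> R) (s : seq R) a b (K : R) : a < b -> continuous f ->
  (forall t, a < t -> t < b -> t \notin s -> is_derive t (1 : R) f (g t)) ->
  (forall t, a < t -> t < b -> t \notin s -> {for t, continuous g}) ->
  (forall t, a < t -> t < b -> t \notin s -> `|g t| <= K) ->
  let A := [set t | a < t /\ t < b /\ t \notin s] in
  [/\ measurable_fun setT (g \_ A), forall t, `|(g \_ A) t| <= `|K| &
      \int[mu]_(t in `[a, b]) (g \_ A) t = f b - f a].
Proof.
move=> ab cf df cg gK A.
have oA : open A by exact: open_itvD_seq.
have mA : measurable A by exact: open_measurable.
have mg : measurable_fun setT (g \_ A).
  apply/(measurable_restrictT g mA); apply: open_continuous_measurable_fun => // t.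
  by rewrite inE => -[at' [tb ts]]; exact: cg.
have gA t : A t -> (g \_ A) t = g t by move=> At; rewrite patchE mem_set.
have bg t : `|(g \_ A) t| <= `|K|.
  rewrite patchE; case: ifPn => [|_]; last by rewrite normr0.
  rewrite inE => -[at' [tb ts]]; apply: le_trans (ler_norm K); exact: gK.
have ig u v : mu.-integrable `[u, v] (EFin \o (g \_ A)).
  have fin : (mu `[u, v]%classic < +oo)%E.
    by rewrite lebesgue_measure_itv /=; case: ifP => _; rewrite ?ltry// -EFinB ltry.
  apply: (measurable_bounded_integrable _ fin) => //.
  - exact: measurable_funTS.
  - by exists `|K|; split; [exact: num_real|move=> w Kw t _; apply: le_trans (bg t) (ltW Kw)].
split => //.
pose a1 := a - 1; pose b1 := b + 1.
pose H x := \int[mu]_(t in `[a1, x]) (g \_ A) t.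
have H0 u v : a1 <= u -> u <= v -> H v - H u = \int[mu]_(t in `]u, v]) (g \_ A) t.
  by move=> au uv; rewrite /H -(@Rintegral_itvB _ _ (BLeft a1) (BRight v) u)// ?bnd_simp.
have Hlip u v : a1 <= u -> u <= v -> `|H v - H u| <= `|K| * (v - u).
  move=> au uv; rewrite H0//.
  have iguv : mu.-integrable `]u, v] (EFin \o (g \_ A)).
    by apply: integrableS (ig u v) => //; exact: subset_itv_oc_cc.
  apply: le_trans (le_normr_Rintegral _ iguv) _ => //.
  have -> : `|K| * (v - u) = \int[mu]_(t in `]u, v]) `|K|.
    have muE : (mu `]u, v]%classic = (v - u)%:E)%E.
      rewrite lebesgue_measure_itv /= lte_fin.
      by move: uv; rewrite le_eqVlt => /orP[/eqP ->|uv']; rewrite ?ltxx ?subrr// uv'.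
    by rewrite Rintegral_cst//; congr (_ * _); rewrite -[LHS]/(fine (v - u)%:E) -muE.
  apply: (@le_Rintegral _ _ _ mu `]u, v] (fun t => `|(g \_ A) t|) (fun=> `|K|)) => //.
  - exact: integrable_norm iguv.
  - have fin : (mu `]u, v]%classic < +oo)%E.
      by rewrite lebesgue_measure_itv /=; case: ifP => _; rewrite ?ltry// -EFinB ltry.
    apply: (measurable_bounded_integrable _ fin) => //.
    by exists `|K|; split; [exact: num_real|move=> w Kw t _ /=; rewrite normr_id; exact: ltW].
pose G x := H (Num.max a x).
have cG : continuous G.
  move=> t; apply/cvgrPdist_le => eps eps0.
  near=> u.
  have tu : `|t - u| <= eps / (`|K| + 1).
    near: u; apply/nbhs_ballP; exists (eps / (`|K| + 1)) => /=.
      by rewrite divr_gt0// ltr_wpDl.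
    by move=> u /ltW.
  have key p q : p <= q -> `|G q - G p| <= `|K| * (q - p).
    move=> pq; rewrite /G; apply: le_trans (Hlip _ _ _ _) _.
    - by rewrite le_max /a1; apply/orP; left; lra.
    - by rewrite ge_max !le_max lexx pq orbT.
    - rewrite ler_wpM2l//; case: (lerP a q) => aq; case: (lerP a p) => ap; lra.
  have : `|G t - G u| <= `|K| * `|t - u|.
    have [tu'|/ltW tu'] := leP t u.
      by rewrite distrC (distrC t) (ger0_norm (x := u - t)) ?subr_ge0// key.
    by rewrite (ger0_norm (x := t - u)) ?subr_ge0// key.
  move=> h; apply: le_trans h _; apply: (@le_trans _ _ (`|K| * (eps / (`|K| + 1)))).
    by rewrite ler_wpM2l.
  by rewrite mulrCA ger_pMr// ler_pdivrMr ?mul1r ?ltr_wpDl// lerDl.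
have dG t : A t -> is_derive t (1 : R) G (g t).
  move=> At; have [at' [tb ts]] := At.
  have ct : {for t, continuous (g \_ A)}.
    have cgt := cg t at' tb ts; rewrite /prop_for /continuous_at (gA t At).
    apply: cvg_trans cgt; apply: near_eq_cvg.
    have nA : nbhs t A by exact: open_nbhs_nbhs.
    by apply: filterS nA => u Au /=; rewrite gA.
  have t1 : t < b1 by rewrite /b1; lra.
  have a1t : a1 < t by rewrite /a1; lra.
  have [d1 d2] := continuous_FTC1_closed t1 (ig a1 b1) a1t ct.
  have d3 : is_derive t (1 : R) H (g t).
    by apply: DeriveDef; [exact: d1|rewrite -derive1E d2 gA].
  apply: (near_eq_is_derive _ d3).
  by near=> u; rewrite /G max_r//; near: u; apply: filterS (lt_nbhsr at') => u /ltW.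
have : f a - G a = f b - G b.
  apply: (@derive0_const (fun x => f x - G x) s _ _ (ltW ab)).
    by move=> x; apply: cvgB; [exact: cf|exact: cG].
  move=> t at' tb ts; rewrite -(subrr (g t)).
  by apply: is_deriveB; [exact: df|apply: dG].
have -> : \int[mu]_(t in `[a, b]) (g \_ A) t = H b - H a.
  rewrite H0 ?(ltW ab)//; last by rewrite /a1; lra.
  rewrite Rintegral_itv_obnd_cbnd//.
  by apply: integrableS (ig a b) => //; exact: subset_itv_oc_cc.
by rewrite /G maxxx (max_r (ltW ab)); lra.
Unshelve. all: by end_near. Qed.

End OneVariable.

(** * Functions of space and time *)

Section PlaneFunctions.
Variable R : realType.
Local Notation mu := (@lebesgue_measure R).
Implicit Types (f : R -> R -> R) (x t : R).

Definition jointly_continuous f := continuous (fun p : R * R => f p.1 p.2).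

Lemma jointly_continuous_path f (c d : R -> R) t : jointly_continuous f ->
  {for t, continuous c} -> {for t, continuous d} -> {for t, continuous (fun s => f (c s) (d s))}.
Proof.
move=> cf cc cd.
exact: continuous2_cvg (cf (c t, d t)) cc cd.
Qed.

Lemma jointly_continuous_x f t : jointly_continuous f -> continuous (f^~ t).
Proof.
move=> cf x; apply: (@jointly_continuous_path f id (fun=> t)) => //; exact: cvg_cst.
Qed.

(** Rounding the first variable down to multiples of [1 / n.+1] gives functions measurable for the
    product structure, being functions of time on countably many strips; they converge pointwise to
    [f]. *)
Lemma measurable_jointly_continuous f : jointly_continuous f ->
  measurable_fun setT (fun p : R * R => f p.1 p.2).
Proof.
move=> cf; pose q n x : R := (Num.floor (x * n.+1%:R))%:~R / n.+1%:R.
apply: (measurable_fun_cvg (h := fun n (p : R * R) => f (q n p.1) p.2)).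
- move=> n.
  pose E (m : nat) : set (R * R) := if unpickle m is Some k then
    [set p : R * R | k%:~R <= p.1 * n.+1%:R < (k + 1)%:~R] else set0.
  have -> : [set: R * R] = \bigcup_m E m.
    apply/seteqP; split; last by [].
    move=> p _; exists (pickle (Num.floor (p.1 * n.+1%:R))); first exact: I.
    by rewrite /E pickleK /= floor_le_tmp floorD1_gt.
  have mE m : measurable (E m).
    rewrite /E; case: unpickle => // k.
    rewrite (_ : [set _ | _] = ~` [set p : R * R | p.1 * n.+1%:R < k%:~R] `&`
        [set p : R * R | p.1 * n.+1%:R < (k + 1)%:~R]); last first.
      apply/seteqP; split => p /=; first by move=> /andP[h ->]; split; [apply/negP; rewrite -leNgt|].
      by move=> [/negP]; rewrite -leNgt => -> ->.
    have mp : measurable_fun setT (fun p : R * R => p.1 * n.+1%:R).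
      by apply: measurable_funM; [exact: measurable_fst|exact: measurable_cst].
    apply: measurableI; first apply: measurableC; apply: measurable_lt_set => //; exact: measurable_cst.
  apply/measurable_fun_bigcup => // m; rewrite /E; case Em : (unpickle m) => [k|]; last first.
    exact: measurable_fun_set0.
  have mEm : measurable [set p : R * R | k%:~R <= p.1 * n.+1%:R < (k + 1)%:~R].
    by have := mE m; rewrite /E Em.
  apply: (eq_measurable_fun (fun p : R * R => f (k%:~R / n.+1%:R) p.2)).
    by move=> p; rewrite inE /= => /floor_def; rewrite /q => ->.
  apply: measurable_funS measurableT _ _ => //.
  apply: (@measurable_timed _ (f (k%:~R / n.+1%:R))).
  apply: continuous_measurable_fun => t.
  by apply: (@jointly_continuous_path f (fun=> k%:~R / n.+1%:R) id) => //; exact: cvg_cst.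
- move=> [x t] _ /=.
  have qx : q ^~ x @ \oo --> x.
    apply/cvgrPdist_le => e e0; near=> n.
    rewrite /q; have n0 : (0 : R) < n.+1%:R by rewrite ltr0n.
    have /andP[h1 h2] := @floor_itv _ (x * n.+1%:R).
    rewrite intrD in h2.
    have -> : x - (Num.floor (x * n.+1%:R))%:~R / n.+1%:R =
       (x * n.+1%:R - (Num.floor (x * n.+1%:R))%:~R) / n.+1%:R.
      by rewrite mulrBl mulfK// gt_eqF.
    rewrite ger0_norm; last by rewrite divr_ge0 ?subr_ge0// ltW.
    rewrite ler_pdivrMr//; apply: (@le_trans _ _ 1); first lra.
    rewrite mulrC -ler_pdivrMr// mul1r; apply: ltW; near: n.
    exists (Num.bound e^-1) => // n /= hn.
    apply: lt_le_trans (archi_boundP _) _; first by rewrite invr_ge0 ltW.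
    by rewrite ler_nat; exact: leq_trans hn (leqnSn _).
  by exact: continuous2_cvg (cf (x, t)) qx (cvg_cst _).
Unshelve. all: by end_near. Qed.

Lemma bounded_support_integrable (g : R -> R) (A K : R) (B : set R) : measurable B ->
  measurable_fun setT g -> (forall x, A < `|x| -> g x = 0) -> (forall x, `|g x| <= K) ->
  mu.-integrable B (EFin \o g).
Proof.
move=> mB mg g0 gK; apply: (@integrableS _ _ _ mu setT) => //.
pose S : set R := `[- A, A]%classic.
have fin : (mu S < +oo)%E.
  by rewrite /S lebesgue_measure_itv /=; case: ifP => _; rewrite ?ltry// -EFinB ltry.
have -> : EFin \o g = (EFin \o g) \_ S.
  apply/funext => x; rewrite patchE; case: ifPn => //; rewrite notin_setE /S /= in_itv /= => /negP xA.
  by rewrite /= g0// ltNge ler_norml.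
have mS : measurable S by exact: measurable_itv.
have H := iffLR (integrable_mkcond (mu := mu) (EFin \o g) mS); apply: H.
apply: (measurable_bounded_integrable _ fin) => //; first exact: measurable_funTS.
exists K; split; first exact: num_real.
by move=> k Kk x _; apply: le_trans (ltW Kk).
Qed.

Definition vanishes_outside (A : R) f := forall x t, (A < `|x|) || (A < `|t|) -> f x t = 0.

Lemma bounded_vanishing f (A : R) : jointly_continuous f -> vanishes_outside A f ->
  exists2 K, 0 < K & forall x t, `|f x t| <= K.
Proof.
move=> cf vf.
have cpt : compact ((`[- A, A] : set R) `*` (`[- A, A] : set R)).
  by apply: compact_setX; exact: segment_compact.
have /compact_bounded[N [_ HN]] : compact [set f p.1 p.2 | p in (`[- A, A] : set R) `*` (`[- A, A] : set R)].
  by apply: continuous_compact => //; exact: continuous_subspaceT.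
have N1 : N < `|N| + 1 by have := ler_norm N; lra.
exists (`|N| + 1); first by have := normr_ge0 N; lra.
move=> x t; have [h|] := boolP ((A < `|x|) || (A < `|t|)).
  by rewrite vf// normr0; have := normr_ge0 N; lra.
rewrite negb_or -!leNgt => /andP[]; rewrite !(ler_norml _ A) => hx ht.
by have := HN _ N1; rewrite /globally /=; apply; exists (x, t) => //.

Qed.

Lemma chain_rule f fx (c : R -> R) t v d : jointly_continuous fx ->
  (forall x t, is_derive x (1 : R) (f^~ t) (fx x t)) ->
  is_derive t (1 : R) (f (c t)) d -> is_derive t (1 : R) c v ->
  is_derive t (1 : R) (fun s => f (c s) s) (d + v * fx (c t) t).
Proof.
move=> cfx dfx dft dc; have cc := is_derive_continuous dc.
have mv s : {w : R | `|w - c t| <= `|c s - c t| & f (c s) s - f (c t) s = fx w s * (c s - c t)}.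
  by apply: cid2; exact: mean_value (fun w => dfx w s).
pose w s := s2val (mv s).
have wc : w s @[s --> t] --> c t.
  apply/cvgrPdist_le => e e0; near=> s; rewrite distrC.
  apply: le_trans (s2valP (mv s)) _; rewrite distrC; near: s.
  by move/cvgrPdist_le: cc => /(_ e e0).
have fxw : fx (w s) s @[s --> t] --> fx (c t) t.
  exact: continuous2_cvg (cfx (c t, t)) wc (@cvg_id _ (nbhs t)).
have quot (g : R -> R) b : is_derive t (1 : R) g b ->
    (fun s => (s - t)^-1 * (g s - g t)) @ t^' --> b.
  move=> [dg <-]; have : (fun h : R => h^-1 *: ((g \o shift t) (h *: (1 : R)) - g t)) @ 0^' --> 'D_1 g t.
    exact: dg.
  move=> H; apply/cvgrPdist_le => e e0.
  have /cvgrPdist_le /(_ e e0) := H; rewrite !near_withinE => -[r r0 Hr].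
  exists r => // s /=; rewrite distrC => sr st.
  have := Hr (s - t); rewrite /ball_ /= sub0r normrN => /(_ sr).
  rewrite subr_eq0 => /(_ st); rewrite /= [_ *: 1]mulr1 subrK; exact.
have q1 := quot _ _ dc; have q2 := quot _ _ dft.
have fxw' : fx (w s) s @[s --> t^'] --> fx (c t) t by apply: cvg_within_filter.
have Q : (fun s => (s - t)^-1 * (f (c s) s - f (c t) t)) @ t^' --> d + v * fx (c t) t.
  rewrite (_ : (fun s => _) = fun s => (s - t)^-1 * (f (c t) s - f (c t) t) +
      (s - t)^-1 * (c s - c t) * fx (w s) s); first exact: cvgD q2 (cvgM q1 fxw').
  apply/funext => s; have := s2valP' (mv s); rewrite -/(w s) => h.
  by rewrite -mulrA -mulrDr; congr (_ * _); rewrite [_ * fx _ _]mulrC -h; ring.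
have H : (fun h : R => h^-1 *: (((fun s => f (c s) s) \o shift t) (h *: (1 : R)) - f (c t) t)) @ 0^'
    --> d + v * fx (c t) t.
  apply/cvgrPdist_le => e e0.
  have /cvgrPdist_le /(_ e e0) := Q; rewrite !near_withinE => -[r r0 Hr].
  exists r => // h /=; rewrite sub0r normrN => hr h0.
  have := Hr (h + t); rewrite /ball_ /= opprD addrCA subrr addr0 normrN => /(_ hr).
  rewrite -subr_eq0 addrK => /(_ h0); rewrite [_ *: 1]mulr1; exact.
by apply: DeriveDef; [apply/cvg_ex; eexists; exact: H | exact/cvg_lim].
Unshelve. all: by end_near. Qed.

(** A single support radius and a single bound, so that a test function and its derivatives can be
    handled as instances with common constants. *)
Record c1_data f fx ft (A K : R) : Prop := C1Data {
  c1_cont : jointly_continuous f;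
  c1_contx : jointly_continuous fx;
  c1_contt : jointly_continuous ft;
  c1_dx : forall x t, is_derive x (1 : R) (f^~ t) (fx x t);
  c1_dt : forall x t, is_derive t (1 : R) (f x) (ft x t);
  c1_van : vanishes_outside A f;
  c1_vanx : vanishes_outside A fx;
  c1_vant : vanishes_outside A ft;
  c1_K : 0 < K;
  c1_bnd : forall x t, [/\ `|f x t| <= K, `|fx x t| <= K & `|ft x t| <= K] }.

Lemma vanishes_dx f (A : R) : vanishes_outside A f ->
  (forall x t, derivable (f^~ t) x 1) -> vanishes_outside A (dx f).
Proof.
move=> vf df x t h; rewrite /dx derive1E.
have [xA|tA] := orP h.
- have nb : \forall y \near x, A < `|y|.
    by apply: (cvgr_gt _ (@norm_continuous _ _ x)) .
  have : is_derive x (1 : R) (f^~ t) 0.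
    apply: (near_eq_is_derive _ (is_derive_cst (0 : R) x (1 : R))).
    by apply: filterS nb => y yA; rewrite vf// yA.
  by move=> [_ ->].
- have -> : (fun y => f y t) = cst 0 by apply/funext => y; rewrite vf// tA orbT.
  by rewrite derive_cst.
Qed.

Lemma vanishes_dt f (A : R) : vanishes_outside A f ->
  (forall x t, derivable (f x) t 1) -> vanishes_outside A (dt f).
Proof.
move=> vf df x t h; rewrite /dt derive1E.
have [xA|tA] := orP h.
- have -> : (fun s => f x s) = cst 0 by apply/funext => y; rewrite vf// xA.
  by rewrite derive_cst.
- have nb : \forall y \near t, A < `|y|.
    by apply: (cvgr_gt _ (@norm_continuous _ _ t)) .
  have : is_derive t (1 : R) (f x) 0.
    apply: (near_eq_is_derive _ (is_derive_cst (0 : R) t (1 : R))).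
    by apply: filterS nb => y yA; rewrite vf// yA orbT.
  by move=> [_ ->].
Qed.

Lemma Cn2_c1 n f (A : R) : Cn2 n.+1 f -> vanishes_outside A f ->
  exists K, c1_data f (dx f) (dt f) A K.
Proof.
move=> [cf [df cx ct]] vf.
have c0 m g : Cn2 m g -> jointly_continuous g by case: m => [|m] [].
have vx : vanishes_outside A (dx f) by apply: vanishes_dx => // x t; case: (df x t).
have vt : vanishes_outside A (dt f) by apply: vanishes_dt => // x t; case: (df x t).
have [K1 K10 B1] := bounded_vanishing cf vf.
have [K2 K20 B2] := bounded_vanishing (c0 _ _ cx) vx.
have [K3 K30 B3] := bounded_vanishing (c0 _ _ ct) vt.
exists (K1 + K2 + K3); split => //; [exact: c0 cx|exact: c0 ct| | | |].
- move=> x t; exact: (DeriveDef (proj1 (df x t)) (esym (derive1E _ _))).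
- move=> x t; exact: (DeriveDef (proj2 (df x t)) (esym (derive1E _ _))).
- by rewrite !addr_gt0.
- by move=> x t; have := B1 x t; have := B2 x t; have := B3 x t; split; lra.
Qed.

Section C1.
Variables (f fx ft : R -> R -> R) (A K : R).
Hypothesis cd : c1_data f fx ft A K.

Lemma c1_lipschitz x y t : `|f y t - f x t| <= K * `|y - x|.
Proof.
have [c _ ->] := mean_value x y (fun w => c1_dx cd w t).
by rewrite normrM ler_wpM2r//; have [] := c1_bnd cd c t.
Qed.

Lemma c1_integrable t (B : set R) : measurable B -> mu.-integrable B (EFin \o f^~ t).
Proof.
move=> mB; apply: (@bounded_support_integrable _ A K) => //.
- by apply: continuous_measurable_fun; move: (c1_cont cd) => /jointly_continuous_x cf; exact: cf.
- by move=> x xA; rewrite (c1_van cd)// xA.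
- by move=> x; have [] := c1_bnd cd x t.
Qed.

End C1.

(** Turns integrals of [f] over constant regions into differences of values at their two fronts. *)
Definition primitive f x t : R := \int[mu]_(w in `]-oo, x]) f w t.

Section Primitive.
Variables (f fx ft : R -> R -> R) (A K : R).
Hypothesis cd : c1_data f fx ft A K.

Lemma primitive_dx x t : is_derive x (1 : R) (primitive f ^~ t) (f x t).
Proof.
have x1 : x < x + 1 by lra.
have [] := @continuous_FTC1 R (f^~ t) -oo%O x (x + 1) x1.
- by apply: (c1_integrable cd).
- first [exact: isT | exact: ltNBSide | by rewrite ltBSide | by rewrite lt_def | by rewrite ltNyr].
- by move: (c1_cont cd) => /jointly_continuous_x cf; exact: cf.
- by move=> d1 d2; apply: DeriveDef; [exact: d1|rewrite -derive1E d2].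
Qed.

Lemma primitive_dt x t : is_derive t (1 : R) (primitive f x) (primitive ft x t).
Proof.
pose S : set R := `[- A, A]%classic.
have mS : measurable S by exact: measurable_itv.
pose G (w : R) : R := K * \1_S w.
have iG : mu.-integrable `]-oo, x] (EFin \o G).
  apply: (@bounded_support_integrable _ A K) => //.
  - by apply: measurable_funM => //; exact: measurable_indic.
  - move=> w wA; rewrite /G indicE memNset ?mulr0// /S /= in_itv /= -ler_norml.
    by apply/negP; rewrite -ltNge.
  - move=> w; rewrite /G normrM gtr0_norm ?(c1_K cd)// ger_pMr ?(c1_K cd)//.
    by rewrite ger0_norm// indicE lern1 leq_b1.
have tI : `]t - 1, t + 1[%classic t by rewrite /= in_itv /=; apply/andP; split; lra.
have G0 w : 0 <= G w by rewrite /G mulr_ge0// ltW// (c1_K cd).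
have := @cvg_differentiation_under_integral R _ _ mu (fun s w => f w s) `]-oo, x]%classic
  (measurable_itv _) t (t - 1) (t + 1) tI.
move=> /(_ (fun s _ => c1_integrable cd s (measurable_itv _))).
move=> /(_ (fun s w _ _ => ex_derive (is_derive := c1_dt cd w s))) /(_ G G0 iG).
have p1 s w : partial1of2 (fun s w => f w s) s w = ft w s.
  by rewrite partial1of2E; exact: (derive_val (is_derive := c1_dt cd w s)).
have GB s w : `]t - 1, t + 1[%classic s -> `]-oo, x]%classic w ->
    `|partial1of2 (fun s w => f w s) s w| <= G w.
  move=> _ _; rewrite p1 /G indicE; case: (boolP (w \in _)) => wA /=.
    by rewrite mulr1; have [] := c1_bnd cd w s.
  rewrite mulr0 (c1_vant cd) ?normr0//; apply/orP; left.
  by move: wA; rewrite notin_setE /S /= in_itv /= ltNge ler_norml => /negP.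
move=> /(_ GB) H.
have H' : (fun h : R => h^-1 *: ((primitive f x \o shift t) (h *: (1 : R)) - primitive f x t)) @ 0^'
    --> primitive ft x t.
  have -> : primitive ft x t = \int[mu]_(y in `]-oo, x]) partial1of2 (fun s w => f w s) t y.
    by rewrite /primitive; apply: eq_Rintegral => w _; rewrite p1.
  apply: cvg_trans H; apply: near_eq_cvg; near=> h.
  by rewrite /= [_ *: 1]mulr1.
by apply: DeriveDef; [apply/cvg_ex; eexists; exact: H' | exact/cvg_lim].
Unshelve. all: by end_near. Qed.

Lemma primitive_cont (c : R -> R) t : {for t, continuous c} ->
  {for t, continuous (fun s => primitive f (c s) s)}.
Proof.
move=> cc; have K0 := c1_K cd; apply/cvgrPdist_le => e e0.
have ct := is_derive_continuous (primitive_dt (c t) t).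
have e2 : 0 < e / 2 by rewrite divr_gt0.
have ee : 0 < e / 2 / K by rewrite !divr_gt0.
near=> s.
have h1 : `|primitive f (c t) t - primitive f (c t) s| <= e / 2.
  near: s; by move/cvgrPdist_le: ct => /(_ _ e2).
have h2 : `|c t - c s| <= e / 2 / K.
  by near: s; move/cvgrPdist_le: cc => /(_ _ ee).
have [w _ h3] := mean_value (c s) (c t) (fun w => primitive_dx w s).
have h4 : `|primitive f (c t) s - primitive f (c s) s| <= e / 2.
  rewrite h3 normrM; apply: (@le_trans _ _ (K * (e / 2 / K))); last by rewrite mulrC divfK ?gt_eqF.
  by apply: ler_pM => //; have [] := c1_bnd cd w s.
have := ler_normD (primitive f (c t) t - primitive f (c t) s) (primitive f (c t) s - primitive f (c s) s).
rewrite addrA subrK; lra.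
Unshelve. all: by end_near. Qed.

Lemma primitive_path (c : R -> R) t v : is_derive t (1 : R) c v ->
  is_derive t (1 : R) (fun s => primitive f (c s) s) (primitive ft (c t) t + v * f (c t) t).
Proof.
move=> dc; apply: chain_rule dc; [exact: c1_cont cd|exact: primitive_dx|exact: primitive_dt].
Qed.

End Primitive.

End PlaneFunctions.

Lemma continuous_at_sum (R : realType) (I : Type) (s : seq I) (f : I -> R -> R) t :
  (forall i, {for t, continuous (f i)}) -> {for t, continuous (fun t => \sum_(i <- s) f i t)}.
Proof.
move=> cf; elim: s => [|i s IH].
  have -> : (fun t => \sum_(i <- [::]) f i t) = cst 0 by apply/funext => w; rewrite big_nil.
  exact: cvg_cst.
have -> : (fun t => \sum_(i <- i :: s) f i t) = f i \+ (fun t => \sum_(i <- s) f i t).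
  by apply/funext => w; rewrite big_cons.
by apply: cvgD; [exact: cf|exact: IH].
Qed.

(** * Balance along the fronts *)

Section FrontSpeed.
Variables (R : realType) (D : pcdata R).
Local Notation Y := (node D).
Local Notation rs := (pcrho D).
Local Notation us := (pcu D).
Local Notation M := (umax D).
Local Notation z := (front_pos D).
Local Notation alive_at := (alive_at D).
Local Notation path := (front_path D).
Local Notation dtime := (dtime D).
Local Notation wmass := (wmass D).
Local Notation wmom := (wmom D).
Local Notation wave_ok := (wave_ok D).
Local Notation wave_of := (wave_of D).
Local Notation birth_time := (birth_time D).
Local Notation contact := (contact D).
Local Notation xi := (xi D).
Local Notation edens := (edens D).
Implicit Types (x y t s : R) (e k l r : nat).

Lemma prv_nxt_eq l r e t : 0 <= t -> (l <= e < r)%N -> alive_at l t -> alive_at r t ->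
  (forall k, (l < k < r)%N -> ~~ alive_at k t) -> prv D e t = l /\ nxt D e t = r.
Proof.
move=> t0 /andP[le er] al ar dd.
have [p1 p2 p3] := prvP D e t; have [n1 n2 n3] := nxtP D e t0.
split; apply/eqP; rewrite eqn_leq; apply/andP; split; rewrite leqNgt; apply/negP => h.
- by have := dd (prv D e t); rewrite h (leq_ltn_trans p1 er) p2 => /(_ isT).
- by have := p3 l; rewrite h le al => /(_ isT).
- by have := n3 r; rewrite h er ar => /(_ isT).
- by have := dd (nxt D e t); rewrite h (leq_ltn_trans le n1) n2 => /(_ isT).
Qed.

Lemma wave_prv_nxt l r e t : wave_ok (l, r) -> 0 < t -> alive (wave_of l r) t ->
  (l <= e < r)%N -> prv D e t = l /\ nxt D e t = r.
Proof.
move=> ok t0 al lr; have [a1 a2 _] := wave_alive_regions ok t0 al.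
apply: prv_nxt_eq => //; first exact: ltW.
by move=> k lk; rewrite -dtime_leP//; exact: (wave_life_le ok (alive_life al) lk).
Qed.

Definition front_speed e t : R := wave_speed D (prv D e t) (nxt D e t) t.

Lemma front_speed_bnd e t : 0 < t -> `|front_speed e t| <= M.
Proof.
move=> t0; have [ok al] := front_wave D e t0.
have [c|nc] := boolP (contact (prv D e t) (nxt D e t)).
  by rewrite /front_speed /wave_speed c; exact: pcu_le.
exact: (shadow_speed_bnd ok nc (alive_life al) t0).
Qed.

(** The birth time of the wave through front [e], if positive, is an extinction time excluded by the
    hypothesis, so the group of [e] is constant near [t] and the wave equations apply. *)
Lemma front_derivative e t : 0 < t -> (forall k, (k < nxt D e t)%N -> dtime k != t%:E) ->
  is_derive t (1 : R) (path e) (front_speed e t) /\ {for t, continuous (front_speed e)}.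
Proof.
move=> t0 nd; have [ok al] := front_wave D e t0.
have [p1 _ _] := prvP D e t; have [n1 _ _] := nxtP D e (ltW t0).
rewrite /front_speed.
set l := prv D e t in ok al p1 *; set r := nxt D e t in ok al n1 nd *.
have ler : (l <= e < r)%N by rewrite p1.
have op : open_life (wave_of l r) t.
  split; last by have [] := al.
  rewrite lt_neqAle; apply/andP; split; last by have [] := al.
  have [b0|[k lk bk]] := birth_attained D l r.
    by rewrite /= /birth_time b0 /= lt_eqF.
  have := birthE ok; rewrite bk /= => dk; apply: contra (nd k _) => [/eqP <-|].
    by rewrite dk.
  by case/andP: lk.
have nop := open_life_near op.
have nwave : \forall s \near t, [/\ 0 < s, alive (wave_of l r) s & life (wave_of l r) s].
  apply: filterS nop => s os; have [b d] := os.
  by split; [exact: open_life_gt0 os|split; [exact: ltW|]|exact: open_life_life].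
have nspeed : \forall s \near t, wave_speed D l r s = wave_speed D (prv D e s) (nxt D e s) s.
  by apply: filterS nwave => s [s0 als _]; have [-> ->] := wave_prv_nxt ok s0 als ler.
have npath : \forall s \near t, wave_line D l r s = path e s.
  apply: filterS nwave => s [s0 als lf].
  have cl := life_cluster ok lf s0.
  have := wave_line_path ok lf; rewrite /= => ->.
  by rewrite (front_path_cluster (ltW s0) cl ler).
split.
- apply: (near_eq_is_derive npath).
  have [c|nc] := boolP (contact l r).
    rewrite /wave_line /wave_speed c.
    have -> : us (uphalf l) = 0 + us (uphalf l) *: (1 : R) by rewrite add0r [_ *: 1]mulr1.
    rewrite {1}[_ *: 1]mulr1 add0r.
    by apply: is_deriveD.
  by have [_ _ H _] := wave_shadow_wave ok nc; have [] := H _ op.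
- have ct : {for t, continuous (wave_speed D l r)}.
    have [c|nc] := boolP (contact l r).
      by rewrite /wave_speed c; exact: cvg_cst.
    have lt := open_life_life op; have W0 := shadow_wmass_gt0 ok nc lt t0.
    have := shadow_speedE ok nc lt t0; rewrite /= => st.
    rewrite /prop_for /continuous_at st.
    have H : wmom l r s / wmass l r s @[s --> t] --> wmom l r t / wmass l r t.
      apply: cvgM; first exact: wmom_continuous.
      by apply: cvgV; [rewrite gt_eqF|exact: wmass_continuous].
    apply: cvg_trans H; apply: near_eq_cvg.
    apply: filterS nwave => s [s0 _ lf].
    by have := shadow_speedE ok nc lf s0.
  rewrite /prop_for /continuous_at -/l -/r.
  by apply: cvg_trans ct; exact: near_eq_cvg.
Qed.

Definition jump_dens e : R := edens e.+1 - edens e.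

(** The mass of a front and the jump of the region integrals at it are both multiples of
    [jump_dens e]; the common factor allows each front to be balanced separately. *)
Lemma xiE e t : xi e t = jump_dens e * (path e t - t * us (uphalf e) - Y e./2).
Proof.
rewrite /jump_dens /xi /emass /edge /edens /= uphalf_half; case oe: (odd e) => /=.
- rewrite add1n (_ : mass D e./2 (Y e./2) = mass D e./2.+1 (Y e./2)); last first.
    by apply: cumul_eq; [exact: incell_node|exact: incellS_node].
  by rewrite mass_cell (mass_cell _ _ (Y e./2)); ring.
- by rewrite add0n mass_cell (mass_cell _ _ (_ - _)); ring.
Qed.

End FrontSpeed.

Section FrontBalance.
Variables (R : realType) (D : pcdata R).
Local Notation mu := (@lebesgue_measure R).
Local Notation Y := (node D).
Local Notation us := (pcu D).
Local Notation M := (umax D).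
Local Notation path := (front_path D).
Local Notation dtime := (dtime D).
Local Notation speed := (front_speed D).
Variables (f fx ft fxt ftt : R -> R -> R) (A K K' : R).
Hypothesis cd : c1_data f fx ft A K.
Hypothesis cdt : c1_data ft fxt ftt A K'.
Implicit Types (x y t s : R) (e k l r : nat).

(* Up to the factor [jump_dens], the contribution of one front to the integral of density times [f]. *)
Definition front_term e t : R :=
  (path e t - t * us (uphalf e) - Y e./2) * f (path e t) t - primitive f (path e t) t.

(** The derivative of [front_term]: the terms [speed e t * f] cancel, leaving the velocity
    [us (uphalf e)] of the labels in front of [f]. *)
Definition front_flux e t : R :=
  (path e t - t * us (uphalf e) - Y e./2) * (ft (path e t) t + speed e t * fx (path e t) t)
  - (primitive ft (path e t) t + us (uphalf e) * f (path e t) t).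

Let path_cont e t : {for t, continuous (path e)}.
Proof. exact: front_path_continuous. Qed.

Lemma front_term_derive e t : is_derive t (1 : R) (path e) (speed e t) ->
  is_derive t (1 : R) (front_term e) (front_flux e t).
Proof.
move=> dp.
have d1 := chain_rule (c1_contx cd) (c1_dx cd) (c1_dt cd (path e t) t) dp.
have d2 := primitive_path cd dp.
pose g s : R := path e s - s * us (uphalf e) - Y e./2.
have d3 : is_derive t (1 : R) g (speed e t - us (uphalf e)).
  have d4 : is_derive t (1 : R) (fun s : R => s * us (uphalf e)) (us (uphalf e)).
    have -> : (fun s : R => s * us (uphalf e)) = (fun s => us (uphalf e) *: s).
      by apply/funext => s; rewrite mulrC.
    have H := is_deriveZ (us (uphalf e)) (is_derive_id t (1 : R)).
    by rewrite [X in is_derive _ _ _ X]mulr1 in H.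
  have := is_deriveB (is_deriveB dp d4) (is_derive_cst (Y e./2) t (1 : R)).
  by rewrite subr0.
have H := is_deriveB (is_deriveM d3 d1) d2.
have -> : front_flux e t = g t *: (ft (path e t) t + speed e t * fx (path e t) t) +
   f (path e t) t *: (speed e t - us (uphalf e)) - (primitive ft (path e t) t + speed e t * f (path e t) t).
  by rewrite /front_flux /g /GRing.scale /=; ring.
exact: H.
Qed.

Lemma front_term_continuous e : continuous (front_term e).
Proof.
move=> t; have cp := @path_cont e t.
apply: cvgB; last exact: (primitive_cont cd cp).
apply: cvgM; last exact: (jointly_continuous_path (c1_cont cd) cp cvg_id).
apply: cvgB; last exact: cvg_cst.
by apply: cvgB => //; apply: cvgM; [exact: cvg_id|exact: cvg_cst].
Qed.

Lemma bounded_on_segment (g : R -> R) a b : continuous g ->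
  exists K0, forall t, a <= t -> t <= b -> `|g t| <= K0.
Proof.
move=> cg; have := continuous_compact (continuous_subspaceT cg) (@segment_compact R a b).
move=> /compact_bounded[N [_ HN]]; exists (`|N| + 1) => t at' tb.
have N1 : N < `|N| + 1 by have := ler_norm N; lra.
by have := HN _ N1; rewrite /globally /=; apply; exists t => //; rewrite /= in_itv /= at'.
Qed.

Let offset e t : R := path e t - t * us (uphalf e) - Y e./2.

Let offset_continuous e t : {for t, continuous (offset e)}.
Proof.
have cp := @path_cont e t.
apply: cvgB; last exact: cvg_cst.
by apply: cvgB => //; apply: cvgM; [exact: cvg_id|exact: cvg_cst].
Qed.

Let along (g : R -> R -> R) e : jointly_continuous g -> forall t, {for t, continuous (fun t => g (path e t) t)}.
Proof.
by move=> cg t; exact: (jointly_continuous_path cg (@path_cont e t) cvg_id).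
Qed.

Let flux_tail e t : R := primitive ft (path e t) t + us (uphalf e) * f (path e t) t.

Let flux_tail_continuous e t : {for t, continuous (flux_tail e)}.
Proof.
apply: cvgD; first exact: (primitive_cont cdt (@path_cont e t)).
by apply: cvgM; [exact: cvg_cst|exact: (@along _ e (c1_cont cd) t)].
Qed.

Lemma front_flux_bnd e tau : exists K0, forall t, 0 < t -> t <= tau -> `|front_flux e t| <= K0.
Proof.
have [K1 B1] := bounded_on_segment 0 tau (fun t => @offset_continuous e t).
have [K2 B2] := bounded_on_segment 0 tau (@along _ e (c1_contt cd)).
have [K3 B3] := bounded_on_segment 0 tau (@along _ e (c1_contx cd)).
have [K4 B4] := bounded_on_segment 0 tau (fun t => @flux_tail_continuous e t).
exists (K1 * (K2 + M * K3) + K4) => t t0 tt; have t0' := ltW t0.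
rewrite /front_flux -/(offset e t) -/(flux_tail e t).
apply: le_trans (ler_normB _ _) _; apply: lerD; last exact: B4.
rewrite normrM; apply: ler_pM => //; first exact: B1.
apply: le_trans (ler_normD _ _) _; apply: lerD; first exact: B2.
by rewrite normrM; apply: ler_pM => //; [exact: front_speed_bnd|exact: B3].
Qed.

Lemma front_flux_continuous e t : {for t, continuous (speed e)} ->
  {for t, continuous (front_flux e)}.
Proof.
move=> cs; apply: cvgB; last exact: (@flux_tail_continuous e t).
apply: cvgM; first exact: (@offset_continuous e t).
apply: cvgD; first exact: (@along _ e (c1_contt cd) t).
by apply: cvgM => //; exact: (@along _ e (c1_contx cd) t).
Qed.

(** Integration of the derivative of [front_term], which vanishes at [tau] because [A < tau] and
    reduces at time 0 to a primitive at the node. *)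
Lemma front_balance n (c : nat -> R) (tau : R) : 0 < tau -> A < tau ->
  exists s : seq R, let E := [set t | 0 < t /\ t < tau /\ t \notin s] in
    let F t := \sum_(e < n) c e * front_flux e t in
    [/\ measurable_fun setT (F \_ E), exists K0, forall t, `|(F \_ E) t| <= K0 &
     \int[mu]_(t in `[0, tau]) (F \_ E) t = \sum_(e < n) c e * primitive f (Y e./2) 0].
Proof.
move=> tau0 Atau.
(* Region [N] lives until [tau], so the groups of the first [n] fronts never extend past it and
   finitely many extinction times matter. *)
have [N /andP[nN aN]] := alive_unbounded D n (ltW tau0).
exists [seq fine (dtime k) | k <- iota 0 N] => E F.
pose S t := \sum_(e < n) c e * front_term e t.
have cS : continuous S.
  move=> t; apply: continuous_at_sum => e.
  by apply: cvgM; [exact: cvg_cst|exact: front_term_continuous].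
have good t e : (e < n)%N -> 0 < t -> t < tau -> t \notin [seq fine (dtime k) | k <- iota 0 N] ->
    is_derive t (1 : R) (path e) (speed e t) /\ {for t, continuous (speed e)}.
  move=> en t0 tt tn; apply: front_derivative => // k kn.
  have aNt : alive_at D N t by apply: alive_at_earlier aN; last exact: ltW.
  have [n1 n2 n3] := nxtP D e (ltW t0).
  have nN' : (nxt D e t <= N)%N.
    rewrite leqNgt; apply/negP => h; have := n3 N.
    by rewrite h (ltn_trans en nN) aNt => /(_ isT).
  apply: contra tn => /eqP dk; apply/mapP; exists k; last by rewrite dk.
  by rewrite mem_iota add0n (leq_trans kn nN').
have Kb e : {K0 | forall t, 0 < t -> t <= tau -> `|front_flux e t| <= K0}.
  exact: cid (front_flux_bnd e tau).
have := @FTC_exceptional R S F [seq fine (dtime k) | k <- iota 0 N] 0 tau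
  (\sum_(e < n) `|c e| * sval (Kb e)) tau0 cS.
case.
- move=> t t0 tt tn.
  rewrite (_ : S = \sum_(e < n) (fun t => c e * front_term e t)); last first.
    by apply/funext => w; rewrite fct_sumE.
  apply: is_derive_sum => e; have [dp _] := good t e (ltn_ord e) t0 tt tn.
  exact: (is_deriveZ (c e) (front_term_derive dp)).
- move=> t t0 tt tn.
  apply: continuous_at_sum => e.
  have [_ cs] := good t e (ltn_ord e) t0 tt tn.
  by apply: cvgM; [exact: cvg_cst|exact: front_flux_continuous].
- move=> t t0 tt tn; apply: le_trans (ler_norm_sum _ _ _) _; apply: ler_sum => e _.
  by rewrite normrM ler_wpM2l//; apply: (svalP (Kb e)) => //; exact: ltW.
move=> m1 m2 m3; split => //; first by eexists; exact: m2.
rewrite -/E in m3; rewrite m3.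
have f0 w : f w tau = 0.
  by rewrite (c1_van cd) //; apply/orP; right; rewrite gtr0_norm.
have -> : S tau = 0.
  rewrite /S big1 // => e _; rewrite /front_term f0 mulr0 /primitive /Rintegral.
  rewrite (@eq_integral _ _ _ mu _ (cst 0%E)) => [|w _]; last by rewrite f0.
  by rewrite integral0 subr0 mulr0.
rewrite sub0r -sumrN; apply: eq_bigr => e _.
rewrite /front_term front_pathE // front_pos0 mul0r subr0 subrr mul0r sub0r.
by rewrite mulrN opprK.
Qed.

End FrontBalance.

(** * Sums over fronts and over waves *)

Section WaveSums.
Variables (R : realType) (D : pcdata R).
Local Notation Y := (node D).
Local Notation us := (pcu D).
Local Notation M := (umax D).
Local Notation z := (front_pos D).
Local Notation alive_at := (alive_at D).
Local Notation path := (front_path D).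
Local Notation wmass := (wmass D).
Local Notation wmom := (wmom D).
Local Notation wave_ok := (wave_ok D).
Local Notation wave_of := (wave_of D).
Local Notation birth_time := (birth_time D).
Local Notation contact := (contact D).
Local Notation xi := (xi D).
Local Notation nxt := (nxt D).
Local Notation prv := (prv D).
Implicit Types (x y t s : R) (e k l r j : nat).

Lemma nxt_unique e r t : 0 <= t -> (e < r)%N -> alive_at r t ->
  (forall k, (e < k < r)%N -> ~~ alive_at k t) -> nxt e t = r.
Proof.
move=> t0 er ar dd; have [n1 n2 n3] := nxtP D e t0.
apply/eqP; rewrite eqn_leq; apply/andP; split; rewrite leqNgt; apply/negP => h.
- by have := n3 r; rewrite h er ar => /(_ isT).
- by have := dd (nxt e t); rewrite h n1 n2 => /(_ isT).
Qed.

Lemma nxtS e t : 0 <= t -> nxt e t = if alive_at e.+1 t then e.+1 else nxt e.+1 t.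
Proof.
move=> t0; case: ifPn => [ae|de].
  by apply: nxt_unique => // k /andP[ek ke]; move: (leq_trans ek ke); rewrite ltnn.
have [n1 n2 n3] := nxtP D e.+1 t0; apply: nxt_unique => //; first exact: ltnW.
move=> k /andP[]; rewrite leq_eqVlt => /orP[/eqP <- //|ek kn].
by apply: n3; rewrite ek.
Qed.

Lemma prv_alive e t : alive_at e t -> prv e t = e.
Proof. by case: e => [|e] ae /=; rewrite ?ae. Qed.

Lemma prvS e t : ~~ alive_at e.+1 t -> prv e.+1 t = prv e t.
Proof. by move=> de; rewrite /= (negbTE de). Qed.

(** Regrouping by waves, as [b] is constant on each of them. The last wave may extend beyond front
    [e]; the additional term collects its excess fronts. *)
Lemma sum_by_waves (a b : nat -> R) e t : 0 <= t -> (forall j, b j = b (prv j t)) ->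
  \sum_(l < e.+1 | alive_at l t) (\sum_(l <= j < nxt l t) a j) * b l =
  \sum_(j < e.+1) a j * b j + (\sum_(e.+1 <= j < nxt e t) a j) * b e.
Proof.
move=> t0 bP; elim: e => [|e IH].
  have [n1 _ _] := nxtP D 0 t0.
  by rewrite big_mkcond !big_ord1 /= big_ltn// mulrDl.
rewrite big_mkcond [LHS]big_ord_recr -big_mkcond /= {}IH [in RHS]big_ord_recr /= (nxtS e t0).
have [n1 n2 n3] := nxtP D e.+1 t0.
have [ae|de] := boolP (alive_at e.+1 t).
  by rewrite (big_geq (leqnn _)) mul0r addr0 (big_ltn n1) mulrDl addrA.
rewrite addr0 (big_ltn n1) mulrDl addrA.
by have -> : b e = b e.+1 by rewrite bP (bP e.+1) prvS.
Qed.

(** Distinct waves absorb disjoint label intervals, and the living regions between them only add to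
    the right-hand side. *)
Lemma wmass_sum_telescope e t : 0 < t ->
  \sum_(l < e.+1 | alive_at l t) wmass l (nxt l t) t <=
  emass D (nxt e t) (z e t) t - emass D 0 (z 0 t) t.
Proof.
move=> t0; have t0' := ltW t0; elim: e => [|e IH].
  by rewrite big_mkcond big_ord1 alive_at0 /wmass front_pathE.
rewrite big_mkcond big_ord_recr -big_mkcond /=.
move: IH; rewrite (nxtS e t0'); have [ae|de] := boolP (alive_at e.+1 t) => IH.
  have h : emass D e.+1 (z e t) t <= emass D e.+1 (z e.+1 t) t.
    rewrite -subr_ge0 emassB subrr mul0r subr0 mulr_ge0 ?subr_ge0 ?front_posS//.
    by rewrite /edens; case: odd => //; exact: ltW (pcrho_gt0 D _).
  by rewrite {2}/wmass front_pathE//; lra.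
by rewrite addr0 -(dead_atS t0' de).
Qed.

Lemma wmass_sum_bnd e t : 0 < t ->
  \sum_(l < e.+1 | alive_at l t) wmass l (nxt l t) t <=
  rhomax D * (Y e./2 - Y 0 + 4 * (t * M)).
Proof.
move=> t0; have t0' := ltW t0; apply: le_trans (wmass_sum_telescope e t0) _.
have M0 := umax_ge0 D; have tM : 0 <= t * M by exact: mulr_ge0.
have B0 : 0 <= rhomax D by apply: le_trans (ltW (pcrho_gt0 D 0)) (pcrho_le D 0).
have [n1 n2 n3] := nxtP D e t0'.
have r1 : in_reg D (nxt e t) (z e t) t.
  split; last by apply: front_pos_mono => //; exact: ltnW.
  by right; rewrite front_nxt.
have a1 : alive_reg D (nxt e t) t by exact/alive_atP.
have [c1 _] := region_edge t0' a1 r1.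
have r0 : in_reg D 0 (z 0 t) t by split; [left|].
have a0 : alive_reg D 0 t by left.
have [c0 _] := region_edge t0' a0 r0.
have /andP[_ h1] := argmin_bnd t0' (region_argmin t0' a1 r1).
have /andP[h0 _] := argmin_bnd t0' (region_argmin t0' a0 r0).
have /andP[_ h2] := front_pos_bnd D e t0'.
have /andP[h3 _] := front_pos_bnd D 0 t0'.
have hY : Y 0 <= Y e./2 by exact: node_le.
have [yy|yy] := leP (edge D 0 (z 0 t) t) (edge D (nxt e t) (z e t) t).
  apply: le_trans (mass_rhomax c0 c1 yy) _; rewrite ler_wpM2l//.
  rewrite /= in h3; lra.
have := mass_le c1 c0 (ltW yy); rewrite -subr_le0 => h.
apply: le_trans h _; apply: mulr_ge0 => //; lra.
Qed.

End WaveSums.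

(** * Values of the representation inside and outside the strips *)

Section StripValues.
Variables (R : realType) (D : pcdata R) (eps : R).
Hypothesis eps0 : 0 < eps.
Local Notation Y := (node D).
Local Notation rs := (pcrho D).
Local Notation us := (pcu D).
Local Notation M := (umax D).
Local Notation z := (front_pos D).
Local Notation alive_at := (alive_at D).
Local Notation path := (front_path D).
Local Notation wmass := (wmass D).
Local Notation wmom := (wmom D).
Local Notation wave_ok := (wave_ok D).
Local Notation wave_of := (wave_of D).
Local Notation birth_time := (birth_time D).
Local Notation contact := (contact D).
Local Notation inside := (inside D).
Local Notation nxt := (nxt D).
Local Notation speed := (front_speed D).
Implicit Types (x y t s : R) (e k l r j n : nat).

(** At a given time a wave is named by its left region: [l] stands for the wave [(l, nxt l t)]. *)
Definition active l t : bool := alive_at l t && ~~ contact l (nxt l t).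

Definition strip_radius l t : R :=
  eps / 2 * (t - birth_time l (nxt l t)) + wave_x D l (nxt l t) eps.

Lemma alive_wave l t : 0 < t -> alive_at l t ->
  wave_ok (l, nxt l t) /\ alive (wave_of l (nxt l t)) t.
Proof. by move=> t0 al; have := front_wave D l t0; rewrite (prv_alive al). Qed.

Lemma strip_radius_bnd l t tau : 0 < t -> t <= tau -> alive_at l t ->
  0 < strip_radius l t /\ strip_radius l t <= eps * (tau + 2) / 2.
Proof.
move=> t0 tt al; have [ok [b _]] := alive_wave t0 al; rewrite /= in b.
have e0 : 0 < eps := eps0; have b0 := birth_time_ge0 D l (nxt l t).
rewrite /strip_radius /wave_x; case: eqP => [->|/eqP bn].
  by rewrite subr0 addr0; split; [rewrite mulr_gt0 ?divr_gt0|nra].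
have bb : 0 <= t - birth_time l (nxt l t) by rewrite subr_ge0.
have := mulr_ge0 (ltW e0) bb; split; nra.
Qed.

Lemma wave_width l t : width eps (wave_of l (nxt l t)) t = 2 * strip_radius l t.
Proof. by rewrite /width /strip_radius /=; field. Qed.

Lemma strip_iff l r x t : 0 < t -> wave_ok (l, r) /\ strip eps (wave_of l r) t x <->
  [/\ active l t, r = nxt l t & `|x - z l t| < strip_radius l t].
Proof.
move=> t0; split.
- move=> [ok [sh al]]; have lr := wave_ok_lt ok.
  have ll : (l <= l < r)%N by rewrite leqnn.
  have [_ n1] := wave_prv_nxt ok t0 al ll.
  have [a1 _ _] := wave_alive_regions ok t0 al.
  rewrite (wave_z (ltW t0) ok (alive_life al)) => h.
  by split; [rewrite /active a1 n1|rewrite n1|rewrite /strip_radius n1].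
- move=> [/andP[al nc] -> h]; have [ok alv] := alive_wave t0 al.
  split => //; split => //.
  by rewrite (wave_z (ltW t0) ok (alive_life alv)).
Qed.

Lemma in_strip_iff x t : 0 < t -> (exists n, in_strip D eps n x t) <->
  exists2 l, active l t & `|x - z l t| < strip_radius l t.
Proof.
move=> t0; split.
- by move=> [n [ok st]]; have [a _ h] := (iffLR (strip_iff _ _ _ t0) (conj ok st)); eexists; [exact: a|].
- move=> [l a h]; have [ok st] := iffRL (strip_iff l (nxt l t) x t0) (And3 a erefl h).
  have [n nE] := wave_index_front (mkfront ok).
  by exists n; rewrite /in_strip nE /=.
Qed.

Lemma strip_values x t : 0 < t -> (exists n, in_strip D eps n x t) ->
  exists l, [/\ active l t, `|x - z l t| < strip_radius l t,
    rho_eps D eps x t = wmass l (nxt l t) t / (2 * strip_radius l t) &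
    u_eps D eps x t = speed l t].
Proof.
move=> t0 [n st]; have [n' [st' E]] := piecewise_strip t0 st.
move: st'; rewrite /in_strip.
rewrite /rho_eps /u_eps !E; case: (wave_index n') => l r /= st'.
have [a rE h] := iffLR (strip_iff l r x t0) st'; exists l.
have [al nc] := andP a; have [ok alv] := alive_wave t0 al.
split => //.
- have := wave_strengthE ok (alive_life alv) t0; rewrite /= rE => ->.
  by have := wave_width l t; rewrite /width /= => ->.
- by rewrite rE /front_speed (prv_alive al).
Qed.

Lemma region_values x t : 0 < t -> (forall n, ~ in_strip D eps n x t) ->
  (forall e, z e t != x) ->
  exists k, [/\ inside k x t, rho_eps D eps x t = edens D k &
    u_eps D eps x t = region_velocity D k x t].
Proof.
move=> t0 ns nz; have [k ins] := inside_exists t0 nz; exists k.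
by split => //; rewrite /rho_eps /u_eps (piecewise_region t0 ns ins).
Qed.

Lemma active_mass l t : 0 < t -> active l t ->
  [/\ 0 <= wmass l (nxt l t) t, `|speed l t| <= M &
   wmass l (nxt l t) t * speed l t = wmom l (nxt l t) t].
Proof.
move=> t0 /andP[al nc]; have [ok alv] := alive_wave t0 al; have lf := alive_life alv.
split; [|exact: front_speed_bnd|].
- by have := wave_strength_ge0 ok lf; rewrite (wave_strengthE ok lf t0).
- have := wave_momentum ok lf t0; rewrite (wave_strengthE ok lf t0) /=.
  by rewrite /front_speed (prv_alive al).
Qed.

Lemma inactive_mass l t : 0 < t -> alive_at l t -> ~~ active l t ->
  wmass l (nxt l t) t = 0 /\ wmom l (nxt l t) t = 0.
Proof.
move=> t0 al; rewrite /active al /= negbK => c; have [ok alv] := alive_wave t0 al.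
have cl := life_cluster ok (alive_life alv) t0; have lr := wave_ok_lt ok.
have w0 := contact_wmass0 t0 lr c cl; split => //.
by apply/eqP; rewrite -normr_le0; have := wmom_le (ltW t0) lr cl; rewrite w0 mulr0.
Qed.

End StripValues.

Section LineIntegrals.
Variable R : realType.
Local Notation mu := (@lebesgue_measure R).

Lemma Rintegral_bigsum (I : Type) (s : seq I) (P : pred I) (h : I -> R -> R) (B : set R) :
  measurable B -> (forall i, P i -> mu.-integrable B (EFin \o h i)) ->
  mu.-integrable B (EFin \o (fun x => \sum_(i <- s | P i) h i x)) /\
  \int[mu]_(x in B) (\sum_(i <- s | P i) h i x) = \sum_(i <- s | P i) \int[mu]_(x in B) h i x.
Proof.
move=> mB ih; elim: s => [|i s [IH1 IH2]].
  have -> : (fun x => \sum_(i <- [::] | P i) h i x) = cst 0 by apply/funext => x; rewrite big_nil.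
  split; last by rewrite big_nil /Rintegral integral0.
  exact: (integrable0 mu B).
have [Pi|nPi] := boolP (P i); last first.
  have -> : (fun x => \sum_(i <- i :: s | P i) h i x) = (fun x => \sum_(i <- s | P i) h i x).
    by apply/funext => x; rewrite big_cons (negbTE nPi).
  by rewrite big_cons (negbTE nPi).
have -> : (fun x => \sum_(i <- i :: s | P i) h i x) = (fun x => h i x + \sum_(i <- s | P i) h i x).
  by apply/funext => x; rewrite big_cons Pi.
split.
  have H := integrableD (mu := mu) mB (ih i Pi) IH1.
  by apply: (eq_integrable (mu := mu) mB _ _ _ H) => x _; rewrite /= EFinD.
by rewrite big_cons Pi -IH2 RintegralD//; exact: ih.
Qed.

Lemma integrable_patch (h : R -> R) (S : set R) : measurable S ->
  mu.-integrable S (EFin \o h) -> mu.-integrable setT (EFin \o (h \_ S)).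
Proof.
move=> mS ih; have -> : EFin \o (h \_ S) = (EFin \o h) \_ S.
  by apply/funext => x; rewrite /= !patchE; case: ifP.
have H := iffLR (integrable_mkcond (mu := mu) (EFin \o h) mS); exact: H.
Qed.

Lemma Rintegral_patch (h : R -> R) (S : set R) :
  \int[mu]_x (h \_ S) x = \int[mu]_(x in S) h x.
Proof. by rewrite -Rintegral_mkcond. Qed.

Lemma Rintegral_dist_le (B N : set R) (h g e : R -> R) : measurable B -> measurable N ->
  mu N = 0%E -> mu.-integrable B (EFin \o h) -> mu.-integrable B (EFin \o g) ->
  mu.-integrable B (EFin \o e) -> (forall x, B x -> ~ N x -> `|h x - g x| <= e x) ->
  `|\int[mu]_(x in B) h x - \int[mu]_(x in B) g x| <= \int[mu]_(x in B) e x.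
Proof.
move=> mB mN N0 ih ig ie H.
have off k : mu.-integrable B (EFin \o k) ->
    \int[mu]_(x in B) k x = \int[mu]_(x in B `\` N) k x.
  by move=> ik; rewrite /Rintegral (negligible_integral (mu := mu) mN mB ik N0).
have mBN : measurable (B `\` N) by exact: measurableD.
have sub : B `\` N `<=` B by move=> x [].
have ih' := integrableS (mu := mu) mB mBN sub ih; have ig' := integrableS (mu := mu) mB mBN sub ig.
have ie' := integrableS (mu := mu) mB mBN sub ie.
rewrite (off _ ih) (off _ ig) (off _ ie) -(RintegralB (mu := mu) mBN ih' ig').
have id : mu.-integrable (B `\` N) (EFin \o (fun x => h x - g x)).
  have Hd := integrableB (mu := mu) mBN ih' ig'.
  by apply: (eq_integrable (mu := mu) mBN _ _ _ Hd) => x _; rewrite /= EFinB.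
apply: le_trans (le_normr_Rintegral (mu := mu) mBN id) _.
apply: (@le_Rintegral _ _ _ mu (B `\` N) (fun x => `|h x - g x|) e) => //.
  exact: integrable_norm id.
by move=> x [Bx Nx]; exact: H.
Qed.

Lemma seq_null (s : seq R) : measurable [set` s] /\ mu [set` s] = 0%E.
Proof.
split; last exact: countable_lebesgue_measure0 (finite_set_countable (finite_seq s)).
elim: s => [|c s IH].
  have -> : [set` ([::] : seq R)] = set0 by apply/seteqP; split.
  exact: measurable0.
have -> : [set` c :: s] = [set c] `|` [set` s].
  apply/seteqP; split => t /=; rewrite inE.
    by move=> /orP[/eqP ->|]; [left|right].
  by move=> [->|->]; rewrite ?eqxx ?orbT.
by apply: measurableU => //; exact: measurable_set1.
Qed.

End LineIntegrals.

Lemma primitive_deriv (R : realType) (f fx ft fxx fxt : R -> R -> R) (A K K' : R) x t :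
  c1_data f fx ft A K -> c1_data fx fxx fxt A K' -> primitive fx x t = f x t.
Proof.
move=> cd cdx; pose a := Num.min x (- A - 1).
have ax : a <= x by rewrite ge_min lexx.
have aA w : w <= a -> A < `|w|.
  move=> wa; have : w <= - A - 1 by apply: le_trans wa _; rewrite ge_min lexx orbT.
  by move=> h; rewrite ltNge ler_norml negb_and -ltNge; apply/orP; left; lra.
have dg w : is_derive w (1 : R) (fun w => primitive fx w t - f w t) 0.
  rewrite -(subrr (fx w t)).
  exact: (is_deriveB (primitive_dx cdx w t) (c1_dx cd w t)).
have cg : continuous (fun w => primitive fx w t - f w t).
  by move=> w; exact: is_derive_continuous (dg w).
have := derive0_const (s := [::]) ax cg (fun w _ _ _ => dg w).
have -> : f a t = 0 by rewrite (c1_van cd)// aA.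
have -> : primitive fx a t = 0.
  rewrite /primitive /Rintegral (@eq_integral _ _ _ _ _ (cst 0%E)) ?integral0// => w.
  by rewrite inE /= in_itv /= => wa; rewrite (c1_van cdx)// aA.
by rewrite subr0 => /eqP; rewrite eq_sym subr_eq0 => /eqP.
Qed.

(** * Weak formulation *)

Section Slice.
Variables (R : realType) (D : pcdata R) (eps : R).
Hypothesis eps0 : 0 < eps.
Local Notation mu := (@lebesgue_measure R).
Local Notation Y := (node D).
Local Notation rs := (pcrho D).
Local Notation us := (pcu D).
Local Notation M := (umax D).
Local Notation z := (front_pos D).
Local Notation alive_at := (alive_at D).
Local Notation path := (front_path D).
Local Notation wmass := (wmass D).
Local Notation inside := (inside D).
Local Notation nxt := (nxt D).
Local Notation speed := (front_speed D).
Local Notation active := (active D).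
Local Notation radius := (strip_radius D eps).
Variables (f fx ft fxx fxt ftx ftt : R -> R -> R) (A K : R).
Hypothesis cd : c1_data f fx ft A K.
Hypothesis cdx : c1_data fx fxx fxt A K.
Hypothesis cdt : c1_data ft ftx ftt A K.
Variables (pw : bool) (m : nat) (t tau : R).
Hypothesis t_gt0 : 0 < t.
Hypothesis t_le : t <= tau.
(** A bound for the width of all strips up to time [tau]. The next hypothesis puts front [m.*2] and
    its strip beyond the support of the test function. *)
Let h := eps * (tau + 2).
Hypothesis far : A + h < z m.*2 t.
Implicit Types (x y s v : R) (e k l r j i : nat).

(* [pw] selects the balance law: momentum ([true]) or mass ([false]). *)
Definition weight v : R := if pw then v else 1.

Definition balance_integrand x s : R :=
  rho_eps D eps x s * weight (u_eps D eps x s) * (ft x s + u_eps D eps x s * fx x s).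

Let psi x v := ft x t + v * fx x t.
Let K1 := K * (1 + M).
Let M1 := 1 + M.

Let M0 : 0 <= M. Proof. exact: umax_ge0. Qed.
Let K0 : 0 < K. Proof. exact: c1_K cd. Qed.
Let K10 : 0 <= K1. Proof. by have := M0; have := K0; rewrite /K1 => ? ?; apply: mulr_ge0; lra. Qed.
Let B0 : 0 < rhomax D. Proof. exact: lt_le_trans (pcrho_gt0 D 0) (pcrho_le D 0). Qed.
Let h0 : 0 < h.
Proof. by have e0 : 0 < eps := eps0; have := t_gt0; have := t_le => ? ?; apply: mulr_gt0 => //; lra. Qed.

Lemma weight_bnd v : `|v| <= M -> `|weight v| <= M1.
Proof. by have := M0; rewrite /weight /M1 => ? ?; case: pw; rewrite ?normr1; lra. Qed.

Let psi_bnd x v : `|v| <= M -> `|psi x v| <= K1.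
Proof.
move=> vM; rewrite /psi /K1 mulrDr mulr1; apply: le_trans (ler_normD _ _) _.
have [_ b1 b2] := c1_bnd cd x t; rewrite normrM mulrC; apply: lerD => //.
by apply: ler_pM.
Qed.

Let psi_lip x y v : `|v| <= M -> `|psi x v - psi y v| <= K1 * `|x - y|.
Proof.
move=> vM; have -> : psi x v - psi y v = (ft x t - ft y t) + v * (fx x t - fx y t).
  by rewrite /psi; ring.
apply: le_trans (ler_normD _ _) _; rewrite normrM.
have b1 := c1_lipschitz cdt y x t; have b2 := c1_lipschitz cdx y x t.
have : `|v| * `|fx x t - fx y t| <= M * (K * `|x - y|) by apply: ler_pM.
by rewrite /K1; lra.
Qed.

Let psi_out x v : A < `|x| -> psi x v = 0.
Proof. by move=> xA; rewrite /psi (c1_vanx cd) ?xA// (c1_vant cd) ?xA// mulr0 addr0. Qed.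

Definition region_set i : set R :=
  if i is i'.+1 then `]z i'.*2.+1 t, z i'.+1.*2 t]%classic else `]-oo, z 0 t]%classic.

Let psi_integrable v (B : set R) : measurable B -> mu.-integrable B (EFin \o psi^~ v).
Proof.
move=> mB; have i1 := c1_integrable cdt t mB; have i2 := c1_integrable cdx t mB.
have H := integrableD (mu := mu) mB i1 (integrableZl (mu := mu) mB v i2).
by apply: (eq_integrable (mu := mu) mB _ _ _ H) => x _; rewrite /= EFinD EFinM.
Qed.

Let psi_primitive v x : \int[mu]_(w in `]-oo, x]) psi w v = primitive ft x t + v * f x t.
Proof.
have mI : measurable (`]-oo, x]%classic : set R) by exact: measurable_itv.
have i1 := c1_integrable cdt t mI; have i2 := c1_integrable cdx t mI.
rewrite /psi RintegralD//; last exact: (integrableZl (mu := mu) mI v i2).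
by rewrite RintegralZl// -(primitive_deriv x t cd cdx).
Qed.

Let measurable_region i : measurable (region_set i).
Proof. by case: i => [|i]; exact: measurable_itv. Qed.

Let region_integral i v : \int[mu]_(w in region_set i) psi w v =
  primitive ft (z i.*2 t) t + v * f (z i.*2 t) t -
  (if i is i'.+1 then primitive ft (z i'.*2.+1 t) t + v * f (z i'.*2.+1 t) t else 0).
Proof.
case: i => [|i]; first by rewrite subr0 psi_primitive.
rewrite -!psi_primitive Rintegral_itvB//; first exact: psi_integrable.
by rewrite bnd_simp; apply: front_pos_mono; [exact: ltW|rewrite doubleS].
Qed.

Definition front_weight e : R := weight (us (uphalf e)) * jump_dens D e.

(** Summation by parts: the two fronts that bound a constant region carry opposite weights. *)
Lemma flux_region_part : - \sum_(e < m.*2.+1) front_weight e *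
    (primitive ft (path e t) t + us (uphalf e) * f (path e t) t) =
  \sum_(i < m.+1) rs i * weight (us i) * \int[mu]_(w in region_set i) psi w (us i).
Proof.
have E e (eo : ~~ odd e) : front_weight e = - (rs e./2 * weight (us e./2)).
  by rewrite /front_weight /jump_dens /edens /= uphalf_half (negbTE eo) /= add0n; ring.
have O e (eo : odd e) : front_weight e = rs e./2.+1 * weight (us e./2.+1).
  by rewrite /front_weight /jump_dens /edens /= uphalf_half eo /= add1n; ring.
have t0 := ltW t_gt0.
elim: m => [|k IH].
  by rewrite !big_ord1 region_integral /= E//= front_pathE//=; ring.
rewrite doubleS big_ord_recr big_ord_recr [RHS]big_ord_recr region_integral -IH /=.
have o1 : odd k.*2.+1 by rewrite /= odd_double.
have e2 : ~~ odd k.*2.+2 by rewrite /= negbK odd_double.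
rewrite (O _ o1) (E _ e2) /= !uphalf_double /= !doubleK !front_pathE //.
by ring.
Qed.

Lemma flux_wave_part : \sum_(e < m.*2.+1) weight (us (uphalf e)) * xi D e t * psi (path e t) (speed e t) =
  \sum_(l < m.*2.+1 | active l t) wmass l (nxt l t) t * weight (speed l t) * psi (z l t) (speed l t).
Proof.
have t0 := ltW t_gt0; have hh := h0.
have bP j : psi (z j t) (speed j t) = psi (z (prv D j t) t) (speed (prv D j t) t).
  have [p1 p2 p3] := prvP D j t; have [n1 n2 n3] := nxtP D j t0.
  have [q1 q2] : prv D (prv D j t) t = prv D j t /\ nxt (prv D j t) t = nxt j t.
    apply: prv_nxt_eq => //; first by rewrite leqnn (leq_ltn_trans p1 n1).
    move=> k /andP[pk kn]; have [kj|jk] := leqP k j; first by apply: p3; rewrite pk.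
    by apply: n3; rewrite jk.
  by rewrite front_prv// /front_speed q1 q2.
(* The wave through front [m.*2] may contain fronts that are not summed; it lies beyond the
   support. *)
have last0 : psi (z m.*2 t) (speed m.*2 t) = 0.
  by apply: psi_out; apply: lt_le_trans (ler_norm _); move: far; lra.
have := sum_by_waves (fun j => weight (us (uphalf j)) * xi D j t) m.*2 t0 bP.
rewrite last0 mulr0 addr0 => S.
rewrite (eq_bigr (fun e : 'I_m.*2.+1 =>
  weight (us (uphalf e)) * xi D e t * psi (z e t) (speed e t))); last first.
  by move=> e _; rewrite front_pathE.
rewrite -S big_mkcond [RHS]big_mkcond /=; apply: eq_bigr => l _.
case: ifPn => al; last by rewrite /active (negbTE al).
have [ok alv] := alive_wave t_gt0 al; have lf := alive_life alv.
have cl := life_cluster ok lf t_gt0; have lr := wave_ok_lt ok.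
case: ifPn => ac.
- congr (_ * _); have [_ _ am] := active_mass t_gt0 ac.
  rewrite /weight; case: pw; first by rewrite sum_xi_mom.
  by under eq_bigr do rewrite mul1r; rewrite sum_xi// mulr1.
- have [w0 w1] := inactive_mass t_gt0 al ac.
  rewrite [X in X * _](_ : _ = 0) ?mul0r// /weight; case: pw; first by rewrite sum_xi_mom.
  by under eq_bigr do rewrite mul1r; rewrite sum_xi.
Qed.

Lemma flux_split : \sum_(e < m.*2.+1) front_weight e * front_flux D f fx ft e t =
  \sum_(i < m.+1) rs i * weight (us i) * \int[mu]_(w in region_set i) psi w (us i) +
  \sum_(l < m.*2.+1 | active l t) wmass l (nxt l t) t * weight (speed l t) * psi (z l t) (speed l t).
Proof.
rewrite -flux_region_part -flux_wave_part addrC -sumrB; apply: eq_bigr => e _.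
by rewrite /front_weight /front_flux xiE /psi; ring.
Qed.

Let amp l := wmass l (nxt l t) t / (2 * radius l t) * weight (speed l t).

Let strip_set l : set R := `]z l t - radius l t, z l t + radius l t[%classic.

Let regf x := \sum_(i < m.+1)
  ((fun w => rs i * weight (us i) * psi w (us i)) \_ (region_set i)) x.

Let stripf x := \sum_(l < m.*2.+1 | active l t)
  ((fun=> amp l * psi (z l t) (speed l t)) \_ (strip_set l)) x.

Let radius_bnd l : active l t -> 0 < radius l t /\ radius l t <= h / 2.
Proof. by move=> /andP[al _]; exact: strip_radius_bnd. Qed.

Let speed_bnd l : `|speed l t| <= M. Proof. exact: front_speed_bnd. Qed.

Let region_disjoint i j x : (i < j)%N -> region_set i x -> ~ region_set j x.
Proof.
move=> ij; have hi : region_set i x -> x <= z i.*2 t.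
  by case: i ij => [|i] _ /=; rewrite in_itv //= => /andP[].
move=> /hi xi; case: j ij => // j ij /=; rewrite in_itv /= => /andP[xj _].
have : z i.*2 t <= z j.*2.+1 t.
  by apply: front_pos_mono; [exact: ltW|rewrite leqW// leq_double].
by move=> zz; have := lt_le_trans xj (le_trans xi zz); rewrite ltxx.
Qed.

Let regf_at i x : (i < m.+1)%N -> region_set i x ->
  regf x = rs i * weight (us i) * psi x (us i).
Proof.
move=> im ri; rewrite /regf (bigD1 (Ordinal im))//= big1 ?addr0.
  by rewrite patchE mem_set.
move=> j /eqP ji; rewrite patchE memNset// => rj.
have [ij|ji'|e] := ltngtP i j; first exact: region_disjoint ij ri rj.
  exact: region_disjoint ji' rj ri.
by apply: ji; apply: val_inj.
Qed.

Let regf_out x : (forall i, (i < m.+1)%N -> ~ region_set i x) -> regf x = 0.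
Proof. by move=> H; rewrite /regf big1// => i _; rewrite patchE memNset//; exact: H. Qed.

Let region_term_bnd i x : `|rs i * weight (us i) * psi x (us i)| <= rhomax D * M1 * K1.
Proof.
rewrite !normrM; apply: ler_pM => //; last exact/psi_bnd/pcu_le.
apply: ler_pM => //; last exact/weight_bnd/pcu_le.
by rewrite gtr0_norm ?pcrho_gt0// pcrho_le.
Qed.

Let regf_bnd x : `|regf x| <= rhomax D * M1 * K1.
Proof.
have [[i [im ri]]|ne] := pselect (exists i, (i < m.+1)%N /\ region_set i x).
  by rewrite (regf_at im ri); exact: region_term_bnd.
rewrite regf_out ?normr0; last by move=> i im ri; apply: ne; exists i.
exact: le_trans (normr_ge0 _) (region_term_bnd 0 x).
Qed.

Let patch_strip (c : R) l x :
  ((fun=> c) \_ (strip_set l)) x = if `|x - z l t| < radius l t then c else 0.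
Proof.
rewrite patchE; have -> : (x \in strip_set l) = (`|x - z l t| < radius l t) => //.
by rewrite mem_setE in_itv /= ltr_distl.
Qed.

Let inside_region k x : ~~ odd k -> inside k x t -> region_set k./2 x.
Proof.
move=> ek [k0 kz]; have kE := odd_double_half k; rewrite (negbTE ek) add0n in kE.
move: k0 kz; rewrite -{1 2 3}kE; case: k./2 => [|j] /=; rewrite in_itv /=; first by move=> _ /ltW.
by move=> [//|->] /ltW ->.
Qed.

(** Error for a unit of mass. If strips are well separated, only the displacement inside one strip
    counts and gives [K1 * h]; otherwise [2 * K1] allows for masses that the representation does not
    show at all. *)
Variable kap : R.
Hypothesis kapP : kap = 2 * K1 \/ (kap = K1 * h /\ forall l l', active l t -> active l' t ->
  (l < l')%N -> (l' < m.*2.+1)%N -> h <= z l' t - z l t).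

Let kap0 : 0 <= kap.
Proof.
by have k1 := K10; case: kapP => [->|[-> _]]; [rewrite mulr_ge0|rewrite mulr_ge0// ltW// h0].
Qed.

Let errf x := \sum_(l < m.*2.+1 | active l t)
  ((fun=> rhomax D * M1 * K1 + `|amp l| * kap) \_ (strip_set l)) x.

Let hit l x := active l t && (`|x - z l t| < radius l t).

Let stripfE x : stripf x = \sum_(l < m.*2.+1 | hit l x) amp l * psi (z l t) (speed l t).
Proof. by rewrite /stripf [RHS]big_mkcondr; apply: eq_bigr => l _; rewrite patch_strip. Qed.

Let errfE x : errf x = \sum_(l < m.*2.+1 | hit l x) (rhomax D * M1 * K1 + `|amp l| * kap).
Proof. by rewrite /errf [RHS]big_mkcondr; apply: eq_bigr => l _; rewrite patch_strip. Qed.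

Let BMK0 : 0 <= rhomax D * M1 * K1.
Proof. exact: le_trans (normr_ge0 _) (regf_bnd 0). Qed.

(** [regf] extends the constant regions underneath the strips, which costs [rhomax D * M1 * K1]
    there. [stripf] adds up all strips even where the representation shows only one of them; this is
    paid by [kap]. *)
Lemma slice_pointwise x : (forall e, (e < m.*2.+1)%N -> z e t != x) ->
  `|balance_integrand x t - (regf x + stripf x)| <= errf x.
Proof.
move=> xz; have t0 := ltW t_gt0; have hp := h0; have kap_ge0 := kap0; have bmk0 := BMK0.
have K1_ge0 := K10.
have close l : hit l x -> `|x - z l t| <= h / 2.
  by move=> /andP[ac xl]; have [_ r2] := radius_bnd ac; lra.
(* Outside the support a strip term may persist, because the test function is evaluated at the
   center of the strip. *)
have [xA|xA] := ltP A `|x|.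
  have -> : balance_integrand x t = 0.
    by rewrite /balance_integrand (c1_vanx cd) ?xA// (c1_vant cd) ?xA// mulr0 addr0 mulr0.
  have -> : regf x = 0.
    have [[i [im ri]]|ne] := pselect (exists i, (i < m.+1)%N /\ region_set i x).
      by rewrite (regf_at im ri) psi_out// mulr0.
    by rewrite regf_out// => i im ri; apply: ne; exists i.
  rewrite !add0r normrN stripfE errfE.
  apply: le_trans (ler_norm_sum _ _ _) _; apply: ler_sum => l hl.
  apply: (@le_trans _ _ (`|amp l| * kap)); last by lra.
  rewrite normrM ler_wpM2l//; case: kapP => [->|[-> _]].
    by have := psi_bnd (z l t) (speed_bnd l); lra.
  have := psi_lip (z l t) x (speed_bnd l); rewrite (psi_out _ xA) subr0 distrC => p.
  apply: le_trans p _; rewrite ler_wpM2l//; have := close l hl; lra.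
have zmx : x < z m.*2 t by have := ler_norm x; move: far; lra.
have lt_m e : z e t <= x + h -> (e < m.*2.+1)%N.
  move=> ex; rewrite ltnS leqNgt; apply/negP => me.
  have := front_pos_mono D t0 (ltnW me); have := ler_norm x; move: far; lra.
have xz' e : z e t != x.
  have [|me] := ltnP e m.*2.+1; first exact: xz.
  have zz := front_pos_mono D t0 (ltnW me); rewrite gt_eqF//; exact: lt_le_trans zmx zz.
have [[l hl]|nh] := pselect (exists l, hit l x); last first.
  have ns n : ~ in_strip D eps n x t.
    move=> st; have [l ac xl] := iffLR (in_strip_iff D eps x t_gt0) (ex_intro _ n st).
    by apply: nh; exists l; rewrite /hit ac.
  rewrite stripfE errfE big1 => [|l hl]; last by exfalso; apply: nh; exists l.
  rewrite big1 => [|l hl]; last by exfalso; apply: nh; exists l.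
  have [k [ins rE uE]] := region_values t_gt0 ns xz'.
  have km : (k <= m.*2)%N.
    rewrite leqNgt; apply/negP => mk; case: ins => [[k0|kx] _].
      by move: mk; rewrite k0.
    have : z m.*2 t <= z k.-1 t by apply: front_pos_mono => //; rewrite -ltnS (ltn_predK mk).
    lra.
  rewrite addr0 /balance_integrand rE uE /edens /region_velocity.
  case ok : (odd k).
    rewrite !mul0r sub0r normrN regf_out ?normr0// => i im ri.
    have [ik|ki] := leqP i.*2 k.
      have ik' : (i.*2 <= k.-1)%N.
        by move: ik; rewrite leq_eqVlt => /orP[/eqP e|]; [move: ok; rewrite -e odd_double|case: (k)].
      have zx : z k.-1 t < x by case: ins => [[k0|//] _]; move: ok; rewrite k0.
      have xi : x <= z i.*2 t by case: i {im ik ik'} ri => [|i] /=; rewrite in_itv //= => /andP[].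
      by have := front_pos_mono D t0 ik'; lra.
    case: i im ri ki => // i im /=; rewrite in_itv /= => /andP[zx _] ki.
    have : z k t <= z i.*2.+1 t by apply: front_pos_mono => //; rewrite doubleS !ltnS in ki.
    by case: ins => _; lra.
  have im : (k./2 < m.+1)%N by rewrite ltnS -(doubleK m) half_leq.
  rewrite (regf_at im) ?subrr ?normr0//; apply: inside_region ins; exact: negbT.
have [l' [ac' xl' rE uE]] : exists l, [/\ active l t, `|x - z l t| < radius l t,
    rho_eps D eps x t = wmass l (nxt l t) t / (2 * radius l t) & u_eps D eps x t = speed l t].
  apply: (strip_values t_gt0); apply: (iffRL (in_strip_iff D eps x t_gt0)).
  by exists l; case/andP: hl.
have hl' : hit l' x by rewrite /hit ac'.
have lm : (l' < m.*2.+1)%N.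
  by apply: lt_m; have := close _ hl'; rewrite ler_distl => /andP[? ?]; lra.
have -> : balance_integrand x t = amp l' * psi x (speed l' t).
  by rewrite /balance_integrand rE uE /amp /psi.
have rb := regf_bnd x.
rewrite stripfE errfE; case: kapP => [kE|[kE gap]].
  rewrite (bigD1 (Ordinal lm))//= [X in _ <= X](bigD1 (Ordinal lm))//=.
  set S1 := \sum_(i < _ | _) _; set S2 := \sum_(i < _ | _) _.
  have S12 : `|S1| <= S2.
    apply: le_trans (ler_norm_sum _ _ _) _; apply: ler_sum => j _.
    rewrite normrM; apply: (@le_trans _ _ (`|amp j| * kap)); last by lra.
    by rewrite ler_wpM2l// kE; have := psi_bnd (z j t) (speed_bnd j); lra.
  have p1 : `|amp l' * psi x (speed l' t)| <= `|amp l'| * K1.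
    by rewrite normrM ler_wpM2l//; exact: psi_bnd.
  have p2 : `|amp l' * psi (z l' t) (speed l' t)| <= `|amp l'| * K1.
    by rewrite normrM ler_wpM2l//; exact: psi_bnd.
  have -> : `|amp l'| * kap = `|amp l'| * K1 + `|amp l'| * K1 by rewrite kE; ring.
  move: p1 p2 S12 rb; rewrite !ler_norml => /andP[? ?] /andP[? ?] /andP[? ?] /andP[? ?].
  by apply/andP; split; lra.
have only (j : 'I_m.*2.+1) : hit j x -> j = Ordinal lm.
  move=> hj; apply: val_inj => /=; have := close _ hl'; have := close _ hj.
  have [aj _] := andP hj; rewrite !ler_distl => /andP[c1 c2] /andP[c3 c4].
  have hx : `|x - z j t| < h / 2.
    have [r0 r1] := radius_bnd aj; have [_ xj] := andP hj; exact: lt_le_trans xj r1.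
  have hx' : `|x - z l' t| < h / 2.
    have [r0 r1] := radius_bnd ac'; exact: lt_le_trans xl' r1.
  move: hx hx'; rewrite !ltr_distl => /andP[? ?] /andP[? ?].
  have [jl|lj|//] := ltngtP (j : nat) l'.
    by exfalso; have := gap _ _ aj ac' jl lm; lra.
  by exfalso; have := gap _ _ ac' aj lj (ltn_ord j); lra.
have single (a : nat -> R) : \sum_(j < m.*2.+1 | hit j x) a j = a l'.
  rewrite (bigD1 (Ordinal lm))//= big1 ?addr0// => j /andP[hj]; rewrite (only j hj) eqxx //.
rewrite (single (fun l => amp l * psi (z l t) (speed l t))).
rewrite (single (fun l => rhomax D * M1 * K1 + `|amp l| * kap)).
have p : `|amp l' * (psi x (speed l' t) - psi (z l' t) (speed l' t))| <= `|amp l'| * kap.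
  rewrite normrM ler_wpM2l// kE; apply: le_trans (psi_lip _ _ (speed_bnd l')) _.
  by rewrite ler_wpM2l//; have := close _ hl'; lra.
move: p rb; rewrite mulrBr !ler_norml => /andP[? ?] /andP[? ?].
by apply/andP; split; lra.
Qed.

Let strip_mu l : active l t -> mu (strip_set l) = (2 * radius l t)%:E.
Proof.
move=> ac; have [r0 _] := radius_bnd ac.
have rr : z l t - radius l t < z l t + radius l t by lra.
by rewrite /strip_set lebesgue_measure_itv /= lte_fin rr -EFinB; congr (_%:E); ring.
Qed.

Let measurable_strip l : measurable (strip_set l).
Proof. exact: measurable_itv. Qed.

Let strip_integral c l : active l t ->
  mu.-integrable setT (EFin \o ((fun=> c) \_ (strip_set l))) /\
  \int[mu]_x (((fun=> c) \_ (strip_set l)) x) = c * (2 * radius l t).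
Proof.
move=> ac; split.
  have ms := measurable_strip l; apply: integrable_patch => //.
  have fin : (mu (strip_set l) < +oo)%E by rewrite strip_mu// ltry.
  apply: (measurable_bounded_integrable _ fin) => //.
  by exists `|c|; split; [exact: num_real|move=> w Kw x _; exact: ltW].
rewrite Rintegral_patch Rintegral_cst//; last exact: measurable_strip.
by congr (_ * _); have := strip_mu ac; rewrite /= => ->.
Qed.

Let region_term_integral i :
  mu.-integrable setT (EFin \o ((fun w => rs i * weight (us i) * psi w (us i)) \_ (region_set i))) /\
  \int[mu]_x (((fun w => rs i * weight (us i) * psi w (us i)) \_ (region_set i)) x) =
  rs i * weight (us i) * \int[mu]_(w in region_set i) psi w (us i).
Proof.
have mr := measurable_region i; have ip := psi_integrable (us i) (measurable_region i); split.
  apply: integrable_patch => //.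
  have Hz := integrableZl (mu := mu) (measurable_region i) (rs i * weight (us i)) ip.
  by apply: (eq_integrable (mu := mu) (measurable_region i) _ _ _ Hz) => x _; rewrite /= -EFinM.
by rewrite Rintegral_patch RintegralZl.
Qed.

Lemma measurable_balance_integrand :
  measurable_fun setT (fun p : R * R => balance_integrand p.1 p.2).
Proof.
have mr := measurable_rho_eps D eps0; have mU := measurable_u_eps D eps0.
have mx := measurable_jointly_continuous (c1_contx cd).
have mt := measurable_jointly_continuous (c1_contt cd).
apply: measurable_funM; last by apply: measurable_funD => //; exact: measurable_funM.
by apply: measurable_funM => //; rewrite /weight; case: pw.
Qed.

Lemma balance_integrand_bnd : exists K2, forall x s, s <= tau -> `|balance_integrand x s| <= K2.
Proof.
have tau0 : 0 <= tau by move: t_gt0 t_le => ? ?; lra.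
have [Kr rb] := rho_eps_bnd D eps0 tau0; exists (Kr * M1 * K1) => x s st.
have ub := u_eps_bnd D eps x s.
rewrite /balance_integrand !normrM; apply: ler_pM => //.
  apply: ler_pM => //; last exact: weight_bnd.
  by rewrite ger0_norm ?rb// rho_eps_ge0.
have [_ b1 b2] := c1_bnd cd x s; apply: le_trans (ler_normD _ _) _; rewrite normrM.
by rewrite /K1 mulrDr mulr1 [K * M]mulrC; apply: lerD => //; apply: ler_pM.
Qed.

Lemma slice_integrable s : s <= tau -> mu.-integrable setT (EFin \o (balance_integrand^~ s)).
Proof.
move=> st; have [K2 b] := balance_integrand_bnd.
apply: (@bounded_support_integrable _ _ A K2) => //.
- have mp : measurable_fun setT (fun x : R => (x, s)).
    by apply: measurable_fun_pair; [exact: measurable_id|exact: measurable_cst].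
  exact: measurableT_comp measurable_balance_integrand mp.
- by move=> x xA; rewrite /balance_integrand (c1_vanx cd) ?xA// (c1_vant cd) ?xA// mulr0 addr0 mulr0.
- by move=> x; exact: b.
Qed.

(** Integrating [errf]: amplitude times width gives back the masses, whose total is bounded by
    [wmass_sum_bnd], and the extended regions cost at most [h] for each strip. *)
Lemma slice_estimate :
  `|\int[mu]_x balance_integrand x t -
    \sum_(e < m.*2.+1) front_weight e * front_flux D f fx ft e t| <=
  m.*2.+1%:R * (h * (rhomax D * M1 * K1)) + kap * M1 * (rhomax D * (Y m - Y 0 + 4 * (t * M))).
Proof.
have [ir er] := @Rintegral_bigsum R _ (index_enum 'I_m.+1) xpredT
  (fun i : 'I_m.+1 => (fun w => rs i * weight (us i) * psi w (us i)) \_ (region_set i)) setT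
  measurableT (fun (i : 'I_m.+1) _ => (region_term_integral i).1).
have [is1 es] := @Rintegral_bigsum R _ (index_enum 'I_m.*2.+1) (fun l : 'I_m.*2.+1 => active l t)
  (fun l : 'I_m.*2.+1 => (fun=> amp l * psi (z l t) (speed l t)) \_ (strip_set l)) setT
  measurableT (fun (l : 'I_m.*2.+1) ac => (strip_integral _ ac).1).
have [ie ee] := @Rintegral_bigsum R _ (index_enum 'I_m.*2.+1) (fun l : 'I_m.*2.+1 => active l t)
  (fun l : 'I_m.*2.+1 => (fun=> rhomax D * M1 * K1 + `|amp l| * kap) \_ (strip_set l)) setT
  measurableT (fun (l : 'I_m.*2.+1) ac => (strip_integral _ ac).1).
have ampE l : active l t -> amp l * (2 * radius l t) = wmass l (nxt l t) t * weight (speed l t).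
  move=> ac; have [r0 _] := radius_bnd ac; rewrite /amp mulrAC divfK// gt_eqF//.
  by rewrite mulr_gt0.
have -> : \sum_(e < m.*2.+1) front_weight e * front_flux D f fx ft e t =
    \int[mu]_x (regf x + stripf x).
  rewrite flux_split RintegralD// /regf er es; congr (_ + _).
    by apply: eq_bigr => i _; rewrite (region_term_integral i).2.
  apply: eq_bigr => l ac; rewrite (strip_integral _ ac).2 -ampE//; ring.
have [mN N0] := seq_null [seq z e t | e <- iota 0 m.*2.+1].
have irs : mu.-integrable setT (EFin \o (fun x => regf x + stripf x)).
  have Hs := integrableD (mu := mu) measurableT ir is1.
  by apply: (eq_integrable (mu := mu) measurableT _ _ _ Hs) => x _; rewrite /= EFinD.
apply: le_trans (Rintegral_dist_le measurableT mN N0 (slice_integrable t_le) irs ie _) _.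
  move=> x _ xN; apply: slice_pointwise => e em; apply/eqP => ze; apply: xN.
  by apply/mapP; exists e => //; rewrite mem_iota.
rewrite ee; have bmk0 := BMK0; have kap_ge0 := kap0; have hp := h0.
apply: (@le_trans _ _ (\sum_(l < m.*2.+1 | active l t)
   (h * (rhomax D * M1 * K1) + kap * M1 * wmass l (nxt l t) t))).
  apply: ler_sum => l ac; rewrite (strip_integral _ ac).2 mulrDl.
  have [r0 r1] := radius_bnd ac; have [w0 _ _] := active_mass t_gt0 ac.
  apply: lerD; first by rewrite mulrC ler_wpM2r//; lra.
  have -> : `|amp l| * kap * (2 * radius l t) = kap * `|amp l * (2 * radius l t)|.
    have r2 : 0 < 2 * radius l t by rewrite mulr_gt0.
    by rewrite (normrM (amp l) (2 * radius l t)) (gtr0_norm r2); ring.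
  rewrite ampE// -mulrA ler_wpM2l// normrM (ger0_norm w0) mulrC.
  by rewrite ler_wpM2r//; exact: weight_bnd (speed_bnd l).
rewrite big_split /=; apply: lerD.
  rewrite big_mkcond /=; have -> : m.*2.+1%:R * (h * (rhomax D * M1 * K1)) =
      \sum_(l < m.*2.+1) h * (rhomax D * M1 * K1) :> R.
    by rewrite sumr_const card_ord mulr_natl.
  apply: ler_sum => l _; case: ifP => // _; exact: mulr_ge0 (ltW hp) bmk0.
rewrite -mulr_sumr; apply: ler_wpM2l; first by have := M0; rewrite /M1 => ?; apply: mulr_ge0 => //; lra.
have := wmass_sum_bnd D m.*2 t_gt0; rewrite doubleK; apply: le_trans.
rewrite big_mkcond [X in _ <= X]big_mkcond /=; apply: ler_sum => l _.
case: ifPn => [ac|nac]; first by have /andP[-> _] := ac.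
case: ifPn => // al; by have [-> _] := inactive_mass t_gt0 al nac.
Qed.

End Slice.

(** Sets of bad times are controlled through their diameter and replaced by intervals, so their own
    measurability does not enter. *)
Lemma covering_interval (R : realType) (S : set R) (lam : R) : (forall t, S t -> 0 < t) ->
  (forall s t, S s -> S t -> s <= t -> t - s <= lam) ->
  exists c, forall t, S t -> c <= t /\ t <= c + lam.
Proof.
move=> S0 Sd; have [[s Ss]|ne] := pselect (exists s, S s); last first.
  by exists 0 => t St; exfalso; apply: ne; exists t.
have hi : has_inf S by split; [exists s|exists 0 => t /S0 /ltW].
exists (inf S) => t St; split; first by apply: ge_inf => //; case: hi.
rewrite -lerBlDr; apply: lb_le_inf; first by exists s.
move=> w Sw; have [wt|/ltW tw] := leP w t; first by have := Sd _ _ Sw St wt; lra.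
have lam0 : 0 <= lam by have := Sd _ _ St St (lexx t); rewrite subrr.
lra.
Qed.

(** * Times at which strips may overlap *)

Section Gaps.
Variables (R : realType) (D : pcdata R).
Local Notation M := (umax D).
Local Notation z := (front_pos D).
Local Notation alive_at := (alive_at D).
Local Notation active := (active D).
Variables (h tau : R).
Hypothesis h_gt0 : 0 < h.
Hypothesis h_small : h <= minstep D / 2.
Implicit Types (t s : R) (l i : nat).

(** The index starts at [i.+1] because region 0 extends to minus infinity. *)
Definition narrow_const i : set R := [set t | 0 < t /\ t <= tau /\
  alive_at i.+1.*2 t /\ z i.+1.*2 t - z i.*2.+1 t < h].

(** Next to a living neighbour the edge of a vacuum is a contact and has no strip; the dangerous
    case is a vacuum between two shadow waves. *)
Definition narrow_vac i : set R := [set t | 0 < t /\ t <= tau /\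
  [/\ alive_at i.*2.+1 t, ~~ alive_at i.*2 t, ~~ alive_at i.+1.*2 t &
      z i.*2.+1 t - z i.*2 t < h]].

Definition narrow_length : R := tau * (8 * h) / minstep D.

Lemma narrow_const_cover i : exists c, forall t, narrow_const i t ->
  c <= t /\ t <= c + narrow_length.
Proof.
apply: covering_interval => [t []//|s t [s0 [stau [_ gs]]] [t0 [ttau [alt _]]] st].
have d0 := minstep_gt0 D; rewrite /narrow_length ler_pdivlMr//.
apply: le_trans (const_gap_time s0 st alt h_gt0 h_small gs) _.
by rewrite ler_wpM2r// mulr_ge0// ltW.
Qed.

Lemma narrow_vac_cover i : exists c, forall t, narrow_vac i t ->
  c <= t /\ t <= c + narrow_length.
Proof.
apply: covering_interval => [t []//|s t [s0 [stau [_ d1 d2 gs]]] [t0 [ttau [alt _ _ _]]] st].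
have d0 := minstep_gt0 D; rewrite /narrow_length ler_pdivlMr//.
apply: le_trans (vac_gap_time s0 st alt d1 d2 h_gt0 h_small gs) _.
by rewrite ler_wpM2r// mulr_ge0// ltW.
Qed.

Definition well_spaced m t : Prop := forall l l', active l t -> active l' t ->
  (l < l')%N -> (l' < m.*2.+1)%N -> h <= z l' t - z l t.

(** If two shadow waves are close, the left region of the second one lies between them and is
    narrow. If it is a vacuum whose left neighbour is alive, the front between them is a contact, so
    that this constant neighbour also lies between the two waves. *)
Lemma well_spaced_or_narrow m t : 0 < t -> t <= tau ->
  well_spaced m t \/ exists2 i, (i < m)%N & narrow_const i t \/ narrow_vac i t.
Proof.
move=> t0 tt; have t0' := ltW t0.
have [|bad] := pselect (exists2 i, (i < m)%N & narrow_const i t \/ narrow_vac i t); first by right.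
left=> l l' al al' ll' l'm; rewrite leNgt; apply/negP => gap; apply: bad.
have [a1 nc1] := andP al; have [a2 nc2] := andP al'.
have no_contact k : active k t -> ~~ alive_at k.+1 t.
  move=> /andP[ak nck]; apply/negP => ak1; move/negP: nck; apply.
  by rewrite (nxtS D k t0') ak1 /contact eqxx.
have zm e e' : (e <= e')%N -> z e t <= z e' t by exact: front_pos_mono.
have [[l'E _]|[l'E _]] := half_cases l'.
- move: l'E a2 ll' l'm gap; case: l'./2 => [|i] -> a2 ll' l'm gap; first by rewrite ltn0 in ll'.
  exists i; first by rewrite ltnS leq_double in l'm.
  left; split => //; split => //; split => //.
  have li : (l <= i.*2.+1)%N by rewrite doubleS ltnS in ll'.
  by have := zm _ _ li; lra.
- set i := l'./2 in l'E; have dn := no_contact _ al'.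
  move: a2 ll' l'm gap dn; rewrite l'E => a2 ll' l'm gap dn.
  have im : (i < m)%N by rewrite ltnS in l'm; rewrite -ltn_double (leq_trans _ l'm).
  have [ai|di] := boolP (alive_at i.*2 t); last first.
    exists i => //; right; split => //; split => //; split => //.
    have li : (l <= i.*2)%N by [].
    by have := zm _ _ li; lra.
  have li : (l < i.*2)%N.
    move: ll'; rewrite ltnS leq_eqVlt => /orP[/eqP le|//].
    by have := no_contact _ al; rewrite le a2.
  case: i {l'E} li im ai a2 gap ll' l'm dn => [|i] li im ai a2 gap ll' l'm dn.
    by rewrite ltn0 in li.
  exists i; first exact: ltnW.
  left; split => //; split => //; split => //.
  have li' : (l <= i.*2.+1)%N by rewrite doubleS ltnS in li.
  have := zm _ _ li'; have := zm i.+1.*2 i.+1.*2.+1 (leqnSn _); lra.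
Qed.

End Gaps.

Section PlaneIntegrals.
Variable R : realType.
Local Notation mu := (@lebesgue_measure R).

Lemma plane_integrable (g : R * R -> R) (A K : R) (B : set (R * R)) : measurable B ->
  measurable_fun setT g -> (forall p, B p -> (A < `|p.1|) || (A < `|p.2|) -> g p = 0) ->
  (forall p, B p -> `|g p| <= K) -> (mu \x mu)%E.-integrable B (EFin \o g).
Proof.
move=> mB mg g0 gK; pose I : set R := `[- A, A]%classic.
have mI : measurable I by exact: measurable_itv.
have mII : measurable (I `*` I) by exact: measurableX.
have fI : (mu I < +oo)%E.
  by rewrite /I lebesgue_measure_itv /=; case: ifP => _; rewrite ?ltry// -EFinB ltry.
have fII : ((mu \x mu)%E (I `*` I) < +oo)%E.
  have muI : mu I \is a fin_num by rewrite ge0_fin_numE.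
  by rewrite product_measure1E// lte_mul_pinfty.
have mS : measurable (B `&` (I `*` I)) by exact: measurableI.
have fin : ((mu \x mu)%E (B `&` (I `*` I)) < +oo)%E.
  by apply: le_lt_trans fII; apply: le_measure; rewrite ?inE//; exact: subIsetr.
have iS : (mu \x mu)%E.-integrable (B `&` (I `*` I)) (EFin \o g).
  apply: (measurable_bounded_integrable _ fin) => //; first exact: measurable_funTS.
  exists K; split; first exact: num_real.
  by move=> k Kk x [Bx _]; apply: le_trans (ltW Kk); exact: gK.
have E : (EFin \o g) \_ B = (EFin \o g) \_ (B `&` (I `*` I)).
  apply/funext => p; rewrite !patchE in_setI; case: (boolP (p \in B)) => //= pB.
  case: ifPn => // pI; rewrite /= g0//; first by move: pB; rewrite inE.
  move: pI; rewrite notin_setE /= /I /= !in_itv /= -!ler_norml => H.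
  by rewrite !ltNge -negb_and; apply/negP => /andP[h1 h2]; apply: H.
apply: (iffRL (integrable_mkcond (mu := (mu \x mu)%E) (EFin \o g) mB)).
rewrite E; exact: (iffLR (integrable_mkcond (mu := (mu \x mu)%E) (EFin \o g) mS)).
Qed.

Lemma Rintegral_itv_cst (c a b : R) : a <= b ->
  mu.-integrable `[a, b] (EFin \o (fun=> c)) /\ \int[mu]_(x in `[a, b]) c = c * (b - a).
Proof.
move=> ab; have muE : (mu `[a, b]%classic = (b - a)%:E)%E.
  rewrite lebesgue_measure_itv /= lte_fin.
  by move: ab; rewrite le_eqVlt => /orP[/eqP ->|ab']; rewrite ?ltxx ?subrr// ab'.
have fin : (mu `[a, b]%classic < +oo)%E by rewrite muE ltry.
split.
  apply: (measurable_bounded_integrable _ fin) => //.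
  by exists `|c|; split; [exact: num_real|move=> w Kw x _; exact: ltW].
by rewrite Rintegral_cst//; congr (_ * _); rewrite -[LHS]/(fine (mu `[a, b]%classic)) muE.
Qed.

(** Fubini provides measurability of the slice integrals; their bound follows from the common
    support. *)
Lemma slices_integrable (g : R -> R -> R) (A K tau : R) : 0 <= A ->
  measurable_fun setT (fun p : R * R => g p.1 p.2) ->
  (forall x t, A < `|x| -> g x t = 0) -> (forall x t, 0 <= t -> t <= tau -> `|g x t| <= K) ->
  mu.-integrable `[0, tau] (EFin \o (fun t => \int[mu]_x g x t)).
Proof.
move=> A0 mg g0 gK.
pose B : set (R * R) := setT `*` `[0, tau]%classic.
have mB : measurable B by apply: measurableX; [exact: measurableT|exact: measurable_itv].
have iB : (mu \x mu)%E.-integrable B (EFin \o (fun p => g p.1 p.2)).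
  apply: (@plane_integrable _ (Num.max A tau) K) => //.
    move=> [x t] [_ /=]; rewrite in_itv /= => /andP[t0 tt] /orP[|].
      by rewrite gt_max => /andP[xA _]; exact: g0.
    by rewrite gt_max ger0_norm// => /andP[_]; rewrite ltNge tt.
  by move=> [x t] [_ /=]; rewrite in_itv /= => /andP[t0 tt]; exact: gK.
have iT := iffLR (integrable_mkcond (mu := (mu \x mu)%E) (EFin \o (fun p : R * R => g p.1 p.2)) mB) iB.
have mG := measurable_fubini_G iT.
have mT : measurable (`[0, tau]%classic : set R) by exact: measurable_itv.
have fin : (mu `[0%R, tau]%classic < +oo)%E.
  by rewrite lebesgue_measure_itv /=; case: ifP => _; rewrite ?ltry// -EFinB ltry.
apply: (measurable_bounded_integrable _ fin) => //.
- have mF : measurable_fun (`[0, tau]%classic : set R)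
      (fine \o fubini_G mu ((EFin \o (fun p : R * R => g p.1 p.2)) \_ B)).
    by apply: measurable_funTS; exact: measurableT_comp.
  apply: eq_measurable_fun mF => t; rewrite inE => tI.
  rewrite /= /fubini_G /Rintegral; congr fine; apply: eq_integral => x _.
  by rewrite patchE mem_set.
- exists (K * (A - - A)); split; first exact: num_real.
  move=> w Kw t /=; rewrite in_itv /= => /andP[t0 tt]; apply: le_trans (ltW Kw).
  have AA : - A <= A by lra.
  have -> : \int[mu]_x g x t = \int[mu]_(x in `[- A, A]) g x t.
    rewrite [RHS]Rintegral_mkcond; apply: eq_Rintegral => x _; rewrite patchE.
    by case: ifPn => //; rewrite notin_setE /= in_itv /= -ler_norml => /negP; rewrite -ltNge => /g0.
  have [ic ec] := Rintegral_itv_cst K AA; rewrite -ec.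
  have mA : measurable (`[- A, A]%classic : set R) by exact: measurable_itv.
  have ig : mu.-integrable `[- A, A] (EFin \o g^~ t).
    have mp : measurable_fun setT (fun x : R => (x, t)).
      by apply: measurable_fun_pair; [exact: measurable_id|exact: measurable_cst].
    apply: (@bounded_support_integrable _ _ A K) => //.
    - exact: measurableT_comp mg mp.
    - by move=> x xA; exact: g0.
    - by move=> x; exact: gK.
  apply: le_trans (le_normr_Rintegral (mu := mu) mA ig) _.
  apply: (@le_Rintegral _ _ _ mu _ (fun x => `|g x t|) (fun=> K)) => //.
  + exact: integrable_norm ig.
  + by move=> x _; exact: gK.
Qed.

End PlaneIntegrals.

(** * Total error in the weak formulation *)

Section WeakForm.
Variables (R : realType) (D : pcdata R) (eps : R).
Hypothesis eps0 : 0 < eps.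
Local Notation mu := (@lebesgue_measure R).
Local Notation Y := (node D).
Local Notation rs := (pcrho D).
Local Notation us := (pcu D).
Local Notation M := (umax D).
Local Notation B := (rhomax D).
Local Notation z := (front_pos D).
Variables (f fx ft fxx fxt ftx ftt : R -> R -> R) (A K : R).
Hypothesis cd : c1_data f fx ft A K.
Hypothesis cdx : c1_data fx fxx fxt A K.
Hypothesis cdt : c1_data ft ftx ftt A K.
Variables (pw : bool) (m : nat) (tau : R).
Local Notation weight := (weight pw).
Let h := eps * (tau + 2).
Hypothesis A0 : 0 <= A.
Hypothesis A_tau : A < tau.
Hypothesis h_small : h <= minstep D / 2.
Hypothesis far : A + h < Y m - tau * M.
Let K1 := K * (1 + M).
Let M1 := 1 + M.
Implicit Types (x t s v : R) (e k l i : nat).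
Local Notation balance := (balance_integrand D eps fx ft pw).
Local Notation fw := (front_weight D pw).

Let M0 : 0 <= M. Proof. exact: umax_ge0. Qed.
Let tau0 : 0 < tau. Proof. exact: le_lt_trans A0 A_tau. Qed.
Let h0 : 0 < h. Proof. by apply: mulr_gt0 => //; rewrite ltr_wpDl// ltW. Qed.
Let K10 : 0 <= K1.
Proof. by have m0 := M0; have k0 := c1_K cd; rewrite /K1; apply: mulr_ge0; lra. Qed.
Let B0 : 0 <= B. Proof. exact: le_trans (ltW (pcrho_gt0 D 0)) (pcrho_le D 0). Qed.

Lemma front_weight_sum (n : nat) (G : nat -> R) : - \sum_(e < n.*2.+1) fw e * G e =
  \sum_(i < n.+1) rs i * weight (us i) * (G i.*2 - (if (i : nat) is i'.+1 then G i'.*2.+1 else 0)).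
Proof.
have E e (eo : ~~ odd e) : fw e = - (rs e./2 * weight (us e./2)).
  by rewrite /front_weight /jump_dens /edens /= uphalf_half (negbTE eo) /= add0n; ring.
have O e (eo : odd e) : fw e = rs e./2.+1 * weight (us e./2.+1).
  by rewrite /front_weight /jump_dens /edens /= uphalf_half eo /= add1n; ring.
elim: n => [|k IH]; first by rewrite !big_ord1 /= E//=; ring.
rewrite doubleS big_ord_recr big_ord_recr [RHS]big_ord_recr -IH /=.
have o1 : odd k.*2.+1 by rewrite /= odd_double.
have e2 : ~~ odd k.*2.+2 by rewrite /= negbK odd_double.
by rewrite (O _ o1) (E _ e2) /= !uphalf_double /= !doubleK //; ring.
Qed.

Definition cell_set i : set R :=
  if i is i'.+1 then `]Y i', Y i]%classic else `]-oo, Y 0]%classic.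

Let cell_disjoint i j x : (i < j)%N -> cell_set i x -> ~ cell_set j x.
Proof.
move=> ij; have hi : cell_set i x -> x <= Y i.
  by case: i ij => [|i] _ /=; rewrite in_itv //= => /andP[].
move=> /hi xi; case: j ij => // j ij /=; rewrite in_itv /= => /andP[xj _].
have : Y i <= Y j by exact: node_le.
by move=> zz; have := lt_le_trans xj (le_trans xi zz); rewrite ltxx.
Qed.

Let measurable_cell i : measurable (cell_set i).
Proof. by case: i => [|i]; exact: measurable_itv. Qed.

Lemma initial_states x : exists i,
  [/\ cell_set i x, rho_eps D eps x 0 = rs i & u_eps D eps x 0 = us i].
Proof.
have [n xn] := node_unbounded D x.
have ex : exists n, x <= Y n by exists n; exact: ltW.
case: (ex_minnP ex) => i xi imin; exists i.
have il : i = 0%N \/ Y i.-1 < x.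
  case: i xi imin => [|i] xi imin; [by left | right => /=].
  by rewrite ltNge; apply/negP => /imin; rewrite ltnn.
split.
- by case: i xi imin il => [|i] xi _ il /=; rewrite in_itv /= xi// andbT; case: il.
- by rewrite /rho_eps (piecewise_initial eps0 (lexx 0) il xi).
- by rewrite /u_eps (piecewise_initial eps0 (lexx 0) il xi).
Qed.

Let cell_term_integral i :
  mu.-integrable setT (EFin \o ((fun w => rs i * weight (us i) * f w 0) \_ (cell_set i))) /\
  \int[mu]_x (((fun w => rs i * weight (us i) * f w 0) \_ (cell_set i)) x) =
  rs i * weight (us i) * (primitive f (Y i) 0 - (if i is i'.+1 then primitive f (Y i') 0 else 0)).
Proof.
have mr := measurable_cell i; have ip := c1_integrable cd 0 mr; split.
  apply: integrable_patch => //.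
  have Hz := integrableZl (mu := mu) mr (rs i * weight (us i)) ip.
  by apply: (eq_integrable (mu := mu) mr _ _ _ Hz) => x _; rewrite /= -EFinM.
rewrite Rintegral_patch RintegralZl//; congr (_ * _).
case: i {mr ip} => [|i]; first by rewrite subr0.
rewrite /primitive Rintegral_itvB//; first exact: (c1_integrable cd 0 (measurable_itv _)).
by rewrite bnd_simp; exact: node_le.
Qed.

Lemma initial_integral : \int[mu]_x (rho_eps D eps x 0 * weight (u_eps D eps x 0) * f x 0) =
  - \sum_(e < m.*2.+1) fw e * primitive f (Y e./2) 0.
Proof.
rewrite (front_weight_sum m (fun e => primitive f (Y e./2) 0)).
have [ir er] := @Rintegral_bigsum R _ (index_enum 'I_m.+1) xpredT
  (fun i : 'I_m.+1 => (fun w => rs i * weight (us i) * f w 0) \_ (cell_set i)) setT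
  measurableT (fun (i : 'I_m.+1) _ => (cell_term_integral i).1).
transitivity (\int[mu]_x \sum_(i < m.+1) ((fun w => rs i * weight (us i) * f w 0) \_ (cell_set i)) x).
  apply: eq_Rintegral => x _; have [i [ci -> ->]] := initial_states x.
  have [im|mi] := ltnP i m.+1.
    rewrite (bigD1 (Ordinal im))//= big1 ?addr0; first by rewrite patchE mem_set.
    move=> j /eqP ji; rewrite patchE memNset// => cj.
    have [ij|ji'|e] := ltngtP i j; first exact: cell_disjoint ij ci cj.
      exact: cell_disjoint ji' cj ci.
    by apply: ji; apply: val_inj.
  have f0 : f x 0 = 0.
    rewrite (c1_van cd)//; apply/orP; left; apply: lt_le_trans (ler_norm _).
    case: i mi ci => // i mi /=; rewrite in_itv /= => /andP[xi _].
    have : Y m <= Y i by exact: node_le.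
    have tm : 0 <= tau * M by rewrite mulr_ge0// ltW.
    by have := h0; move: far; lra.
  by rewrite f0 mulr0 big1// => j _; rewrite patchE f0 mulr0; case: ifP.
rewrite er; apply: eq_bigr => i _; rewrite (cell_term_integral i).2 doubleK.
by case: (nat_of_ord i) => //= i'; rewrite uphalf_double.
Qed.

(** First the separated estimate over the whole of [[0, tau]], then the crude one on [m] intervals
    for constant regions and [m] for vacuums, each of length [narrow_length]. *)
Definition weak_bound : R :=
  let L := B * (Y m - Y 0 + 4 * (tau * M)) in
  tau * (m.*2.+1%:R * (h * (B * M1 * K1)) + K1 * h * M1 * L) +
  2 * (m%:R * (2 * K1 * M1 * L * narrow_length D h tau)).

Let space_integral t := \int[mu]_x balance x t.

Let space_integral_integrable : mu.-integrable `[0, tau] (EFin \o space_integral).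
Proof.
have [K2 b] := balance_integrand_bnd D eps0 cd pw tau0 (lexx tau).
apply: (@slices_integrable _ _ A K2 tau) => //.
- exact: (measurable_balance_integrand D eps0 cd pw).
- by move=> x t xA; rewrite /balance_integrand (c1_vanx cd) ?xA// (c1_vant cd) ?xA// mulr0 addr0 mulr0.
- by move=> x t _; exact: b.
Qed.

Lemma weak_form_le :
  `|\int[mu]_(t in `[0, +oo[) (\int[mu]_x balance x t) +
    \int[mu]_x (rho_eps D eps x 0 * weight (u_eps D eps x 0) * f x 0)| <= weak_bound.
Proof.
have K10' := K10; have B0' := B0; have M0' := M0; have h0' := h0; have tau0' := tau0.
have M10 : 0 <= M1 by rewrite /M1; lra.
pose T : set R := `[0, tau]%classic.
have mT : measurable T by exact: measurable_itv.
have [s [mF [KF bF] eF]] := front_balance D cd cdt m.*2.+1 fw tau0 A_tau.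
rewrite initial_integral -eF.
set E := [set t | _] in mF bF eF *; set F := (fun t => _) in mF bF eF *.
have -> : \int[mu]_(t in `[0, +oo[) (\int[mu]_x balance x t) = \int[mu]_t (space_integral \_ T) t.
  rewrite Rintegral_mkcond; apply: eq_Rintegral => t _; rewrite !patchE /T.
  have -> : (t \in `[0, tau]%classic) = (0 <= t) && (t <= tau) by rewrite mem_setE in_itv.
  have -> : (t \in `[0, +oo[%classic) = (0 <= t) by rewrite mem_setE in_itv /= andbT.
  case: (leP 0 t) => //= t0; case: leP => // tt.
  rewrite /Rintegral (@eq_integral _ _ _ mu setT (cst 0%E)) ?integral0// => x _.
  have tA : A < `|t| by rewrite ger0_norm//; exact: lt_trans A_tau tt.
  by rewrite /balance_integrand (c1_vanx cd) ?tA ?orbT// (c1_vant cd) ?tA ?orbT// mulr0 addr0 mulr0.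
rewrite -[\int[mu]_(t in `[0, tau]) _](Rintegral_patch (F \_ E) T).
have iF : mu.-integrable setT (EFin \o ((F \_ E) \_ T)).
  apply: integrable_patch => //.
  have fin : (mu T < +oo)%E.
    by rewrite /T lebesgue_measure_itv /=; case: ifP => _; rewrite ?ltry// -EFinB ltry.
  apply: (measurable_bounded_integrable _ fin) => //; first exact: measurable_funTS.
  exists KF; split; first exact: num_real.
  by move=> w Kw t _; apply: le_trans (ltW Kw); exact: bF.
have iI := integrable_patch mT space_integral_integrable.
pose L := B * (Y m - Y 0 + 4 * (tau * M)).
have L0 : 0 <= L.
  by apply: mulr_ge0 => //; have : Y 0 <= Y m by [exact: node_le]; have := mulr_ge0 (ltW tau0') M0'; lra.
pose cA := m.*2.+1%:R * (h * (B * M1 * K1)) + K1 * h * M1 * L.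
pose cB := 2 * K1 * M1 * L; pose lam := narrow_length D h tau.
have lam0 : 0 <= lam.
  by rewrite /lam /narrow_length divr_ge0 ?(ltW (minstep_gt0 D))//; apply: mulr_ge0; lra.
have h0w := ltW h0'.
have q1 : 0 <= K1 * h * M1 by apply: mulr_ge0 => //; exact: mulr_ge0.
have q2 : 0 <= m.*2.+1%:R * (h * (B * M1 * K1)).
  by apply: mulr_ge0 => //; apply: mulr_ge0 => //; apply: mulr_ge0 => //; exact: mulr_ge0.
have q3 : 0 <= 2 * K1 * M1 by apply: mulr_ge0 => //; exact: mulr_ge0.
have cA0 : 0 <= cA by apply: addr_ge0 => //; exact: mulr_ge0.
have cB0 : 0 <= cB by exact: mulr_ge0.
have Jc i : {c | forall t, narrow_const D h tau i t -> c <= t /\ t <= c + lam}.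
  exact: cid (narrow_const_cover tau h0 h_small i).
have Jv i : {c | forall t, narrow_vac D h tau i t -> c <= t /\ t <= c + lam}.
  exact: cid (narrow_vac_cover tau h0 h_small i).
pose S1 i : set R := `[sval (Jc i), sval (Jc i) + lam]%classic.
pose S2 i : set R := `[sval (Jv i), sval (Jv i) + lam]%classic.
have itvE c : mu.-integrable setT (EFin \o ((fun=> cB) \_ `[c, c + lam]%classic)) /\
    \int[mu]_t (((fun=> cB) \_ `[c, c + lam]%classic) t) = cB * lam.
  have cc : c <= c + lam by lra.
  have [i1 e1] := Rintegral_itv_cst cB cc; split.
    by apply: integrable_patch => //; exact: measurable_itv.
  by rewrite Rintegral_patch e1; congr (_ * _); ring.
have [i1 e1] := @Rintegral_bigsum R _ (index_enum 'I_m) xpredT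
  (fun i : 'I_m => (fun=> cB) \_ (S1 i)) setT measurableT (fun (i : 'I_m) _ => (itvE _).1).
have [i2 e2] := @Rintegral_bigsum R _ (index_enum 'I_m) xpredT
  (fun i : 'I_m => (fun=> cB) \_ (S2 i)) setT measurableT (fun (i : 'I_m) _ => (itvE _).1).
have [iA eA] := Rintegral_itv_cst cA (ltW tau0').
have iA' := integrable_patch mT iA.
pose err t := ((fun=> cA) \_ T) t + (\sum_(i < m) ((fun=> cB) \_ (S1 i)) t +
  \sum_(i < m) ((fun=> cB) \_ (S2 i)) t).
have i12 : mu.-integrable setT (EFin \o (fun t => \sum_(i < m) ((fun=> cB) \_ (S1 i)) t +
  \sum_(i < m) ((fun=> cB) \_ (S2 i)) t)).
  have Hs := integrableD (mu := mu) measurableT i1 i2.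
  by apply: (eq_integrable (mu := mu) measurableT _ _ _ Hs) => x _; rewrite /= EFinD.
have ierr : mu.-integrable setT (EFin \o err).
  have Hs := integrableD (mu := mu) measurableT iA' i12.
  by apply: (eq_integrable (mu := mu) measurableT _ _ _ Hs) => x _; rewrite /= EFinD.
have [mN N0] := seq_null (0 :: tau :: s).
have ge0 (c : R) (S : set R) t : 0 <= c -> 0 <= ((fun=> c) \_ S) t.
  by move=> c0; rewrite patchE; case: ifP.
apply: le_trans (Rintegral_dist_le measurableT mN N0 iI iF ierr _) _; last first.
  rewrite /err RintegralD// RintegralD// e1 e2 Rintegral_patch eA subr0.
  rewrite /S1 /S2; under eq_bigr do rewrite (itvE _).2.
  under [X in _ + (_ + X)]eq_bigr do rewrite (itvE _).2.
  rewrite !sumr_const !card_ord -[_ *+ m]mulr_natl /weak_bound -/L -/cA -/cB -/lam.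
  by rewrite le_eqVlt; apply/orP; left; apply/eqP; ring.
move=> t _ tN; have S10 : 0 <= \sum_(i < m) ((fun=> cB) \_ (S1 i)) t.
  by apply: sumr_ge0 => i _; exact: ge0.
have S20 : 0 <= \sum_(i < m) ((fun=> cB) \_ (S2 i)) t.
  by apply: sumr_ge0 => i _; exact: ge0.
have PT (S : set R) (k : R -> R) : (k \_ S) t = if t \in S then k t else 0 by rewrite patchE.
rewrite /err !(PT T); case: ifPn => tT; last first.
  by rewrite subrr normr0 add0r addr_ge0.
move: tT; rewrite inE /T /= in_itv /= => /andP[t0 tt].
have {t0}t0 : 0 < t.
  by rewrite lt_neqAle t0 andbT eq_sym; apply/eqP => e; apply: tN; rewrite /= inE e eqxx.
have tt' : t < tau.
  by rewrite lt_neqAle tt andbT; apply/eqP => e; apply: tN; rewrite /= !inE e eqxx orbT.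
have Et : E t.
  split => //; split => //; apply/negP => ts; apply: tN.
  by rewrite /= !inE ts !orbT.
rewrite (PT E) mem_set//.
have farz : A + h < z m.*2 t.
  have /andP[h1 _] := front_pos_bnd D m.*2 (ltW t0); rewrite doubleK in h1.
  have : t * M <= tau * M by rewrite ler_wpM2r.
  by move: far; lra.
have Lt : B * (Y m - Y 0 + 4 * (t * M)) <= L.
  by rewrite ler_wpM2l// lerD2l ler_wpM2l// ler_wpM2r.
(* The two choices of [kap] in [slice_estimate]: [K1 * h] at well spaced times, [2 * K1] at narrow
   times, which the intervals [S1 i] and [S2 i] cover. *)
have [sp|[i im bad]] := well_spaced_or_narrow D h m t0 tt.
- have := slice_estimate eps0 cd cdx cdt pw t0 tt farz (or_intror (conj erefl sp)).
  rewrite -/h -/K1 -/M1 -/(space_integral t) => SE.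
  apply: le_trans SE _; rewrite /cA.
  have : K1 * h * M1 * (B * (Y m - Y 0 + 4 * (t * M))) <= K1 * h * M1 * L.
    by rewrite ler_wpM2l.
  lra.
- have := slice_estimate eps0 cd cdx cdt pw t0 tt farz (or_introl erefl).
  rewrite -/h -/K1 -/M1 -/(space_integral t) => SE.
  have cL : 2 * K1 * M1 * (B * (Y m - Y 0 + 4 * (t * M))) <= cB by rewrite ler_wpM2l.
  have cA1 : m.*2.+1%:R * (h * (B * M1 * K1)) <= cA by rewrite /cA lerDl; exact: mulr_ge0.
  have one (S : nat -> set R) : S i t -> cB <= \sum_(i < m) ((fun=> cB) \_ (S i)) t.
    move=> Si; rewrite (bigD1 (Ordinal im))//= patchE mem_set// lerDl.
    by apply: sumr_ge0 => j _; exact: ge0.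
  have : cB <= \sum_(i < m) ((fun=> cB) \_ (S1 i)) t + \sum_(i < m) ((fun=> cB) \_ (S2 i)) t.
    case: bad => bad.
      have : S1 i t by rewrite /S1 /= in_itv /=; apply/andP; exact: (svalP (Jc i) t bad).
      by move=> /one; lra.
    have : S2 i t by rewrite /S2 /= in_itv /=; apply/andP; exact: (svalP (Jv i) t bad).
    by move=> /one; lra.
  lra.
Qed.

End WeakForm.

(** * Convergence *)

Section Smallness.
Variable R : realType.

Lemma cvg_at_right0 (F : R -> R) (l : R) :
  (forall eta : R, 0 < eta -> exists2 e1, 0 < e1 & forall eps, 0 < eps -> eps < e1 ->
    `|l - F eps| <= eta) -> F @ 0^'+ --> l.
Proof.
move=> H; apply/cvgrPdist_le => eta eta0; have [e1 e10 He] := H eta eta0.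
near=> eps; apply: He; near: eps; [exact: nbhs_right_gt|exact: nbhs_right_lt].
Unshelve. all: by end_near. Qed.

Lemma cube_rootK (eps : R) : 0 <= eps -> (eps `^ 3^-1) ^+ 3 = eps.
Proof.
by move=> e0; rewrite -powR_mulrn ?powR_ge0// -powRrM mulVf ?pnatr_eq0// powRr1.
Qed.

Lemma cube_root_lt (eta eps : R) : 0 < eta -> 0 < eps -> eps < eta ^+ 3 -> eps `^ 3^-1 < eta.
Proof.
move=> eta0 e0 lt; rewrite ltNge; apply/negP => le.
have := lerXn2r 3 (ltW eta0 : eta \is Num.nneg) (powR_ge0 _ _ : _ \is Num.nneg) le.
by rewrite cube_rootK ?(ltW e0)// leNgt lt.
Qed.

Lemma pcdata_exists (Y r v : nat -> R) (d B M : R) : 0 < d ->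
  (forall i, d <= Y i.+1 - Y i) -> (forall i, 0 < r i) -> (forall i, r i <= B) ->
  (forall i, `|v i| <= M) -> exists D : pcdata R,
    [/\ node D = Y, pcrho D = r & pcu D = v] /\ [/\ minstep D = d, rhomax D = B & umax D = M].
Proof. by move=> h1 h2 h3 h4 h5; exists (PCData h1 h2 h3 h4 h5). Qed.

Lemma weak_bound_small (a C B M A K tau : R) : 0 <= A -> A < tau -> 0 <= K -> 0 <= B -> 0 <= M ->
  1 <= C -> exists Cst, forall (D : pcdata R) (eps : R),
    minstep D ^+ 3 = eps -> minstep D * (tau + 2) <= 2^-1 -> node D 0 = a ->
    (forall i, node D i.+1 - node D i <= C * minstep D) -> rhomax D = B -> umax D = M ->
  exists m, [/\ eps * (tau + 2) <= minstep D / 2, A + eps * (tau + 2) < node D m - tau * umax D &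
    weak_bound D eps K m tau <= Cst * minstep D].
Proof.
move=> A0 Atau K0 B0 M0 C1; have tau0 : 0 < tau by exact: le_lt_trans Atau.
pose T := tau + 2; have T2 : 2 <= T by rewrite /T; lra.
(* [m] will be the first node beyond [X]: support radius, plus 1 to cover strip widths, plus
   propagation distance. [Lm] bounds the distance from [Y 0] to it, the summand [C] covering the
   last step. *)
pose X := A + 1 + tau * M; pose Lm := `|X| + `|a| + C.
have Lm0 : 0 <= Lm by rewrite /Lm; have := normr_ge0 X; have := normr_ge0 a; lra.
pose Lb := B * (Lm + 4 * (tau * M)).
pose P := B * (1 + M) * (K * (1 + M)); pose Q := K * (1 + M) * (1 + M).
have tM : 0 <= tau * M by rewrite mulr_ge0// ltW.
have P0 : 0 <= P by rewrite /P; do !apply: mulr_ge0 => //; lra.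
have Q0 : 0 <= Q by rewrite /Q; do !apply: mulr_ge0 => //; lra.
have Lb0 : 0 <= Lb by rewrite /Lb mulr_ge0//; lra.
exists (tau * ((Lm + 1) * P + Q * Lb) + 2 * (2 * Q * Lb * (tau * 8) * (Lm * T))).
move=> D eps de dT Ya Ystep DB DM; have d0 := minstep_gt0 D.
set d := minstep D in de dT Ystep d0 *; rewrite -/T in dT *; rewrite DM.
have d2 : d * 2 <= d * T by rewrite ler_pM2l.
have d4 : d <= 4^-1 by lra.
pose h := eps * T; have hE : h = d * d * (d * T) by rewrite /h -de; ring.
have dd : d * d <= d by rewrite -{3}[d]mulr1 ler_pM2l//; lra.
have dd0 : 0 <= d * d by rewrite mulr_ge0// ltW.
have h_half : h <= d / 2.
  rewrite hE; apply: (@le_trans _ _ (d * 2^-1)) => //.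
  have dT0 : 0 <= d * T by apply: mulr_ge0; [exact: ltW|lra].
  exact: ler_pM.
have dT0 : 0 <= d * T by apply: mulr_ge0; [exact: ltW|lra].
have h0 : 0 <= h by rewrite hE mulr_ge0.
have [n Xn] := node_unbounded D X; have ex : exists n, X < node D n by exists n.
case: (ex_minnP ex) => m Xm mmin; exists m.
have Ym : node D m - node D 0 <= Lm.
  rewrite Ya; case: m Xm mmin => [|k] Xm mmin; first by rewrite Ya subrr.
  have : node D k <= X by rewrite leNgt; apply/negP => /mmin; rewrite ltnn.
  have := Ystep k; have : C * d <= C by rewrite ger_pMr; lra.
  by rewrite /Lm; have := ler_norm X; have := ler_norm (- a); rewrite normrN; lra.
have md : m%:R * d <= Lm by have := node_ge D m; rewrite -/d; lra.
have m0 : 0 <= m%:R :> R by [].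
split; first exact: h_half.
  by rewrite -/h; move: Xm; rewrite /X; lra.
rewrite /weak_bound /narrow_length DB DM -/T -/h -/d.
have YY : 0 <= node D m - node D 0 by rewrite subr_ge0 node_le.
set L := B * (node D m - node D 0 + 4 * (tau * M)).
have L0 : 0 <= L by rewrite /L mulr_ge0//; lra.
have LLb : L <= Lb by rewrite /L /Lb ler_wpM2l//; lra.
have nh : m.*2.+1%:R * h <= (Lm + 1) * d.
  rewrite -natr1 -muln2 natrM mulrDl mul1r mulrDl mul1r; apply: lerD; last lra.
  have -> : m%:R * 2 * h = (m%:R * d) * (2 * (d * T)) * d by rewrite hE; ring.
  have q1 : 0 <= m%:R * d by rewrite mulr_ge0// ltW.
  have q2 : 0 <= 2 * (d * T) by rewrite mulr_ge0.
  have q3 : 2 * (d * T) <= 1 by lra.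
  by rewrite ler_pM2r// -[leRHS]mulr1; exact: ler_pM.
have p1 : m.*2.+1%:R * (h * P) <= (Lm + 1) * P * d.
  by rewrite mulrA [leRHS]mulrAC ler_wpM2r.
have p2 : K * (1 + M) * h * (1 + M) * L <= Q * Lb * d.
  have -> : K * (1 + M) * h * (1 + M) * L = Q * (L * h) by rewrite /Q; ring.
  by rewrite -mulrA ler_wpM2l// ler_pM//; lra.
have p3 : m%:R * (2 * (K * (1 + M)) * (1 + M) * L * (tau * (8 * h) / d)) <=
    2 * Q * Lb * (tau * 8) * (Lm * T) * d.
  have -> : m%:R * (2 * (K * (1 + M)) * (1 + M) * L * (tau * (8 * h) / d)) =
     (2 * Q * (tau * 8)) * (L * ((m%:R * d) * T)) * d.
    by rewrite hE /Q; field; rewrite gt_eqF.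
  have -> : 2 * Q * Lb * (tau * 8) * (Lm * T) * d = (2 * Q * (tau * 8)) * (Lb * (Lm * T)) * d by ring.
  rewrite ler_wpM2r ?(ltW d0)// ler_wpM2l//.
    by do !apply: mulr_ge0 => //; exact: ltW.
  have T0 : 0 <= T by lra.
  apply: ler_pM => //; first by do !apply: mulr_ge0 => //; exact: ltW.
  by rewrite ler_wpM2r//; lra.
have -> : (tau * ((Lm + 1) * P + Q * Lb) + 2 * (2 * Q * Lb * (tau * 8) * (Lm * T))) * d =
  tau * ((Lm + 1) * P * d + Q * Lb * d) + 2 * (2 * Q * Lb * (tau * 8) * (Lm * T) * d) by ring.
apply: lerD; last by rewrite ler_wpM2l.
by rewrite ler_wpM2l ?(ltW tau0)// lerD.
Qed.

End Smallness.

Section Profiles.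
Variables (R : realType) (D : pcdata R).
Local Notation P := (pc_pattern D).

Lemma profile_x (d : R) (w : front P) : 0 < time0 (P w) -> prof_x (P w) d = d.
Proof. by move=> /= b; rewrite /wave_x gt_eqF. Qed.

Lemma profile_mass (d t : R) (w : front P) : 0 < d -> is_shadow (P w) -> life (P w) t ->
  strip_mass d (P w) t = strength (P w) t.
Proof.
case: w => -[l r] ok d0 /= sh [b _]; rewrite /strip_mass /= sh /width /=.
have b0 := birth_time_ge0 D l r; rewrite /= in b.
have [e|ne] := eqVneq (d * (t - birth_time D l r) + 2 * wave_x D l r d) 0; last first.
  by rewrite mulrC divfK.
rewrite e mul0r; move: e; rewrite /wave_x; case: eqP => [bE|/eqP bn] e.
  have -> : t = 0.
    by apply/eqP; move: e; rewrite bE subr0 mulr0 addr0 => /eqP; rewrite mulf_eq0 gt_eqF.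
  by rewrite wave_strength0.
have := mulr_ge0 (ltW d0) (_ : 0 <= t - birth_time D l r); rewrite subr_ge0 => /(_ b); lra.
Qed.

End Profiles.

Section InitialData.
Variable R : realType.
Local Notation mu := (@lebesgue_measure R).

Lemma bounded_pointwise_integrals (q : R -> R -> R) (g psi : R -> R) (Kq A Kp : R) :
  (forall eps, 0 < eps -> measurable_fun setT (q eps)) ->
  (forall eps x, 0 < eps -> `|q eps x| <= Kq) ->
  (forall x, q^~ x @ 0^'+ --> g x) -> continuous psi -> (forall x, A < `|x| -> psi x = 0) ->
  (forall x, `|psi x| <= Kp) ->
  (fun eps => \int[mu]_x (q eps x * psi x)) @ 0^'+ --> \int[mu]_x (g x * psi x).
Proof.
move=> mq qK qg cpsi psi0 psiK; apply/cvg_at_rightP => u [u0 uc].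
have qu x : q (u n) x @[n --> \oo] --> g x.
  by have := iffLR (cvg_at_rightP (q^~ x) 0 (g x)) (qg x); apply.
have mpsi : measurable_fun setT psi by exact: continuous_measurable_fun.
have mg : measurable_fun setT g.
  by apply: (measurable_fun_cvg (h := fun n => q (u n))) => [n|x _]; [exact: mq|exact: qu].
have Kq0 : 0 <= Kq by apply: le_trans (qK 1 0 ltr01).
have Kp0 : 0 <= Kp by apply: le_trans (psiK 0).
pose S : set R := `[- A, A]%classic.
have mS : measurable S by exact: measurable_itv.
pose G (x : R) : R := Kq * Kp * \1_S x.
have iG : mu.-integrable setT (EFin \o G).
  apply: (@bounded_support_integrable _ _ A (Kq * Kp)) => //.
  - by apply: measurable_funM => //; exact: measurable_indic.
  - move=> w wA; rewrite /G indicE memNset ?mulr0// /S /= in_itv /= -ler_norml.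
    by apply/negP; rewrite -ltNge.
  - move=> w; rewrite /G normrM (ger0_norm (mulr_ge0 Kq0 Kp0)) ler_piMr ?mulr_ge0//.
    by rewrite ger0_norm// indicE lern1 leq_b1.
have dom n x : `|q (u n) x * psi x| <= G x.
  rewrite /G indicE; case: (boolP (x \in S)) => xS /=.
    by rewrite mulr1 normrM; apply: ler_pM => //; exact: qK.
  rewrite psi0 ?mulr0 ?normr0//.
  by move: xS; rewrite notin_setE /S /= in_itv /= -ler_norml => /negP; rewrite -ltNge.
have cq x : (fun n => (q (u n) x * psi x)%:E) @ \oo --> (g x * psi x)%:E.
  apply: cvg_EFin; first exact: nearW.
  exact: cvgM (qu x) (cvg_cst (psi x)).
have [i1 _ i3] := @dominated_convergence _ _ R mu setT measurableT
  (fun n x => (q (u n) x * psi x)%:E) (fun x => (g x * psi x)%:E) (EFin \o G)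
  (fun n => iffRL (measurable_EFinP _ _) (measurable_funM (mq _ (u0 n)) mpsi))
  (iffRL (measurable_EFinP _ _) (measurable_funM mg mpsi))
  (aeW mu (fun x _ => cq x))
  iG (aeW mu (fun x n _ => dom n x)).
have e : (\int[mu]_x (g x * psi x)%:E = (\int[mu]_x (g x * psi x))%:E)%E.
  by rewrite fineK//; exact: integrable_fin_num i1.
by apply: fine_cvg; rewrite -e.
Qed.

End InitialData.

Section Convergence.
Variable R : realType.
Local Notation mu := (@lebesgue_measure R).

Lemma c1_data_weaken (f fx ft : R -> R -> R) (A K K' : R) : K <= K' ->
  c1_data f fx ft A K -> c1_data f fx ft A K'.
Proof.
move=> KK [h1 h2 h3 h4 h5 h6 h7 h8 h9 h10]; split => //; first exact: lt_le_trans KK.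
by move=> x t; have [b1 b2 b3] := h10 x t; split; exact: le_trans KK.
Qed.

Lemma test_fun2_c1 (phi : R -> R -> R) : test_fun2 phi -> exists A K, [/\ 0 <= A,
  c1_data phi (dx phi) (dt phi) A K, c1_data (dx phi) (dx (dx phi)) (dt (dx phi)) A K &
  c1_data (dt phi) (dx (dt phi)) (dt (dt phi)) A K].
Proof.
move=> [smooth [A0 vA0]]; pose A := `|A0|.
have vA : vanishes_outside A phi.
  move=> x t h; apply: vA0; have A0A : A0 <= A by exact: ler_norm.
  by case/orP: h => h; [left|right]; exact: le_lt_trans h.
have [_ [_ cx ct]] := smooth 2%N.
have [K1 c1] := @Cn2_c1 R 0 phi A (smooth 1%N) vA.
have [K2 c2] := @Cn2_c1 R 0 (dx phi) A cx (c1_vanx c1).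
have [K3 c3] := @Cn2_c1 R 0 (dt phi) A ct (c1_vant c1).
have k1 := c1_K c1; have k2 := c1_K c2; have k3 := c1_K c3.
exists A, (K1 + K2 + K3); split; first exact: normr_ge0.
- by apply: c1_data_weaken c1; lra.
- by apply: c1_data_weaken c2; lra.
- by apply: c1_data_weaken c3; lra.
Qed.

Lemma weak_form_balance (D : pcdata R) eps phi pw :
  weak_form (fun x t => rho_eps D eps x t * weight pw (u_eps D eps x t)) (u_eps D eps) phi =
  \int[mu]_(t in `[0, +oo[) (\int[mu]_x balance_integrand D eps (dx phi) (dt phi) pw x t) +
  \int[mu]_x (rho_eps D eps x 0 * weight pw (u_eps D eps x 0) * phi x 0).
Proof.
have -> : balance_integrand D eps (dx phi) (dt phi) pw =
    integrand (fun x t => rho_eps D eps x t * weight pw (u_eps D eps x t)) (u_eps D eps) phi.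
  by apply/funext => x; apply/funext => t; rewrite /integrand /balance_integrand; ring.
by [].
Qed.

Lemma balance_integrable (D : pcdata R) eps phi pw : 0 < eps -> test_fun2 phi ->
  integrable_balance (fun x t => rho_eps D eps x t * weight pw (u_eps D eps x t))
    (u_eps D eps) phi.
Proof.
move=> eps0 /test_fun2_c1[A [K [A0 c1 cx ct]]].
have tau0 : 0 < A + 1 by rewrite ltr_wpDl.
have [K2 b] := balance_integrand_bnd D eps0 c1 pw tau0 (lexx _).
have K20 : 0 <= K2 by apply: le_trans (b 0 0 (ltW tau0)).
have out (p : R * R) : (A < `|p.1|) || (A < `|p.2|) ->
    balance_integrand D eps (dx phi) (dt phi) pw p.1 p.2 = 0.
  by move=> h; rewrite /balance_integrand (c1_vanx c1)// (c1_vant c1)// mulr0 addr0 mulr0.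
have mB : measurable ((setT : set R) `*` `[0, +oo[%classic : set (R * R)).
  by apply: measurableX; [exact: measurableT|exact: measurable_itv].
have bnd (p : R * R) : `|balance_integrand D eps (dx phi) (dt phi) pw p.1 p.2| <= K2.
  have [h|h] := leP p.2 (A + 1); first exact: b.
  rewrite out ?normr0//; apply/orP; right; apply: lt_le_trans (ler_norm _).
  by apply: lt_trans h; rewrite ltrDl.
have H := plane_integrable mB (measurable_balance_integrand D eps0 c1 pw) (fun p _ => out p)
  (fun p _ => bnd p).
rewrite /integrable_balance.
apply: (eq_integrable (mu := (mu \x mu)%E) mB _ _ _ H) => p _ /=; congr (_%:E).
by rewrite /integrand /balance_integrand; ring.
Qed.

Variables (a C B M : R) (D : R -> pcdata R).
Hypothesis C1 : 1 <= C.
Hypothesis D_minstep : forall eps, 0 < eps -> minstep (D eps) = eps `^ 3^-1.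
Hypothesis D_node0 : forall eps, 0 < eps -> node (D eps) 0 = a.
Hypothesis D_step : forall eps, 0 < eps -> forall i,
  node (D eps) i.+1 - node (D eps) i <= C * minstep (D eps).
Hypothesis D_rhomax : forall eps, 0 < eps -> rhomax (D eps) = B.
Hypothesis D_umax : forall eps, 0 < eps -> umax (D eps) = M.

Lemma weak_form_cvg phi pw : test_fun2 phi ->
  (fun eps => weak_form (fun x t => rho_eps (D eps) eps x t * weight pw (u_eps (D eps) eps x t))
     (u_eps (D eps) eps) phi) @ 0^'+ --> (0 : R).
Proof.
move=> /test_fun2_c1[A [K [A0 c1 cx ct]]].
have A1 : A < A + 1 by lra.
have B0 : 0 <= B.
  by rewrite -(D_rhomax ltr01); exact: le_trans (ltW (pcrho_gt0 _ 0)) (pcrho_le _ 0).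
have M0 : 0 <= M by rewrite -(D_umax ltr01); exact: umax_ge0.
have [Cst H] := weak_bound_small a A0 A1 (ltW (c1_K c1)) B0 M0 C1.
apply: cvg_at_right0 => eta eta0.
pose T := A + 1 + 2; have T0 : 0 < T by rewrite /T; lra.
pose d := Num.min (2^-1 / T) (eta / (`|Cst| + 1)).
have N1 : 0 < `|Cst| + 1 by rewrite ltr_wpDl.
have d0 : 0 < d by rewrite lt_min !divr_gt0.
exists (d ^+ 3); first exact: exprn_gt0.
move=> eps eps0 epsd; have := cube_root_lt d0 eps0 epsd.
rewrite -(D_minstep eps0) lt_min => /andP[dT dC].
have mE : minstep (D eps) ^+ 3 = eps by rewrite D_minstep// cube_rootK// ltW.
have dT' : minstep (D eps) * (A + 1 + 2) <= 2^-1 by rewrite -ler_pdivlMr//; exact: ltW.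
have [m [h1 h2 h3]] := H (D eps) eps mE dT' (D_node0 eps0) (D_step eps0) (D_rhomax eps0) (D_umax eps0).
rewrite sub0r normrN weak_form_balance.
apply: le_trans (weak_form_le eps0 c1 cx ct pw A0 A1 h1 h2) _; apply: le_trans h3 _.
have ms := minstep_gt0 (D eps).
apply: (@le_trans _ _ ((`|Cst| + 1) * minstep (D eps))).
  by rewrite ler_wpM2r ?(ltW ms)//; have := ler_norm Cst; lra.
by rewrite mulrC -ler_pdivlMr//; exact: ltW.
Qed.

(** Pointwise convergence under domination: a point right of [a] lies in a cell no longer than
    [C * minstep], whose state is sampled at its right end, and [g] is continuous. *)
Lemma initial_cvg (q : R -> R -> R) (val : pcdata R -> nat -> R) (g0 : R) (g : R -> R) (K : R)
    (psi : R -> R) :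
  {within `[a, +oo[%classic, continuous g} ->
  (forall eps, 0 < eps -> measurable_fun setT (q eps)) ->
  (forall eps x, 0 < eps -> `|q eps x| <= K) ->
  (forall eps x, 0 < eps -> exists i, cell_set (D eps) i x /\ q eps x = val (D eps) i) ->
  (forall eps i, 0 < eps -> val (D eps) i = sample g0 g (node (D eps)) i) ->
  test_fun1 psi ->
  (fun eps => \int[mu]_x (q eps x * psi x)) @ 0^'+ --> \int[mu]_x (jump_datum a g0 g x * psi x).
Proof.
move=> cg mq qK qval vals [dpsi [A psi0]].
have cpsi : continuous psi.
  by move=> x; apply: differentiable_continuous; apply/derivable1_diffP; exact: (dpsi 0%N x).
have [Kp HKp] := bounded_on_segment (- A) A cpsi.
apply: (bounded_pointwise_integrals (Kq := K) (A := A) (Kp := `|Kp|)) => //; last first.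
  move=> x; have [xA|xA] := ltP A `|x|; first by rewrite psi0// normr0.
  move: xA; rewrite ler_norml => /andP[h1 h2].
  exact: le_trans (HKp _ h1 h2) (ler_norm _).
move=> x; apply: cvg_at_right0 => eta eta0.
have [xa|ax] := leP x a.
  exists 1 => // eps eps0 _; have [i [ci ->]] := qval eps x eps0.
  have i0 : i = 0%N.
    case: i ci => // i /=; rewrite in_itv /= => /andP[Yx _].
    have := node_le (D eps) (leq0n i); rewrite (D_node0 eps0) => aY.
    by have := lt_le_trans Yx (le_trans xa aY); rewrite ltxx.
  by rewrite i0 (vals _ _ eps0) /jump_datum xa /= subrr normr0 ltW.
have xa : (x <= a) = false by rewrite leNgt ax.
have xI : `[a, +oo[%classic x by rewrite /= in_itv /= (ltW ax).
have := iffLR (subspace_continuousP _ _) cg x xI.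
move=> /cvgrPdist_le /(_ eta eta0); rewrite near_withinE => -[r r0 Hr].
have C0 : 0 < C by exact: lt_le_trans C1.
have rC : 0 < r / C by rewrite divr_gt0.
exists ((r / C) ^+ 3); first exact: exprn_gt0.
move=> eps eps0 epsr; have [i [ci ->]] := qval eps x eps0.
have := cube_root_lt rC eps0 epsr; rewrite -(D_minstep eps0) ltr_pdivlMr// => dr.
case: i ci => [|i] /=; rewrite in_itv /=.
  by move=> xY; exfalso; move: xY; rewrite (D_node0 eps0) xa.
move=> /andP[Yx xY]; rewrite (vals _ _ eps0) /= /jump_datum xa /=.
have st := D_step eps0 i; apply: Hr.
  rewrite /ball_ /= ltr_norml; apply/andP; split; rewrite mulrC in dr; lra.
by rewrite /= in_itv /= andbT; exact: le_trans (ltW ax) xY.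
Qed.

End Convergence.

Unset Implicit Arguments.

Theorem theorem5p3 (R : realType) (a : R) (rho u : R -> R) (rho0 u0 C : R)
    (Y : R -> nat -> R)
    (rho_cont : {within `[a, +oo[%classic, continuous rho})
    (u_cont : {within `[a, +oo[%classic, continuous u})
    (rho_bnd : [bounded rho x | x in `[a, +oo[%classic])
    (u_bnd : [bounded u x | x in `[a, +oo[%classic])
    (u_extr : finite_set (local_extremum `[a, +oo[%classic u))
    (rho_pos : forall x : R, a <= x -> 0 < rho x)
    (rho0_pos : 0 < rho0)
    (C_ge1 : 1 <= C)
    (Y_part : forall eps : R, 0 < eps -> Y eps 0%N = a /\
       forall i, eps `^ (3^-1) <= Y eps i.+1 - Y eps i <= C * eps `^ (3^-1)) :
  exists2 eps0 : R, 0 < eps0 &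
  exists (P : R -> pattern R) (rhoE uE : R -> R -> R -> R),
    [/\ forall eps : R, 0 < eps < eps0 ->
          let rs := sample rho0 rho (Y eps) in
          let us := sample u0 u (Y eps) in
          [/\ tracking (Y eps) rs us (P eps),
              admissible us (P eps) &
              represents (Y eps) rs us eps (P eps) (rhoE eps) (uE eps)],
        uniform_profiles eps0 P &
        approx_solution eps0 rhoE uE (jump_datum a rho0 rho) (jump_datum a u0 u)].
Proof.
have bounded_half (g : R -> R) : [bounded g x | x in `[a, +oo[%classic] ->
    exists Kg, forall x, a <= x -> `|g x| <= Kg.
  move=> [N [_ HN]]; exists (`|N| + 1) => x ax.
  have N1 : N < `|N| + 1 by have := ler_norm N; lra.
  by have := HN _ N1; rewrite /globally /=; apply; rewrite /= in_itv /= ax.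
have [Kr HKr] := bounded_half _ rho_bnd; have [Ku HKu] := bounded_half _ u_bnd.
pose B := Num.max rho0 Kr; pose M := Num.max `|u0| Ku.
have C0 : 0 < C by exact: lt_le_trans C_ge1.
have Y_ge eps i : 0 < eps -> a <= Y eps i.
  move=> e0; have [Y0 Yi] := Y_part eps e0; elim: i => [|i IH]; first by rewrite Y0.
  by have /andP[h _] := Yi i; have := powR_ge0 eps 3^-1; lra.
have exD eps : exists D : pcdata R, 0 < eps ->
    [/\ node D = Y eps, pcrho D = sample rho0 rho (Y eps) & pcu D = sample u0 u (Y eps)] /\
    [/\ minstep D = eps `^ 3^-1, rhomax D = B & umax D = M].
  have [e0|ne] := pselect (0 < eps); last first.
    (* For [eps <= 0] arbitrary data are supplied, constant states on integer nodes, since [choice]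
       produces a total function. *)
    have one (i : nat) : 1 <= i.+1%:R - i%:R :> R by rewrite -natr1 addrAC subrr add0r.
    have [D _] := pcdata_exists ltr01 one (fun=> rho0_pos) (fun=> lexx rho0) (fun=> lexx `|u0|).
    by exists D => e0; exfalso; apply: ne.
  have Yi i : eps `^ 3^-1 <= Y eps i.+1 - Y eps i by have [_ /(_ i) /andP[]] := Y_part eps e0.
  have r0 i : 0 < sample rho0 rho (Y eps) i by case: i => [//|i]; exact/rho_pos/Y_ge.
  have rB i : sample rho0 rho (Y eps) i <= B.
    rewrite le_max; case: i => [|i] /=; first by rewrite lexx.
    by rewrite (le_trans (ler_norm _) (HKr _ (Y_ge _ _ e0))) orbT.
  have vM i : `|sample u0 u (Y eps) i| <= M.
    rewrite le_max; case: i => [|i] /=; first by rewrite lexx.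
    by rewrite (HKu _ (Y_ge _ _ e0)) orbT.
  have [D HD] := pcdata_exists (powR_gt0 3^-1 e0) Yi r0 rB vM.
  by exists D.
have [D DP] := choice exD.
have D_minstep eps : 0 < eps -> minstep (D eps) = eps `^ 3^-1 by move=> /DP[_ []].
have D_node0 eps : 0 < eps -> node (D eps) 0 = a.
  by move=> e0; have [[-> _ _] _] := DP eps e0; have [] := Y_part eps e0.
have D_step eps : 0 < eps -> forall i, node (D eps) i.+1 - node (D eps) i <= C * minstep (D eps).
  move=> e0 i; rewrite D_minstep//; have [[-> _ _] _] := DP eps e0.
  by have [_ /(_ i) /andP[]] := Y_part eps e0.
have D_rhomax eps : 0 < eps -> rhomax (D eps) = B by move=> /DP[_ []].
have D_umax eps : 0 < eps -> umax (D eps) = M by move=> /DP[_ []].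
have measurable_initial (q : R -> R -> R) : measurable_fun setT (fun p : R * R => q p.1 p.2) ->
    measurable_fun setT (q^~ 0).
  move=> mq; have mp : measurable_fun setT (fun x : R => (x, 0 : R)).
    by apply: measurable_fun_pair; [exact: measurable_id|exact: measurable_cst].
  exact: measurableT_comp mq mp.
(* The construction works for every positive [eps], whence the arbitrary value 1; smallness of [eps]
   enters through the limits. *)
exists 1 => //; exists (fun eps => pc_pattern (D eps)), (fun eps => rho_eps (D eps) eps),
  (fun eps => u_eps (D eps) eps); split.
- move=> eps /andP[e0 _]; have [[nE rE uE] _] := DP eps e0.
  rewrite -rE -uE -nE; split; [exact: pc_tracking|exact: pc_admissible|exact: pc_represents].
- split.
    exists 1, 1, 1; split => // eps d w _ _ _ b.
    by rewrite profile_x// mul1r lexx.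
  move=> tau eta eta0; exists 1 => // eps d t w _ /andP[d0 _] sh lf _; split.
    by rewrite /= subrr normr0 ltW.
  by rewrite profile_mass// subrr normr0 ltW.
split.
- by move=> eps x t /andP[e0 _] _; exact: rho_eps_ge0.
- move=> phi tphi; have mass_false (E : pcdata R) eps :
      rho_eps E eps = (fun x t => rho_eps E eps x t * weight false (u_eps E eps x t)).
    by apply/funext => x; apply/funext => t; rewrite mulr1.
  split.
  + move=> eps /andP[e0 _]; split; last exact: (balance_integrable (D eps) true e0 tphi).
    rewrite {1}mass_false; exact: (balance_integrable (D eps) false e0 tphi).
  + have := weak_form_cvg C_ge1 D_minstep D_node0 D_step D_rhomax D_umax false tphi.
    by under eq_fun do rewrite -mass_false.
  + exact: (weak_form_cvg C_ge1 D_minstep D_node0 D_step D_rhomax D_umax true tphi).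
- move=> psi tpsi; split.
  + apply: (initial_cvg C_ge1 D_minstep D_node0 D_step (val := fun E i => pcrho E i) (K := B) rho_cont) tpsi.
    * by move=> eps e0; apply: measurable_initial; exact: measurable_rho_eps.
    * move=> eps x e0; have [i [_ -> _]] := initial_states (D eps) e0 x.
      by rewrite ger0_norm ?(ltW (pcrho_gt0 _ _))// -(D_rhomax eps e0) pcrho_le.
    * by move=> eps x e0; have [i [ci ri _]] := initial_states (D eps) e0 x; exists i.
    * by move=> eps i e0; have [[-> -> _] _] := DP eps e0.
  + apply: (initial_cvg C_ge1 D_minstep D_node0 D_step (val := fun E i => pcu E i) (K := M) u_cont) tpsi.
    * by move=> eps e0; apply: measurable_initial; exact: measurable_u_eps.
    * by move=> eps x e0; rewrite -(D_umax eps e0); exact: u_eps_bnd.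
    * by move=> eps x e0; have [i [ci _ ui]] := initial_states (D eps) e0 x; exists i.
    * by move=> eps i e0; have [[-> _ ->] _] := DP eps e0.
Qed.
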